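(* Let $n\ge1$, $1<p<\infty$, $p'=p/(p-1)$, and let $\alpha\ge 0$ and $\lambda$ be real numbers with $0<\lambda\le \frac n2-\alpha$. Assume that $\frac1p+\frac{\alpha+\lambda}{n}=1$, $\lambda<n$, $\alpha<\frac n{p'}$, $\alpha+2\lambda>\frac n{p'}$, $3\lambda<2n$, $\frac3p\ge1$ and $\frac2p\ge 1$. Let $$\Lambda(f_1,f_2,f_3)=\iiint_{(\mathbb R^n)^3}\frac{f_1(x)f_2(y)f_3(z)}{|x|^{\alpha}|y|^{\alpha}|z|^{\alpha}|x-y|^{\lambda}|x-z|^{\lambda}|y-z|^{\lambda}}\,dx\,dy\,dz$$ and $$C_A=\sup_{\|f_i\|_{L^p(\mathbb R^n)}=1,\ i=1,2,3}|\Lambda(f_1,f_2,f_3)| .$$ Then every triple $(f_1,f_2,f_3)$ of nonnegative functions in $L^p(\mathbb R^n)$ with $\|f_i\|_{L^p(\mathbb R^n)}=1$ for $i=1,2,3$ and $\Lambda(f_1,f_2,f_3)=C_A$ satisfies $$f_1= f_2= f_3\quad\text{a.e. in }\mathbb R^n .$$ Equivalently, setting $U_i:=f_i^{p-1}$, $i=1,2,3$, one has $U:=U_1= U_2= U_3$ a.e. Moreover, with $s=1/(p-1)$ and $C=C_A^{-1}$, the common function $U$ satisfies, for a.e. $x\in\mathbb R^n$, $$U(x)=C|x|^{-\alpha}\iint_{\mathbb R^n\times\mathbb R^n}\frac{U(y)^s|y|^{-\alpha}U(z)^s|z|^{-\alpha}}{|x-y|^\lambda|x-z|^\lambda|y-z|^\lambda}\,dy\,dz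 .$$
   Context: This is the fully symmetric case ($p_1=p_2=p_3=p$, $\alpha_1=\alpha_2=\alpha_3=\alpha$, $\alpha_{12}=\alpha_{13}=\alpha_{23}=\lambda$) of the trilinear Stein--Weiss form with weights $|x_i|^{-\alpha_i}$ and $|x_i-x_j|^{-\alpha_{ij}}$. It is a known theorem that under the stated assumptions there is a finite constant $C'$ with $|\Lambda(f_1,f_2,f_3)|\le C'\prod_{i=1}^3\|f_i\|_{L^p(\mathbb R^n)}$ for all $f_i\in L^p(\mathbb R^n)$, so that $C_A<\infty$. *)

(* Defs.v *)
From HB Require Import structures.
From mathcomp Require Import all_boot all_order all_algebra.
From mathcomp Require Import all_classical all_reals all_analysis.

Set Implicit Arguments.
Unset Strict Implicit.
Unset Printing Implicit Defensive.

Import Order.TTheory GRing.Theory Num.Theory.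
Import numFieldNormedType.Exports.

Local Open Scope classical_set_scope.
Local Open Scope ring_scope.

(* R^n, as an n-tuple with the product (equivalently Borel) sigma-algebra. *)
Notation Rn R n := (n.-tuple (measurableTypeR R)).

Definition rn_cons (R : realType) (n : nat)
    (w : measurableTypeR R * Rn R n) : Rn R n.+1 :=
  [the Rn R n.+1 of w.1 :: w.2].

Definition rn_uncons (R : realType) (n : nat)
    (t : Rn R n.+1) : measurableTypeR R * Rn R n :=
  (thead t, [tuple of behead t]).

Definition enorm (R : realType) (n : nat) (x : Rn R n) : R :=
  Num.sqrt (\sum_(i < n) tnth x i ^+ 2).

Definition edist (R : realType) (n : nat) (x y : Rn R n) : R :=
  Num.sqrt (\sum_(i < n) (tnth x i - tnth y i) ^+ 2).

Section lebesgue_step.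
Local Open Scope ereal_scope.
Context (R : realType) (n : nat).
Variable m : {sigma_finite_measure set (Rn R n) -> \bar R}.

Definition lebesgue_cons : set (Rn R n.+1) -> \bar R :=
  pushforward (@lebesgue_measure R \x m) (@rn_cons R n).

Lemma measurable_rn_cons : measurable_fun [set: _] (@rn_cons R n).
Proof. exact: measurable_cons. Qed.

Lemma measurable_rn_uncons :
  measurable_fun [set: _] (@rn_uncons R n).
Proof.
apply/measurable_fun_pairP; split; last exact: measurable_behead.
exact: measurable_tnth.
Qed.

Lemma rn_consK : cancel (@rn_cons R n) (@rn_uncons R n).
Proof. by case=> a t; congr pair => //; apply: val_inj. Qed.

Let lebesgue_cons0 : lebesgue_cons set0 = 0.
Proof. by rewrite /lebesgue_cons /pushforward preimage_set0 measure0. Qed.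

Let lebesgue_cons_ge0 A : 0 <= lebesgue_cons A.
Proof. by rewrite /lebesgue_cons /pushforward; exact: measure_ge0. Qed.

Let lebesgue_cons_sigma_additive : semi_sigma_additive lebesgue_cons.
Proof.
move=> F mF tF mUF; rewrite /lebesgue_cons /pushforward preimage_bigcup.
apply: measure_semi_sigma_additive.
- by move=> k; rewrite -[X in measurable X]setTI; exact: measurable_rn_cons.
- apply/trivIsetP => /= i j _ _ ij; rewrite -preimage_setI.
  by move/trivIsetP : tF => /(_ _ _ _ _ ij) ->//; rewrite preimage_set0.
- rewrite -preimage_bigcup -[X in measurable X]setTI.
  exact: measurable_rn_cons.
Qed.

HB.instance Definition _ := isMeasure.Build _ _ _ lebesgue_cons
  lebesgue_cons0 lebesgue_cons_ge0 lebesgue_cons_sigma_additive.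

Let lebesgue_cons_sigma_finite : sigma_finite setT lebesgue_cons.
Proof.
have /sigma_finiteP[F [TF ndF Foo]] := sigma_finiteT (@lebesgue_measure R).
have /sigma_finiteP[G [TG ndG Goo]] := sigma_finiteT m.
pose u := @rn_uncons R n.
exists (fun k => u @^-1` (F k `*` G k)).
  apply/seteqP; split => // t _.
  have [i _ Fi] : (\bigcup_k F k) (u t).1 by rewrite -TF.
  have [j _ Gj] : (\bigcup_k G k) (u t).2 by rewrite -TG.
  exists (maxn i j) => //; split => /=.
    by apply: subsetPset (Fi); exact/ndF/leq_maxl.
  by apply: subsetPset (Gj); exact/ndG/leq_maxr.
move=> k; have [mFk Fk_fin] := Foo k; have [mGk Gk_fin] := Goo k; split.
  rewrite -[X in measurable X]setTI.
  by apply: measurable_rn_uncons => //; exact: measurableX.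
rewrite /lebesgue_cons /pushforward.
have -> : @rn_cons R n @^-1` (u @^-1` (F k `*` G k)) = F k `*` G k.
  by rewrite -comp_preimage (_ : u \o _ = id)//; apply/funext; exact: rn_consK.
by rewrite product_measure1E// lte_mul_pinfty// ge0_fin_numE.
Qed.

HB.instance Definition _ := Measure_isSigmaFinite.Build _ _ _ lebesgue_cons
  lebesgue_cons_sigma_finite.

End lebesgue_step.

Section lebesgue_zero.
Context (R : realType).

Definition lebesgue_nil : set (Rn R 0) -> \bar R :=
  \d_([tuple] : Rn R 0).

HB.instance Definition _ := FiniteMeasure.on lebesgue_nil.

End lebesgue_zero.

Fixpoint lebesgue_Rn (R : realType) (n : nat) :
    {sigma_finite_measure set (Rn R n) -> \bar R} :=
  match n with
  | 0 => @lebesgue_nil R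
  | n'.+1 => lebesgue_cons (lebesgue_Rn R n')
  end.

Section lebesgue_box.
Local Open Scope ereal_scope.

Lemma lebesgue_Rn_box (R : realType) (n : nat)
    (A : 'I_n -> set (measurableTypeR R)) :
  (forall i, measurable (A i)) ->
  lebesgue_Rn R n [set t | forall i, A i (tnth t i)] =
  \prod_(i < n) lebesgue_measure (A i).
Proof.
elim: n A => [|n IH] A mA.
  rewrite big_ord0 /= /lebesgue_nil diracE mem_set//= => -[]//.
rewrite big_ord_recl /= /lebesgue_cons /pushforward.
pose B := [set t : Rn R n | forall i, A (lift ord0 i) (tnth t i)].
have mB : measurable B.
  have -> : B = \bigcap_(i : 'I_n) ((@tnth n _ ^~ i) @^-1` A (lift ord0 i)).
    by apply/seteqP; split => t /= Bt i; [move=> _; exact: Bt|exact: Bt].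
  apply: fin_bigcap_measurable => // i _.
  by rewrite -[X in measurable X]setTI; exact: measurable_tnth.
have -> : @rn_cons R n @^-1` [set t | forall i, A i (tnth t i)] =
    A ord0 `*` B.
  apply/seteqP; split => -[a t] /=.
    move=> Aat; split; first exact: (Aat ord0).
    by move=> i /=; have := Aat (lift ord0 i); rewrite tnthS.
  move=> [/= Aa Bt] i; have [j ->|->//] := unliftP ord0 i.
  by rewrite tnthS; exact: Bt.
by rewrite product_measure1E// (IH (fun i => A (lift ord0 i))).
Qed.

End lebesgue_box.

Section stein_weiss.
Context (R : realType) (n : nat).
Local Notation mu := (lebesgue_Rn R n).

(* Since 0 `^ (- a) = 0 for a != 0, the weight vanishes at the origin and the
   kernel on the diagonals instead of being infinite there; for n >= 1 these
   are null sets. *)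
Definition sw_weight (alpha : R) (x : Rn R n) : R := enorm x `^ (- alpha).

Definition sw_kernel (lambda : R) (x y z : Rn R n) : R :=
  edist x y `^ (- lambda) * edist x z `^ (- lambda) * edist y z `^ (- lambda).

Definition sw_form (alpha lambda : R) (f1 f2 f3 : Rn R n -> R) : \bar R :=
  (\int[mu \x mu \x mu]_w
     (f1 w.1.1 * f2 w.1.2 * f3 w.2
      * (sw_weight alpha w.1.1 * sw_weight alpha w.1.2 * sw_weight alpha w.2)
      * sw_kernel lambda w.1.1 w.1.2 w.2)%:E)%E.

Definition Lp_unit (p : R) : set (Rn R n -> R) :=
  [set f | f \in Lfun mu p%:E /\ 'N[mu]_(p%:E)[EFin \o f]%E = 1%E].

Definition sw_best_constant (p alpha lambda : R) : \bar R :=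
  ereal_sup [set c | exists f1 f2 f3, [/\ Lp_unit p f1, Lp_unit p f2,
    Lp_unit p f3 & c = `|sw_form alpha lambda f1 f2 f3|%E]].

End stein_weiss.

(* Main.v *)
From HB Require Import structures.
Require Import Defs.
From mathcomp Require Import all_boot all_order all_algebra.
From mathcomp Require Import all_classical all_reals all_analysis.
From mathcomp Require Import measurable_realfun ring lra.

(** The kernel [|x - y|^-lambda] is a superposition of products of Gaussians in [x]
    and in [y] with a common centre ([riesz_gauss]). Hence the energy
    [E(f, g)], the double integral of [f x * g y * |x - y|^-lambda], satisfies
    [2 E(f, g) <= E(f, f) + E(g, g)], and equality with a finite value forces the
    Gaussian transforms of [f] and [g] to agree. Gaussian transforms determine a
    function ([gaussian_unique]): equality of integrals against all Gaussians
    passes from a set to its part outside a ball, because powers of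
    [1 - gauss r c] approximate the indicator function of the outside of the ball
    while remaining combinations of Gaussians, and balls generate the measurable
    sets. So the energy is strictly positive definite ([energy_strict]).

    Freezing the third variable [z] turns the trilinear form into the energy of
    [f1] and [f2], each multiplied by the weight and by [|x - z|^-lambda]. For a
    maximising triple, averaging over [z] gives
    [Lambda(f1, f1, f3) + Lambda(f2, f2, f3) <= 2 Lambda(f1, f2, f3)], the reverse
    of the integrated energy inequality; therefore almost all slices are in the
    equality case and [f1 = f2] almost everywhere ([maximizer_eq12]). The symmetry
    of the form gives [f2 = f3].

    This argument needs the maximum to be finite, and only that: no explicit
    constant enters. Since [1 <= 2/p], the integrand is a geometric mean of the
    product of the [f^p] and of an integrand of the same shape for the
    square-integrable function [f^(p/2)] ([triform_finite_diag]). For the latter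
    the smallest of the three kernels is discarded and the remaining integrals
    are estimated by composing Riesz kernels ([star_finite_weighted]) or, in the
    absence of weights, by ordering the values of the function
    ([star_finite_unweighted]).

    Finally, with [F] the common function, the weighted potential [V] of [F] pairs with
    every function [h] of norm 1 to at most [C_A], with equality for [h = F].
    Comparing [F] with the pointwise maximiser of [t V / C_A - t^p / p], truncated
    so as to be admissible, gives [V = C_A F^(p-1)] by the strict form of Young's
    inequality ([dual_equality]); this is the Euler-Lagrange equation. *)

Import Order.TTheory GRing.Theory Num.Theory.
Import numFieldNormedType.Exports.

Local Open Scope classical_set_scope.
Local Open Scope ring_scope.

Set Implicit Arguments.
Unset Strict Implicit.
Unset Printing Implicit Defensive.

Local Notation edist := Defs.edist.

(** * Nonnegative integrals and product measures *)

Section measure_theory.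
Local Open Scope ereal_scope.
Context d (T : measurableType d) (R : realType).
Variable m : {measure set T -> \bar R}.

(** The engine of every equality case below: a pointwise inequality whose
    integrated form is reversed is an equality almost everywhere. *)
Lemma ae_eq_of_integral_le (f g : T -> \bar R) :
  measurable_fun setT f -> measurable_fun setT g ->
  (forall x, 0 <= g x) -> (forall x, g x <= f x) ->
  \int[m]_x f x <= \int[m]_x g x -> \int[m]_x g x < +oo ->
  {ae m, forall x, f x = g x}.
Proof.
move=> mf mg g0 gf fg goo.
have f0 x : 0 <= f x by exact: le_trans (gf x).
have foo : \int[m]_x f x < +oo by exact: le_lt_trans goo.
have fi : m.-integrable setT f.
  by apply/integrableP; split => //; under eq_integral do rewrite gee0_abs//.
suff : ae_eq m setT f g by apply: filterS => x /(_ I).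
apply: integral_ae_eq => // E _ mE.
have split_ h : measurable_fun setT h -> (forall x, 0 <= h x) ->
    \int[m]_x h x = \int[m]_(x in E) h x + \int[m]_(x in ~` E) h x.
  move=> mh h0; rewrite -ge0_integral_setU ?setUv//; first exact: measurableC.
  by apply/disj_setPRL.
have le1 : \int[m]_(x in E) g x <= \int[m]_(x in E) f x.
  by apply: ge0_le_integral => //; exact: measurable_funTS.
have le2 : \int[m]_(x in ~` E) g x <= \int[m]_(x in ~` E) f x.
  by apply: ge0_le_integral => //;
    [exact: measurableC|exact: measurable_funTS|exact: measurable_funTS].
apply/eqP; rewrite eq_le le1 andbT.
move: fg goo foo; rewrite (split_ f)// (split_ g)//.
move: le1 le2.
have : 0 <= \int[m]_(x in E) g x by apply: integral_ge0.
have : 0 <= \int[m]_(x in ~` E) g x by apply: integral_ge0.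
have : 0 <= \int[m]_(x in E) f x by apply: integral_ge0.
have : 0 <= \int[m]_(x in ~` E) f x by apply: integral_ge0.
move: (\int[m]_(x in E) g x) (\int[m]_(x in ~` E) g x) (\int[m]_(x in E) f x)
  (\int[m]_(x in ~` E) f x) => [a||] [b||] [c||] [e||] //=.
by rewrite -!EFinD !lee_fin => *; lra.
Qed.

Lemma ae_eq0_of_integral (f : T -> \bar R) :
  measurable_fun setT f -> (forall x, 0 <= f x) -> \int[m]_x f x = 0 ->
  {ae m, forall x, f x = 0}.
Proof.
move=> mf f0 fint; have : \int[m]_x `|f x| = 0.
  by under eq_integral do rewrite gee0_abs//.
move/(ae_eq_integral_abs m measurableT mf).
by apply: filterS => x /(_ I).
Qed.

Lemma ge0_integral_realZ (k : R) (h : T -> R) :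
  measurable_fun setT h -> (0 <= k)%R -> (forall x, 0 <= h x)%R ->
  \int[m]_x (k * h x)%:E = k%:E * \int[m]_x (h x)%:E.
Proof.
move=> mh k0 h0; under eq_integral do rewrite EFinM.
rewrite ge0_integralZl_EFin//; first by move=> x _; rewrite lee_fin.
exact/measurable_EFinP.
Qed.

Lemma ge0_integral_realD (h1 h2 : T -> R) :
  measurable_fun setT h1 -> measurable_fun setT h2 ->
  (forall x, 0 <= h1 x)%R -> (forall x, 0 <= h2 x)%R ->
  \int[m]_x (h1 x + h2 x)%:E = \int[m]_x (h1 x)%:E + \int[m]_x (h2 x)%:E.
Proof.
move=> mh1 mh2 h10 h20; under eq_integral do rewrite EFinD.
rewrite ge0_integralD//.
- by move=> x _; rewrite lee_fin.
- exact/measurable_EFinP.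
- by move=> x _; rewrite lee_fin.
- exact/measurable_EFinP.
Qed.

Lemma ge0_le_integral_real (h1 h2 : T -> R) :
  measurable_fun setT h1 -> measurable_fun setT h2 ->
  (forall x, 0 <= h1 x)%R -> (forall x, h1 x <= h2 x)%R ->
  \int[m]_x (h1 x)%:E <= \int[m]_x (h2 x)%:E.
Proof.
move=> mh1 mh2 h10 h12; apply: ge0_le_integral => //.
- by move=> x _; rewrite lee_fin.
- exact/measurable_EFinP.
- exact/measurable_EFinP.
- by move=> x _; rewrite lee_fin.
Qed.

End measure_theory.

Section product_null.
Local Open Scope ereal_scope.
Context d1 d2 (T1 : measurableType d1) (T2 : measurableType d2) (R : realType).
Variable m1 : {sigma_finite_measure set T1 -> \bar R}.
Variable m2 : {sigma_finite_measure set T2 -> \bar R}.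

Lemma product_measure_sigma_finite : sigma_finite setT (m1 \x m2).
Proof.
have /sigma_finiteP[F [TF ndF Foo]] := sigma_finiteT m1.
have /sigma_finiteP[G [TG ndG Goo]] := sigma_finiteT m2.
exists (fun n => F n `*` G n).
  apply/seteqP; split => // -[x y] _.
  have [i _ Fi] : (\bigcup_k F k) x by rewrite -TF.
  have [j _ Gj] : (\bigcup_k G k) y by rewrite -TG.
  exists (maxn i j) => //; split => /=.
    by apply: subsetPset (Fi); exact/ndF/leq_maxl.
  by apply: subsetPset (Gj); exact/ndG/leq_maxr.
move=> k; have [mFk Fk_fin] := Foo k; have [mGk Gk_fin] := Goo k; split.
  exact: measurableX.
by rewrite product_measure1E// lte_mul_pinfty// ge0_fin_numE.
Qed.

(** The sigma-finite structure is attached explicitly so that a product measure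
    can itself be a factor of a further product. *)
Definition product_sf : {sigma_finite_measure set (T1 * T2)%type -> \bar R} :=
  HB.pack (m1 \x m2) (Measure_isSigmaFinite.Build _ _ _ (m1 \x m2) product_measure_sigma_finite).

Lemma ae_prod_fst (P : T1 -> Prop) :
  {ae m1, forall x, P x} -> {ae m1 \x m2, forall w, P w.1}.
Proof.
move=> [N [mN N0 PN]]; exists (N `*` setT); split.
- exact: measurableX.
- rewrite product_measure1E//; transitivity (0 * m2 setT); last exact: mul0e.
  by congr (_ * _); exact: N0.
- by move=> w /= Pw; split => //; exact: PN.
Qed.

Lemma ae_prod_snd (P : T2 -> Prop) :
  {ae m2, forall x, P x} -> {ae m1 \x m2, forall w, P w.2}.
Proof.
move=> [N [mN N0 PN]]; exists (setT `*` N); split.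
- exact: measurableX.
- rewrite product_measure1E//; transitivity (m1 setT * 0); last exact: mule0.
  by congr (_ * _); exact: N0.
- by move=> w /= Pw; split => //; exact: PN.
Qed.

End product_null.

(** * Euclidean distance on tuples *)

Section euclid.
Context (R : realType) (n : nat).
Implicit Types x y z : Rn R n.

Definition sqdist x y : R := \sum_(i < n) (tnth x i - tnth y i) ^+ 2.

Definition origin : Rn R n := [tuple of nseq n 0].

Lemma sqdist_ge0 x y : 0 <= sqdist x y.
Proof. by apply: sumr_ge0 => i _; exact: sqr_ge0. Qed.

Lemma edist_ge0 x y : 0 <= edist x y.
Proof. exact: sqrtr_ge0. Qed.

Lemma sqr_edist x y : edist x y ^+ 2 = sqdist x y.
Proof. by rewrite /edist sqr_sqrtr// sqdist_ge0. Qed.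

Lemma edistC x y : edist x y = edist y x.
Proof.
by rewrite /edist; congr Num.sqrt; apply: eq_bigr => i _; rewrite -sqrrN opprB.
Qed.

Lemma enormE x : enorm x = edist origin x.
Proof.
rewrite /enorm /edist; congr Num.sqrt; apply: eq_bigr => i _.
by rewrite tnth_nseq sub0r sqrrN.
Qed.

Lemma edist_eq0 x y : edist x y = 0 -> x = y.
Proof.
move=> xy; have : sqdist x y = 0 by rewrite -sqr_edist xy expr0n.
move/eqP; rewrite psumr_eq0; last by move=> i _; exact: sqr_ge0.
move/allP => h; apply: eq_from_tnth => i.
by have := h i (mem_index_enum i); rewrite sqrf_eq0 subr_eq0 => /eqP.
Qed.

Lemma edist_gt0 x y : x <> y -> 0 < edist x y.
Proof.
move=> xy; rewrite lt_neqAle edist_ge0 andbT eq_sym; apply/eqP => /edist_eq0.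
exact: xy.
Qed.

Lemma edistxx x : edist x x = 0.
Proof. by rewrite /edist big1 ?sqrtr0// => i _; rewrite subrr expr0n. Qed.

(** Convexity of the square gives the triangle inequality up to a constant; the
    integral estimates are insensitive to that constant. *)
Lemma sqdist_triangle x y z :
  sqdist x z <= 2 * sqdist x y + 2 * sqdist y z.
Proof.
rewrite /sqdist !mulr_sumr -big_split /=; apply: ler_sum => i _.
move: (tnth x i) (tnth y i) (tnth z i) => a b c.
by have := sqr_ge0 ((a - b) - (b - c)); rewrite !expr2; lra.
Qed.

Lemma edist_coord x y i : `|tnth x i - tnth y i| <= edist x y.
Proof.
rewrite -[leLHS]ger0_norm// -sqrtr_sqr ler_wsqrtr// real_normK ?num_real//.
by rewrite (bigD1 i)//= lerDl sumr_ge0// => j _; exact: sqr_ge0.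
Qed.

End euclid.
Arguments origin {R n}.

Section measurability.
Context (R : realType) (n : nat) d (T : measurableType d).

Lemma measurable_sqdist (f g : T -> Rn R n) :
  measurable_fun setT f -> measurable_fun setT g ->
  measurable_fun setT (fun t => sqdist (f t) (g t)).
Proof.
move=> mf mg; apply: measurable_sum => i; apply: measurable_funX.
by apply: measurable_funB;
  [exact: (measurableT_comp (measurable_tnth i) mf)
  |exact: (measurableT_comp (measurable_tnth i) mg)].
Qed.

Lemma measurable_edist (f g : T -> Rn R n) :
  measurable_fun setT f -> measurable_fun setT g ->
  measurable_fun setT (fun t => edist (f t) (g t)).
Proof.
move=> mf mg; apply: (@measurableT_comp _ _ _ _ _ _ (@Num.sqrt R)).
  apply: continuous_measurable_fun; exact: sqrt_continuous.
exact: measurable_sqdist.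
Qed.

Lemma measurable_powRl (f : T -> R) (a : R) :
  measurable_fun setT f -> measurable_fun setT (fun t => f t `^ a).
Proof. by move=> mf; exact: (measurableT_comp (measurable_powR a) mf). Qed.

Lemma measurable_expR_comp (f : T -> R) :
  measurable_fun setT f -> measurable_fun setT (fun t => expR (f t)).
Proof. by move=> mf; exact: (measurableT_comp (@measurable_expR R) mf). Qed.

End measurability.

(** * Balls and dyadic estimates *)

Section balls.
Context (R : realType) (n : nat).
Local Notation mu := (lebesgue_Rn R n).

Definition eball (c : Rn R n) (r : R) : set (Rn R n) := [set y | edist c y <= r].

Lemma measurable_eball (c : Rn R n) (r : R) :
  measurable (eball c r).
Proof.
have m1 : measurable_fun setT (fun y => edist c y).
  by apply: measurable_edist => //; exact: measurable_cst.
rewrite -[X in measurable X]setTI.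
have -> : eball c r = (fun y => edist c y) @^-1` `]-oo, r].
  by apply/seteqP; split => y /=; rewrite in_itv.
exact: m1.
Qed.

Lemma measurable_box (A : 'I_n -> set (measurableTypeR R)) :
  (forall i, measurable (A i)) ->
  measurable [set t : Rn R n | forall i, A i (tnth t i)].
Proof.
move=> mA; have -> : [set t : Rn R n | forall i, A i (tnth t i)] =
    \bigcap_(i : 'I_n) ((@tnth n _ ^~ i) @^-1` A i).
  by apply/seteqP; split => t /= At i; [move=> _; exact: At|exact: At].
apply: fin_bigcap_measurable => // i _.
by rewrite -[X in measurable X]setTI; exact: measurable_tnth.
Qed.

(** The volume of the circumscribed cube; only the power of [r] matters. *)
Lemma lebesgue_ball_le (c : Rn R n) (r : R) : 0 <= r ->
  (mu (eball c r) <= ((2 * r) ^+ n)%:E)%E.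
Proof.
move=> r0.
pose A (i : 'I_n) : set (measurableTypeR R) := `[tnth c i - r, tnth c i + r]%classic.
have mA i : measurable (A i) by exact: measurable_itv.
have mB := measurable_box mA.
have sub : (eball c r) `<=` [set t : Rn R n | forall i, A i (tnth t i)].
  move=> y /= cy i; rewrite /A /= in_itv /=.
  have := le_trans (edist_coord c y i) cy; rewrite ler_norml => /andP[? ?].
  by apply/andP; split; lra.
apply: (@le_trans _ _ (mu [set t : Rn R n | forall i, A i (tnth t i)])).
  by apply: le_measure => //; rewrite inE//; exact: measurable_eball.
rewrite lebesgue_Rn_box//.
rewrite (eq_bigr (fun=> (2 * r)%:E)) => [|i _].
  by rewrite prodEFin prodr_const card_ord.
rewrite /A lebesgue_measure_itv/= lte_fin; case: ifPn => [_|].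
  by rewrite -EFinB; congr EFin; ring.
by rewrite -leNgt => h; congr EFin; lra.
Qed.

Lemma lebesgue_point (c : Rn R n) : (0 < n)%N -> mu [set c] = 0%E.
Proof.
case: n c => // k c _.
have -> : [set c] = [set t : Rn R k.+1 | forall i, [set tnth c i] (tnth t i)].
  apply/seteqP; split => t /=; first by move=> -> .
  by move=> h; apply: eq_from_tnth => i; exact: h.
pose A (i : 'I_k.+1) : set (measurableTypeR R) := [set tnth c i].
have mA i : measurable (A i) by exact: measurable_set1.
have := @lebesgue_Rn_box R k.+1 A mA.
by rewrite big_ord_recl {2}/A lebesgue_measure_set1 mul0e.
Qed.

Lemma ae_neq (c : Rn R n) : (0 < n)%N -> {ae mu, forall y, y <> c}.
Proof.
move=> n0; exists [set c]; split => //; last 2 first.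
  exact: lebesgue_point.
  by move=> y /= /contrapT.
have -> : [set c] = eball c 0.
  apply/seteqP; split => y /=; first by move=> ->; rewrite /eball/= edistxx.
  rewrite /eball/= => h; apply/esym/edist_eq0/eqP.
  by rewrite eq_le h edist_ge0.
exact: measurable_eball.
Qed.

(** Summing over the dyadic shell that contains [y]: [h] is below the series of
    the functions [a k * \1_(eball c (r k))], which is integrated termwise and
    dominated by a geometric series. *)
Lemma integral_dyadic_le (c : Rn R n) (h : Rn R n -> R) (a r : nat -> R)
    (D q : R) :
  measurable_fun setT h -> (forall y, 0 <= h y) ->
  (forall k, 0 <= a k) -> (forall k, 0 <= r k) -> 0 <= D -> 0 <= q < 1 ->
  (forall y, exists k, h y <= a k * \1_(eball c (r k)) y) ->
  (forall k, a k * (2 * r k) ^+ n <= D * q ^+ k) ->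
  (\int[mu]_y (h y)%:E <= (D / (1 - q))%:E)%E.
Proof.
move=> mh h0 a0 r0 D0 /andP[q0 q1] hk ak.
have mball k : measurable_fun setT (\1_(eball c (r k)) : Rn R n -> R).
  exact: measurable_indic (measurable_eball c (r k)).
pose F k y := (a k * \1_(eball c (r k)) y)%:E.
have F0 k y : (0 <= F k y)%E by rewrite lee_fin mulr_ge0.
have mF k : measurable_fun setT (F k).
  by apply/measurable_EFinP; apply: measurable_funM.
have hF y : ((h y)%:E <= \sum_(k <oo) F k y)%E.
  have [k hky] := hk y; apply: (@le_trans _ _ (F k y)); first by rewrite lee_fin.
  apply: (@le_trans _ _ (\sum_(0 <= i < k.+1) F i y)%E).
    by rewrite big_nat_recr//= leeDr// sume_ge0.
  exact: nneseries_lim_ge.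
apply: (@le_trans _ _ (\int[mu]_y (\sum_(k <oo) F k y))%E).
  apply: ge0_le_integral => //.
  - by move=> y _; rewrite lee_fin.
  - exact/measurable_EFinP.
  - exact: ge0_emeasurable_sum.
rewrite integral_nneseries//.
apply: (@le_trans _ _ (\sum_(k <oo) (D * q ^+ k)%:E)%E).
  apply: lee_nneseries => [k _ _|k _]; first exact: integral_ge0.
  rewrite /F; under eq_integral do rewrite EFinM.
  rewrite ge0_integralZl_EFin//; last exact/measurable_EFinP.
  rewrite integral_indic//; last exact: measurable_eball.
  rewrite setIT.
  apply: (@le_trans _ _ (a k * (2 * r k) ^+ n)%:E); last first.
    by rewrite lee_fin; exact: ak.
  by rewrite EFinM lee_wpmul2l ?lee_fin//; exact: lebesgue_ball_le.
have cv : (fun k => \sum_(0 <= i < k) (D * q ^+ i)%:E)%E @ \oo --> (D / (1 - q))%:E.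
  rewrite (_ : (fun _ => _) = EFin \o series (geometric D q)); last first.
    by apply/funext => k; rewrite /= sumEFin.
  apply/cvg_EFin; first by near=> k.
  by apply: cvg_geometric_series; rewrite ger0_norm.
by rewrite (cvg_lim _ cv).
Unshelve. all: by end_near.
Qed.

End balls.

Section radial.
Context (R : realType) (n : nat).
Local Notation mu := (lebesgue_Rn R n).

Lemma dyadic_small (x r : R) : 0 < x -> x <= r ->
  exists k, 2 ^- k.+1 * r < x <= 2 ^- k * r.
Proof.
move=> x0 xr; have r0 : 0 < r by exact: lt_le_trans xr.
have ex : exists k, 2 ^- k.+1 * r < x.
  have : (fun k => 2^-1 ^+ k * r) @ \oo --> 0 * r.
    by apply: cvgMl; apply: cvg_expr; rewrite ger0_norm ?invf_lt1 ?ltr1n.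
  rewrite mul0r => /cvgr_lt /(_ _ x0) [N _ /(_ N.+1 (leqnSn N)) /= h].
  by exists N; rewrite -exprVn.
pose k := ex_minn ex; exists k; rewrite /k; case: ex_minnP => {}k -> kmin /=.
case: k kmin => [_|k kmin]; first by rewrite expr0 invr1 mul1r.
by rewrite leNgt; apply/negP => /kmin; rewrite ltnn.
Qed.

Lemma dyadic_large (x r : R) : 0 < r -> r < x ->
  exists k, 2 ^+ k * r < x <= 2 ^+ k.+1 * r.
Proof.
move=> r0 rx; have x0 : 0 < x by exact: lt_trans rx.
have ex : exists k, x <= 2 ^+ k.+1 * r.
  have [k /andP[h _]] := dyadic_small r0 (ltW rx).
  exists k; apply: ltW; rewrite -(ltr_pM2l (_ : 0 < 2 ^- k.+1)) ?invr_gt0 ?exprn_gt0//.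
  by rewrite mulrA mulVf ?mul1r// expf_neq0.
pose k := ex_minn ex; exists k; rewrite /k; case: ex_minnP => {}k -> kmin /=.
rewrite andbT; case: k kmin => [_|k kmin]; first by rewrite expr0 mul1r.
by rewrite ltNge; apply/negP => /kmin; rewrite ltnn.
Qed.

End radial.

(** * Integrals of powers of the distance *)

Section power_integrals.
Context (R : realType) (n : nat).
Local Notation mu := (lebesgue_Rn R n).

Lemma powR_expr (x a : R) k : 0 <= x -> (x ^+ k) `^ a = (x `^ a) ^+ k.
Proof. by move=> x0; rewrite -(powR_mulrn k x0) -(powR_mulrn k (powR_ge0 _ _)) powRAC. Qed.

Lemma ler_powRN (a x y : R) : 0 <= a -> 0 < x -> x <= y -> y `^ (- a) <= x `^ (- a).
Proof.
move=> a0 x0 xy; have y0 : 0 < y by exact: lt_le_trans xy.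
rewrite !powRN lef_pV2 ?posrE ?powR_gt0//.
by apply: ge0_ler_powR => //; rewrite nnegrE ltW.
Qed.

Lemma measurable_edist_powR (c : Rn R n) (a : R) :
  measurable_fun setT (fun y => edist c y `^ a).
Proof.
apply: measurable_powRl.
exact: (measurable_edist (measurable_cst c) (@measurable_id _ _ setT)).
Qed.

(** On the shell where the distance is about [2^-k r] the integrand is about
    [(2^-k r)^-s] and the volume about [(2^-k r)^n], whence the ratio
    [2^(s-n) < 1]; the next lemma runs through the shells outside the ball. *)
Lemma integral_edist_near (s : R) : 0 <= s < n%:R -> exists2 C : R, 0 <= C &
  forall (c : Rn R n) (r : R), 0 < r ->
  (\int[mu]_y (\1_(eball c r) y * edist c y `^ (- s))%:E
    <= (C * r `^ (n%:R - s))%:E)%E.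
Proof.
move=> /andP[s0 sn]; pose q : R := 2^-1 `^ (n%:R - s).
have q01 : 0 <= q < 1.
  rewrite powR_ge0 /= /q [ltRHS](_ : 1 = 1 `^ (n%:R - s)); last by rewrite powR1.
  rewrite gt0_ltr_powR ?subr_gt0// ?nnegrE//.
  by rewrite invf_lt1// ltr1n.
exists (2 `^ s * 2 ^+ n / (1 - q)).
  rewrite !mulr_ge0 ?powR_ge0 ?exprn_ge0// invr_ge0 subr_ge0 ltW//.
  by case/andP: q01.
move=> c r r0.
have p2 k : (0 : R) < 2 ^- k by rewrite invr_gt0 exprn_gt0.
rewrite mulrAC.
apply: (@integral_dyadic_le _ _ c _ (fun k => (2 ^- k.+1 * r) `^ (- s))
  (fun k => 2 ^- k * r)).
- apply: measurable_funM; last exact: measurable_edist_powR.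
  exact: measurable_indic (measurable_eball c r).
- by move=> y; rewrite mulr_ge0 ?powR_ge0.
- by move=> k; rewrite powR_ge0.
- by move=> k; rewrite mulr_ge0 ?ltW.
- by rewrite !mulr_ge0 ?powR_ge0 ?exprn_ge0.
- exact: q01.
- move=> y; have [yr|yr] := boolP (y \in eball c r); last first.
    exists 0%N; rewrite {1}indicE (negbTE yr) mul0r mulr_ge0 ?powR_ge0//.
  rewrite {1}indicE yr mul1r.
  have [y0|/eqP y0] := eqVneq (edist c y) 0.
    exists 0%N; rewrite y0; have [->|sn0] := eqVneq s 0.
      by rewrite oppr0 !powRr0 mul1r indicE mem_set// /eball /= y0 mulr_ge0 ?ltW.
    by rewrite powR0 ?oppr_eq0// mulr_ge0 ?powR_ge0.
  have d0 : 0 < edist c y by rewrite lt_neqAle edist_ge0 andbT eq_sym; exact/eqP.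
  move: yr; rewrite inE /eball /= => yr.
  have [k /andP[k1 k2]] := dyadic_small d0 yr; exists k.
  rewrite indicE mem_set// mulr1; apply: ler_powRN => //; last exact: ltW.
  by rewrite mulr_gt0.
- move=> k; set w := 2 ^- k.
  have -> : 2 ^- k.+1 = w / 2 by rewrite exprS invfM mulrC.
  have w0 : 0 < w by exact: p2.
  have e1 : (w / 2 * r) `^ (- s) = 2 `^ s * (w * r) `^ (- s).
    rewrite (_ : w / 2 * r = 2^-1 * (w * r)); last by ring.
    rewrite powRM ?mulr_ge0 ?invr_ge0 ?ltW//; congr (_ * _).
    by rewrite -powR_inv1// -powRrM mulN1r opprK.
  have wr : 0 < w * r by rewrite mulr_gt0.
  have e2 : w * r != 0 by rewrite gt_eqF.
  rewrite e1 exprMn.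
  rewrite (_ : _ * _ * _ = 2 `^ s * 2 ^+ n * ((w * r) `^ (- s) * (w * r) ^+ n)); last by ring.
  rewrite -(powR_mulrn n (ltW wr)) -powRD; last by rewrite e2 implybT.
  rewrite -!mulrA ler_wpM2l ?powR_ge0// ler_wpM2l ?exprn_ge0//.
  rewrite [- s + _]addrC (powRM _ (ltW w0) (ltW r0)) mulrC ler_wpM2l ?powR_ge0//.
  by rewrite /w /q -exprVn powR_expr.
Qed.

Lemma integral_edist_far (s : R) : n%:R < s -> exists2 C : R, 0 <= C &
  forall (c : Rn R n) (r : R), 0 < r ->
  (\int[mu]_y (\1_(~` eball c r) y * edist c y `^ (- s))%:E
    <= (C * r `^ (n%:R - s))%:E)%E.
Proof.
move=> sn; pose q : R := 2 `^ (n%:R - s).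
have s0 : 0 <= s by rewrite ltW// (le_lt_trans _ sn).
have q01 : 0 <= q < 1.
  rewrite powR_ge0 /= /q -opprB powRN invf_lt1 ?powR_gt0//.
  rewrite [ltLHS](_ : 1 = 1 `^ (s - n%:R)); last by rewrite powR1.
  rewrite gt0_ltr_powR ?subr_gt0// ?nnegrE//.
  by rewrite ltr1n.
exists (4 ^+ n / (1 - q)).
  rewrite !mulr_ge0 ?exprn_ge0// invr_ge0 subr_ge0 ltW//.
  by case/andP: q01.
move=> c r r0.
have p2 k : (0 : R) < 2 ^+ k by rewrite exprn_gt0.
rewrite mulrAC.
apply: (@integral_dyadic_le _ _ c _ (fun k => (2 ^+ k * r) `^ (- s))
  (fun k => 2 ^+ k.+1 * r)).
- apply: measurable_funM; last exact: measurable_edist_powR.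
  exact: measurable_indic (measurableC (measurable_eball c r)).
- by move=> y; rewrite mulr_ge0 ?powR_ge0.
- by move=> k; rewrite powR_ge0.
- by move=> k; rewrite mulr_ge0 ?ltW.
- by rewrite !mulr_ge0 ?powR_ge0 ?exprn_ge0.
- exact: q01.
- move=> y; have [yr|yr] := boolP (y \in ~` eball c r); last first.
    exists 0%N; rewrite {1}indicE (negbTE yr) mul0r mulr_ge0 ?powR_ge0//.
  rewrite {1}indicE yr mul1r.
  move: yr; rewrite inE /eball /= => /negP; rewrite -ltNge => yr.
  have [k /andP[k1 k2]] := dyadic_large r0 yr; exists k.
  rewrite indicE mem_set// mulr1; apply: ler_powRN => //; last exact: ltW.
  by rewrite mulr_gt0.
- move=> k; set w := 2 ^+ k.
  have -> : 2 * (2 ^+ k.+1 * r) = 4 * (w * r) by rewrite exprS /w; ring.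
  have w0 : 0 < w by exact: p2.
  have wr : 0 < w * r by rewrite mulr_gt0.
  have e2 : w * r != 0 by rewrite gt_eqF.
  rewrite exprMn mulrCA -(powR_mulrn n (ltW wr)) -powRD; last by rewrite e2 implybT.
  rewrite -!mulrA ler_wpM2l ?exprn_ge0//.
  rewrite [- s + _]addrC (powRM _ (ltW w0) (ltW r0)) mulrC ler_wpM2l ?powR_ge0//.
  by rewrite /w /q powR_expr.
Qed.

(** With [r] the distance from [c] to [x], near [c] the second kernel is at most
    [(r/4)^-t], near [x] the first one is at most [(r/4)^-s], and elsewhere both
    distances are comparable, so that the product behaves like
    [|c - z|^(-s-t)]. Each of the three pieces scales like [r^(n-s-t)]. *)
Lemma integral_riesz_le (s t : R) : 0 <= s < n%:R -> 0 <= t < n%:R ->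
  n%:R < s + t -> exists2 C : R, 0 <= C &
  forall c x : Rn R n, 0 < edist c x ->
  (\int[mu]_z (edist c z `^ (- s) * edist x z `^ (- t))%:E
    <= (C * edist c x `^ (n%:R - s - t))%:E)%E.
Proof.
move=> hs ht st.
have [C1 C10 near1] := integral_edist_near hs.
have [C2 C20 near2] := integral_edist_near ht.
have [C3 C30 far3] := integral_edist_far st.
have [s0 t0] : 0 <= s /\ 0 <= t by case/andP: hs; case/andP: ht.
pose e : R := n%:R - s - t.
exists (4 `^ (- e) * (C1 + C2) + 6 `^ t * C3 * 4 `^ (- e)).
  by rewrite addr_ge0// !mulr_ge0 ?powR_ge0// addr_ge0.
move=> c x cx; set r := edist c x in cx *.
have r4 : 0 < r / 4 by rewrite divr_gt0.
pose h1 z : R := \1_(eball c (r / 4)) z * edist c z `^ (- s).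
pose h2 z : R := \1_(eball x (r / 4)) z * edist x z `^ (- t).
pose h3 z : R := \1_(~` eball c (r / 4)) z * edist c z `^ (- (s + t)).
have mh1 : measurable_fun setT h1.
  apply: measurable_funM; last exact: measurable_edist_powR.
  exact: measurable_indic (measurable_eball c _).
have mh2 : measurable_fun setT h2.
  apply: measurable_funM; last exact: measurable_edist_powR.
  exact: measurable_indic (measurable_eball x _).
have mh3 : measurable_fun setT h3.
  apply: measurable_funM; last exact: measurable_edist_powR.
  exact: measurable_indic (measurableC (measurable_eball c _)).
have h1E z : h1 z = \1_(eball c (r / 4)) z * edist c z `^ (- s) by [].
have h2E z : h2 z = \1_(eball x (r / 4)) z * edist x z `^ (- t) by [].
have h3E z : h3 z = \1_(~` eball c (r / 4)) z * edist c z `^ (- (s + t)) by [].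
have i1 : (\int[mu]_z (h1 z)%:E <= (C1 * (r / 4) `^ (n%:R - s))%:E)%E.
  exact: near1.
have i2 : (\int[mu]_z (h2 z)%:E <= (C2 * (r / 4) `^ (n%:R - t))%:E)%E.
  exact: near2.
have i3 : (\int[mu]_z (h3 z)%:E <= (C3 * (r / 4) `^ (n%:R - (s + t)))%:E)%E.
  exact: far3.
have rE : edist c x = r by [].
have eE : e = n%:R - s - t by [].
clear near1 near2 far3; clearbody h1 h2 h3 r e.
have h10 z : 0 <= h1 z by rewrite h1E mulr_ge0 ?powR_ge0.
have h20 z : 0 <= h2 z by rewrite h2E mulr_ge0 ?powR_ge0.
have h30 z : 0 <= h3 z by rewrite h3E mulr_ge0 ?powR_ge0.
have tri (z u v : Rn R n) : edist u v ^+ 2 <= 2 * edist u z ^+ 2 + 2 * edist z v ^+ 2.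
  by rewrite !sqr_edist sqdist_triangle.
have big (z u v : Rn R n) : edist u v = r -> edist u z <= r / 4 -> r / 4 <= edist v z.
  move=> uv uz; have := tri z u v; rewrite uv (edistC v).
  have := edist_ge0 z v; have := edist_ge0 u z.
  move: (edist u z) (edist z v) uz => a b; rewrite !expr2; nra.
have dom z : edist c z `^ (- s) * edist x z `^ (- t) <=
    (r / 4) `^ (- t) * h1 z + (r / 4) `^ (- s) * h2 z + 6 `^ t * h3 z.
  have P1 : 0 <= (r / 4) `^ (- t) * h1 z by rewrite mulr_ge0 ?powR_ge0.
  have P2 : 0 <= (r / 4) `^ (- s) * h2 z by rewrite mulr_ge0 ?powR_ge0.
  have P3 : 0 <= 6 `^ t * h3 z by rewrite mulr_ge0 ?powR_ge0.
  have [zc|zc] := leP (edist c z) (r / 4).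
    rewrite -addrA; apply: ler_wpDr; first exact: addr_ge0.
    rewrite h1E indicE mem_set// mul1r mulrC ler_wpM2r ?powR_ge0//.
    by apply: ler_powRN => //; exact: (big _ c x).
  have [zx|zx] := leP (edist x z) (r / 4).
    apply: ler_wpDr => //; apply: ler_wpDl => //.
    rewrite h2E indicE mem_set// mul1r ler_wpM2r ?powR_ge0//.
    apply: ler_powRN => //; by apply: (big _ x) => //; rewrite edistC.
  apply: ler_wpDl; first exact: addr_ge0.
  have z0 : 0 < edist c z by exact: lt_trans zc.
  rewrite h3E indicE mem_set; last by move=> /=; apply/negP; rewrite -ltNge.
  rewrite mul1r opprD powRD; last by rewrite (gt_eqF z0) implybT.
  rewrite mulrCA ler_wpM2l ?powR_ge0//.
  (* Outside both balls |c - z| <= 6 |x - z| by the weak triangle inequality. *)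
  rewrite (_ : 6 `^ t = 6^-1 `^ (- t)); last first.
    by rewrite -powR_inv1// -powRrM mulN1r opprK.
  rewrite -powRM ?edist_ge0//; apply: ler_powRN => //; first by rewrite mulr_gt0.
  have := tri x c z; rewrite rE.
  have := edist_ge0 c z; have := edist_ge0 x z.
  move: (edist x z) (edist c z) zx zc => a b; rewrite !expr2; nra.
apply: (@le_trans _ _ (\int[mu]_z ((r / 4) `^ (- t) * h1 z +
    (r / 4) `^ (- s) * h2 z + 6 `^ t * h3 z)%:E)%E).
  apply: ge0_le_integral_real => //.
  - apply: measurable_funM; exact: measurable_edist_powR.
  - by do 2?apply: measurable_funD; exact: measurable_funM.
  - by move=> z; rewrite mulr_ge0 ?powR_ge0.
have mZ (k : R) (h : Rn R n -> R) : measurable_fun setT h ->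
    measurable_fun setT (fun z : Rn R n => k * h z).
  by move=> mh; exact: measurable_funM.
have pZ a b (h : Rn R n -> R) : (forall z, 0 <= h z) ->
    forall z, 0 <= (a : R) `^ b * h z.
  by move=> hh z; rewrite mulr_ge0 ?powR_ge0.
rewrite ge0_integral_realD; last 4 first.
- by apply: measurable_funD; exact: mZ.
- exact: mZ.
- by move=> z; rewrite addr_ge0 ?pZ.
- exact: pZ.
rewrite ge0_integral_realD; last 4 first.
- exact: mZ.
- exact: mZ.
- exact: pZ.
- exact: pZ.
rewrite !ge0_integral_realZ ?powR_ge0//.
have r4n : (r / 4 == 0) = false by rewrite gt_eqF.
have E a b : (r / 4) `^ (- a) * (r / 4) `^ (n%:R - b) = (r / 4) `^ (n%:R - b - a).
  by rewrite -powRD ?r4n ?implybT// addrC.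
have E4 : (r / 4) `^ e = 4 `^ (- e) * r `^ e.
  rewrite powRM ?ltW// mulrC; congr (_ * _).
  by rewrite -powR_inv1// -powRrM mulN1r.
rewrite (_ : (_ * _)%R%:E = ((r / 4) `^ (- t) * (C1 * (r / 4) `^ (n%:R - s)))%:E
    + ((r / 4) `^ (- s) * (C2 * (r / 4) `^ (n%:R - t)))%:E
    + (6 `^ t * (C3 * (r / 4) `^ (n%:R - (s + t))))%:E)%E; last first.
  rewrite -!EFinD; congr EFin.
  rewrite [X in _ = X + _ + _]mulrCA [X in _ = _ + X + _]mulrCA !E.
  rewrite -eE (_ : n%:R - t - s = e); last by rewrite eE; ring.
  rewrite (_ : n%:R - (s + t) = e); last by rewrite eE; ring.
  by rewrite E4; ring.
by do 2?[apply: leeD]; rewrite [leRHS]EFinM lee_wpmul2l ?lee_fin ?powR_ge0.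
Qed.

End power_integrals.

(** * Gaussian and Gamma integrals *)

Section lebesgue_1d.
Context (R : realType).
Local Notation leb := (@lebesgue_measure R).

Lemma ge0_integral_oppr (f : R -> \bar R) :
  measurable_fun [set: R] f -> (forall r, (0 <= f r)%E) ->
  (\int[leb]_r f (- r)%R = \int[leb]_r f r)%E.
Proof.
move=> mf f0; transitivity
  (\int[leb]_(r in (-%R : _ -> measurableTypeR R) @^-1` setT) f (- r)%R)%E.
  by rewrite preimage_setT.
rewrite -ge0_integral_pushforward//=.
by apply: eq_measure_integral => //= A mA AS; exact: lebesgue_measureN.
Qed.

Lemma ge0_integral_addr (f : R -> R) (c : R) :
  continuous f -> (forall r, 0 <= f r) ->
  (\int[leb]_r (f (r + c))%:E = \int[leb]_r (f r)%:E)%E.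
Proof.
move=> cf f0; pose F (x : R) := x + c.
have dF : F^`()%classic = cst 1.
  apply/funext => x; rewrite derive1E /F deriveD// derive_id derive_cst addr0//.
rewrite (@increasing_ge0_integration_by_substitutionT _ F f) ?dF//.
- by apply: eq_integral => x _; rewrite /= mulr1.
- by move=> x y xy; rewrite /F ltrD2r.
- by move=> x; exact: cvg_cst.
- exact: is_cvg_cst.
- exact: is_cvg_cst.
- exact: cvg_addrr_Ny.
- exact: cvg_addrr.
Qed.

Lemma integral_gauss1 (s c : R) : 0 < s ->
  (\int[leb]_u (expR (- (s * (c - u) ^+ 2)))%:E = (Num.sqrt (pi / s))%:E)%E.
Proof.
move=> s0; pose sg : R := Num.sqrt (s^-1 / 2).
have sg2 : sg ^+ 2 *+ 2 = s^-1.
  rewrite /sg sqr_sqrtr; last by rewrite divr_ge0 ?invr_ge0 ?ltW.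
  by rewrite -mulr_natr divfK.
have sg0 : sg != 0 by rewrite gt_eqF// sqrtr_gt0 divr_gt0 ?invr_gt0.
have pk : (normal_peak sg)^-1 = Num.sqrt (pi / s).
  by rewrite /normal_peak invrK -mulrnAl sg2 mulrC.
have pk0 : 0 < Num.sqrt (pi / s) by rewrite sqrtr_gt0 divr_gt0 ?pi_gt0.
rewrite -[RHS]mule1 -(integral_normal_pdf c sg) -ge0_integral_realZ ?ltW//.
- apply: eq_integral => u _; congr EFin.
  rewrite normal_pdfE// -pk mulKf; last first.
    by rewrite gt_eqF// normal_peak_gt0.
  by rewrite /normal_fun sg2 invrK; congr expR; ring.
- exact: measurable_normal_pdf.
- by move=> x; exact: normal_pdf_ge0.
Qed.

(** The Gamma integral, in logarithmic scale: there the scaling of [r] is a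
    translation, so only the convergence for [r = 1] has to be proved. It follows
    by comparison with a two-sided exponential density of rate [min b 1]. *)
Lemma integral_gamma (b : R) : 0 < b -> exists2 c : R, 0 < c &
  forall r, 0 < r ->
  (\int[leb]_t (expR (b * t) * expR (- (r * expR t)))%:E = (c * r `^ (- b))%:E)%E.
Proof.
move=> b0; pose G (t : R) : R := expR (b * t) * expR (- expR t).
have G0 t : 0 < G t by rewrite mulr_gt0 ?expR_gt0.
have cG : continuous G.
  move=> t; apply: (@continuousM R R (fun t => expR (b * t)) (fun t => expR (- expR t))).
    apply: (@continuous_comp _ _ _ (fun t => b * t) expR); last exact: continuous_expR.
    by apply: continuousM; [exact: cvg_cst|exact: cvg_id].
  apply: (@continuous_comp _ _ _ (fun t => - expR t) expR); last exact: continuous_expR.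
  by apply: continuousN; exact: continuous_expR.
have mG : measurable_fun setT G by exact: continuous_measurable_fun.
pose e : R := Num.min b 1.
have e0 : 0 < e by rewrite lt_min b0 ltr01.
have [eb e1] : e <= b /\ e <= 1 by rewrite !ge_min !lexx orbT.
pose K : R := expR ((b + 1) ^+ 2 / 2) + 1.
have K1 : 1 <= K by rewrite lerDr expR_ge0.
have K0 : 0 <= K / e by apply: divr_ge0; [exact: le_trans ler01 K1|exact: ltW].
have dom t : G t <= K / e * (exponential_pdf e t + exponential_pdf e (- t)).
  have P0 x : 0 <= exponential_pdf e x by exact: exponential_pdf_ge0 (ltW e0) _.
  have PE x : 0 <= x -> exponential_pdf e x = e * expR (- e * x).
    by move=> x0; rewrite /exponential_pdf patchE ifT// inE/= in_itv/= x0.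
  have [t0|t0] := leP 0 t.
    apply: (@le_trans _ _ (K / e * exponential_pdf e t)); last first.
      by rewrite ler_wpM2l// lerDl.
    rewrite PE// mulrA divfK ?gt_eqF//.
    apply: (@le_trans _ _ (expR ((b + 1) ^+ 2 / 2) * expR (- e * t))); last first.
      by rewrite ler_wpM2r ?expR_ge0// lerDl.
    rewrite /G -!expRD ler_expR.
    have h := @expR_ge1Dxn R t 1 t0.
    have := sqr_ge0 (b + 1 - t).
    have : 1 + t ^+ 2 / 2 <= expR t by [].
    have : 0 <= (1 - e) * t by rewrite mulr_ge0// subr_ge0.
    rewrite !expr2; nra.
  apply: (@le_trans _ _ (K / e * exponential_pdf e (- t))); last first.
    by rewrite ler_wpM2l// lerDr.
  rewrite PE; last by rewrite oppr_ge0 ltW.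
  rewrite mulrA divfK ?gt_eqF// mulNr mulrN opprK.
  apply: (@le_trans _ _ (expR (e * t))); last first.
    by rewrite ler_peMl ?expR_ge0.
  rewrite /G -expRD ler_expR; have := expR_ge0 t.
  have : 0 <= (b - e) * (- t) by rewrite mulr_ge0 ?subr_ge0 ?oppr_ge0// ltW.
  lra.
have mP : measurable_fun setT (exponential_pdf e).
  exact: measurable_exponential_pdf.
have P0 x : 0 <= exponential_pdf e x by exact: exponential_pdf_ge0 (ltW e0) _.
have Goo : (\int[leb]_t (G t)%:E < +oo)%E.
  have mPN : measurable_fun setT (fun t : R => exponential_pdf e (- t)).
    by apply: (measurableT_comp mP); exact: measurable_funN.
  apply: (@le_lt_trans _ _ (\int[leb]_t
     (K / e * (exponential_pdf e t + exponential_pdf e (- t)))%:E)%E).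
    apply: ge0_le_integral_real => //.
    - by apply: measurable_funM => //; exact: measurable_funD.
    - by move=> t; exact: ltW.
  rewrite ge0_integral_realZ//; last 2 first.
  - exact: measurable_funD.
  - by move=> t; rewrite addr_ge0.
  rewrite ge0_integral_realD//.
  rewrite (ge0_integral_oppr (f := fun t => (exponential_pdf e t)%:E)); last 2 first.
  - exact/measurable_EFinP.
  - by move=> t; rewrite lee_fin.
  by rewrite integral_exponential_pdf ?ltW//= -EFinD -EFinM ltry.
have Gpos : (0 < \int[leb]_t (G t)%:E)%E.
  rewrite lt_neqAle integral_ge0 ?andbT; last by move=> t _; rewrite lee_fin ltW.
  apply/eqP => /esym.
  have mGE : measurable_fun setT (EFin \o G) by exact/measurable_EFinP.
  have GE0 t : (0 <= (EFin \o G) t)%E by rewrite lee_fin ltW.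
  move=> hi; have [N [mN N0 sub]] := ae_eq0_of_integral (m := leb) mGE GE0 hi.
  have NT : N = setT.
    apply/seteqP; split => // t _; apply: sub => /= -[] /eqP.
    by rewrite gt_eqF.
  have := lebesgue_measure_itv `[(0:R), 1].
  rewrite /= lte_fin ltr01 => h.
  have : (leb `[0%R, 1%R]%classic <= leb N)%E.
    by apply: le_measure; rewrite ?inE// NT.
  by rewrite h [X in (_ <= X)%E]N0 -EFinB lee_fin; lra.
exists (fine (\int[leb]_t (G t)%:E)).
  by rewrite fine_gt0// Gpos.
move=> r r0; rewrite EFinM fineK; last by rewrite ge0_fin_numE// ltW.
rewrite -(ge0_integral_addr (ln r) cG); last by move=> t; exact: ltW.
rewrite muleC -ge0_integral_realZ; last 3 first.
- apply: (measurableT_comp mG); exact: measurable_funD.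
- exact: powR_ge0.
- by move=> t; exact: ltW.
apply: eq_integral => t _; congr EFin.
rewrite /G expRD lnK// mulrA; congr (_ * _); last by rewrite [r * _]mulrC.
by rewrite /powR gt_eqF// -expRD; congr expR; ring.
Qed.

End lebesgue_1d.

Section gauss.
Context (R : realType).

Lemma integral_lebesgue_cons n (h : Rn R n.+1 -> \bar R) :
  measurable_fun setT h -> (forall x, (0 <= h x)%E) ->
  (\int[lebesgue_Rn R n.+1]_x h x =
   \int[@lebesgue_measure R]_a \int[lebesgue_Rn R n]_t h (rn_cons (a, t)))%E.
Proof.
move=> mh h0.
transitivity (\int[@lebesgue_measure R \x lebesgue_Rn R n]_(w in
    (@rn_cons R n) @^-1` setT) (h \o @rn_cons R n) w)%E.
  rewrite -(@ge0_integral_pushforward _ _ _ _ _ _ (@measurable_rn_cons R n))//.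
rewrite preimage_setT fubini_tonelli1//; last by move=> w; exact: h0.
exact: measurableT_comp mh (@measurable_rn_cons R n).
Qed.

Lemma sqdist_cons n (a b : R) (x y : Rn R n) :
  sqdist (rn_cons (a, x)) (rn_cons (b, y)) = (a - b) ^+ 2 + sqdist x y.
Proof.
rewrite /sqdist big_ord_recl /=; congr (_ + _).
by apply: eq_bigr => i _; rewrite !tnthS.
Qed.

Lemma rn_unconsK n (t : Rn R n.+1) : rn_cons (rn_uncons t) = t.
Proof. by case/tupleP: t => a t; apply: val_inj. Qed.

Definition gauss_mass n (s : R) : R := Num.sqrt (pi / s) ^+ n.

Lemma gauss_mass_gt0 n s : 0 < s -> 0 < gauss_mass n s.
Proof. by move=> s0; rewrite exprn_gt0// sqrtr_gt0 divr_gt0 ?pi_gt0. Qed.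

Lemma measurable_gauss n (s : R) (c : Rn R n) :
  measurable_fun setT (fun u => expR (- (s * sqdist c u))).
Proof.
apply: measurable_expR_comp; apply: measurable_funN; apply: measurable_funM => //.
exact: (measurable_sqdist (measurable_cst c) (@measurable_id _ _ setT)).
Qed.

Lemma integral_gauss n (s : R) (c : Rn R n) : 0 < s ->
  (\int[lebesgue_Rn R n]_u (expR (- (s * sqdist c u)))%:E = (gauss_mass n s)%:E)%E.
Proof.
move=> s0; elim: n c => [c|n IH c].
  rewrite /lebesgue_Rn /= integral_dirac//; last first.
    by apply/measurable_EFinP; exact: measurable_gauss.
  rewrite diracT mul1e /gauss_mass expr0; congr EFin.
  by rewrite /sqdist big_ord0 mulr0 oppr0 expR0.
rewrite integral_lebesgue_cons; last 2 first.
- by apply/measurable_EFinP; exact: measurable_gauss.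
- by move=> x; rewrite lee_fin expR_ge0.
rewrite -(rn_unconsK c); case: (rn_uncons c) => a {}c.
transitivity (\int[@lebesgue_measure R]_b
  (gauss_mass n s * expR (- (s * (a - b) ^+ 2)))%:E)%E.
  apply: eq_integral => b _.
  under eq_integral => t _ do rewrite sqdist_cons mulrDr opprD expRD.
  rewrite ge0_integral_realZ ?expR_ge0//; last exact: measurable_gauss.
  by rewrite IH -EFinM mulrC.
rewrite ge0_integral_realZ ?(ltW (gauss_mass_gt0 _ _))//.
  by rewrite integral_gauss1// -EFinM /gauss_mass exprSr.
apply: measurable_expR_comp; apply: measurable_funN; apply: measurable_funM => //.
by apply: measurable_funX; exact: measurable_funB.
Qed.

End gauss.

(** * The Riesz energy as an integral of Gaussian transforms *)

Section gauss_feature.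
Context (R : realType) (n : nat).
Local Notation mu := (lebesgue_Rn R n).
Local Notation leb := (@lebesgue_measure R).
Local Notation W := (measurableTypeR R * Rn R n)%type.
Local Notation mW := (product_sf leb mu).

(** A Gaussian centred at [w.2] whose rate is [2 * expR w.1]; the exponential
    makes the scale parameter range over the whole line. *)
Definition gfeature (w : W) (x : Rn R n) : R :=
  expR (- (2 * expR w.1 * sqdist x w.2)).

Lemma gfeature_ge0 w x : 0 <= gfeature w x.
Proof. exact: expR_ge0. Qed.

Lemma measurable_gfeature d (T : measurableType d) (f : T -> W) (g : T -> Rn R n) :
  measurable_fun setT f -> measurable_fun setT g ->
  measurable_fun setT (fun t => gfeature (f t) (g t)).
Proof.
move=> mf mg; apply: measurable_expR_comp; apply: measurable_funN.
apply: measurable_funM; last first.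
  by apply: measurable_sqdist => //; exact: (measurableT_comp measurable_snd mf).
apply: measurable_funM; first exact: measurable_cst.
by apply: measurable_expR_comp; exact: (measurableT_comp measurable_fst mf).
Qed.

Lemma sqdist_midpoint (x y u : Rn R n) :
  2 * sqdist x u + 2 * sqdist y u = sqdist x y +
  4 * sqdist [tuple (tnth x i + tnth y i) / 2 | i < n] u.
Proof.
rewrite /sqdist !mulr_sumr -!big_split /=; apply: eq_bigr => i _.
by rewrite tnth_mktuple; field.
Qed.

(** The density for which the Gaussian features factor the Riesz kernel: the
    factor [gauss_mass] undoes the integration over centres, and the rest is the
    Gamma density that turns exponentials of the squared distance into a power. *)
Definition gauss_weight (c l t : R) : R :=
  c^-1 * expR (l / 2 * t) / gauss_mass n (4 * expR t).

Lemma gauss_weight_gt0 (c l t : R) : 0 < c -> 0 < gauss_weight c l t.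
Proof.
by move=> c0; rewrite !mulr_gt0 ?invr_gt0 ?expR_gt0// gauss_mass_gt0// mulr_gt0 ?expR_gt0.
Qed.

Lemma measurable_gauss_weight (c l : R) : measurable_fun setT (gauss_weight c l).
Proof.
have -> : gauss_weight c l = fun t => c^-1 * expR (l / 2 * t) *
    (Num.sqrt (pi / 4 * expR (- t)) ^- n).
  apply/funext => t; rewrite /gauss_weight /gauss_mass.
  by congr (_ * (Num.sqrt _ ^- n)); rewrite expRN -mulrA -invfM.
apply: measurable_funM.
  apply: measurable_funM; first exact: measurable_cst.
  by apply: measurable_expR_comp; exact: measurable_funM.
have -> : (fun x : R => Num.sqrt (pi / 4 * expR (- x)) ^- n) =
    (fun x => (Num.sqrt (pi / 4 * expR (- x)) ^+ n) `^ (-1)).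
  by apply/funext => x; rewrite powR_inv1// exprn_ge0// sqrtr_ge0.
apply: measurable_powRl; apply: measurable_funX.
apply: (@measurableT_comp _ _ _ _ _ _ (@Num.sqrt R)).
  apply: continuous_measurable_fun; exact: sqrt_continuous.
apply: measurable_funM; first exact: measurable_cst.
by apply: measurable_expR_comp; exact: measurable_funN.
Qed.

(** By the parallelogram identity, integrating the product of two features over
    their common centre gives a Gaussian in [x - y]; mixing the scales with the
    Gamma integral then gives [|x - y|^-l]. So the kernel is a superposition of
    rank-one positive kernels. *)
Lemma riesz_gauss (l : R) : 0 < l -> exists2 k : R -> R,
  measurable_fun setT k /\ (forall t, 0 < k t) &
  forall x y : Rn R n, x <> y ->
  (\int[mW]_w (k w.1 * gfeature w x * gfeature w y)%:E = (edist x y `^ (- l))%:E)%E.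
Proof.
move=> l0; have l20 : 0 < l / 2 by rewrite divr_gt0.
have [c c0 gam] := integral_gamma l20.
have [k [mk k0] kE] : exists2 k : R -> R, measurable_fun setT k /\ (forall t, 0 < k t) &
    forall t, k t * gauss_mass n (4 * expR t) = c^-1 * expR (l / 2 * t).
  exists (gauss_weight c l).
    split; first exact: measurable_gauss_weight.
    by move=> t; exact: gauss_weight_gt0.
  by move=> t; rewrite divfK// gt_eqF// gauss_mass_gt0// mulr_gt0 ?expR_gt0.
exists k => // x y xy; have d0 := edist_gt0 xy.
have q0 : 0 < sqdist x y by rewrite -sqr_edist exprn_gt0.
have mkW : measurable_fun setT (fun w : W => k w.1).
  exact: (measurableT_comp mk).
rewrite fubini_tonelli1; last 2 first.
- apply/measurable_EFinP; do 2?[apply: measurable_funM => //];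
    by apply: measurable_gfeature => //; exact: measurable_cst.
- move=> w; rewrite lee_fin; apply: mulr_ge0; last exact: gfeature_ge0.
  by apply: mulr_ge0; [exact: ltW|exact: gfeature_ge0].
transitivity (\int[leb]_t (c^-1 *
    (expR (l / 2 * t) * expR (- (sqdist x y * expR t))))%:E)%E.
  apply: eq_integral => t _; rewrite /fubini_F.
  pose m := [tuple (tnth x i + tnth y i) / 2 | i < n].
  have t40 : 0 < 4 * expR t by rewrite mulr_gt0 ?expR_gt0.
  transitivity (\int[mu]_u ((k t * expR (- (sqdist x y * expR t))) *
      expR (- (4 * expR t * sqdist m u)))%:E)%E.
    apply: eq_integral => u _; congr EFin => /=.
    rewrite -!mulrA; congr (_ * _); rewrite /gfeature -!expRD; congr expR.
    have := sqdist_midpoint x y u; rewrite -/m /=; move: (sqdist m u) => s1 h.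
    rewrite -opprD -[in RHS]opprD; congr (- _).
    transitivity (expR t * (2 * sqdist x u + 2 * sqdist y u)); first by ring.
    by rewrite h; ring.
  rewrite ge0_integral_realZ; last 3 first.
  - exact: measurable_gauss.
  - by apply: mulr_ge0; [exact: ltW|exact: expR_ge0].
  - by move=> u; exact: expR_ge0.
  rewrite integral_gauss// -EFinM; congr EFin.
  by rewrite mulrAC kE mulrA.
rewrite ge0_integral_realZ; last 3 first.
- apply: measurable_funM; apply: measurable_expR_comp.
    exact: measurable_funM.
  by apply: measurable_funN; apply: measurable_funM => //; exact: measurable_expR.
- by rewrite invr_ge0 ltW.
- by move=> t; rewrite mulr_ge0 ?expR_ge0.
rewrite gam// -EFinM; congr EFin; rewrite mulrA mulVf ?gt_eqF// mul1r.
rewrite -sqr_edist -powR_mulrn ?edist_ge0// -powRrM; congr powR.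
by field.
Qed.

End gauss_feature.

Section weighted_amgm.
Context d (T : measurableType d) (R : realType).
Variable m : {measure set T -> \bar R}.

(** The factors may be infinite, which is why the inequality between means is
    kept in a form without subtraction. *)
Lemma amgm_ereal (k : R) (a b : \bar R) : 0 < k -> (0 <= a)%E -> (0 <= b)%E ->
  (k%:E * (a * b) + k%:E * (a * b) <= k%:E * (a * a) + k%:E * (b * b))%E.
Proof.
move=> k0; case: a => [a||]//; case: b => [b||]//.
- by rewrite -!EFinM -!EFinD !lee_fin => *; have := sqr_ge0 (a - b); rewrite expr2; nra.
- by move=> *; rewrite [(+oo * +oo)%E]mulyy [(k%:E * +oo)%E]gt0_muley ?lte_fin// addey ?leey// -EFinM.
- by move=> *; rewrite [(+oo * +oo)%E]mulyy [(k%:E * +oo)%E]gt0_muley ?lte_fin// addye ?leey// -EFinM.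
Qed.

Lemma amgm_ereal_eq (k : R) (a b : \bar R) : 0 < k -> (0 <= a)%E -> (0 <= b)%E ->
  (k%:E * (a * a) + k%:E * (b * b) = k%:E * (a * b) + k%:E * (a * b))%E ->
  (k%:E * (a * b) < +oo)%E -> a = b /\ (a < +oo)%E.
Proof.
move=> k0; case: a => [a||]//; case: b => [b||]//.
- rewrite -!EFinM -!EFinD => a0 b0 [] h _; split; last exact: ltry.
  congr EFin; apply/eqP; rewrite -subr_eq0 -sqrf_eq0.
  have : k * (a - b) ^+ 2 = 0.
    have -> : k * (a - b) ^+ 2 = k * (a * a) + k * (b * b) -
      (k * (a * b) + k * (a * b)) by ring.
    by rewrite h subrr.
  by move/eqP; rewrite mulf_eq0 gt_eqF//.
- move=> _ _ + h; rewrite [(+oo * +oo)%E]mulyy [(k%:E * +oo)%E]gt0_muley ?lte_fin// -!EFinM addey//.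
  by move=> e; move: (lte_add_pinfty h h); rewrite -e ltxx.
- move=> _ _ + h; rewrite [(+oo * +oo)%E]mulyy [(k%:E * +oo)%E]gt0_muley ?lte_fin// -!EFinM addye//.
  by move=> e; move: (lte_add_pinfty h h); rewrite -e ltxx.
- by move=> _ _ _; rewrite mulyy [(k%:E * +oo)%E]gt0_muley ?lte_fin// ltxx.
Qed.

Variables (k : T -> R) (a b : T -> \bar R).
Hypotheses (mk : measurable_fun setT k) (ma : measurable_fun setT a)
  (mb : measurable_fun setT b).
Hypotheses (k0 : forall x, 0 < k x) (a0 : forall x, (0 <= a x)%E)
  (b0 : forall x, (0 <= b x)%E).
Let e (u v : T -> \bar R) x := ((k x)%:E * (u x * v x))%E.
Let mkE : measurable_fun setT (fun x => (k x)%:E).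
Proof. exact/measurable_EFinP. Qed.
Let me (u v : T -> \bar R) : measurable_fun setT u -> measurable_fun setT v ->
  measurable_fun setT (e u v).
Proof.
by move=> mu mv; exact: (emeasurable_funM mkE (emeasurable_funM mu mv)).
Qed.
Let pe (u v : T -> \bar R) : (forall x, (0 <= u x)%E) -> (forall x, (0 <= v x)%E) ->
  forall x, (0 <= e u v x)%E.
Proof.
move=> u0 v0 x; apply: mule_ge0; last exact: mule_ge0.
by rewrite lee_fin ltW.
Qed.
Let le_e x : (e a b x + e a b x <= e a a x + e b b x)%E.
Proof. exact: (amgm_ereal (k0 x)). Qed.
Let mab := me ma mb.
Let maa := me ma ma.
Let mbb := me mb mb.
Let pab := pe a0 b0.
Let paa := pe a0 a0.
Let pbb := pe b0 b0.

Lemma integral_amgm :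
  (\int[m]_x ((k x)%:E * (a x * b x)) + \int[m]_x ((k x)%:E * (a x * b x)) <=
   \int[m]_x ((k x)%:E * (a x * a x)) + \int[m]_x ((k x)%:E * (b x * b x)))%E.
Proof.
rewrite -(ge0_integralD m measurableT (fun x _ => pab x) mab (fun x _ => pab x) mab).
rewrite -(ge0_integralD m measurableT (fun x _ => paa x) maa (fun x _ => pbb x) mbb).
apply: ge0_le_integral.
- exact: measurableT.
- by move=> x _; apply: adde_ge0; exact: pab.
- exact: emeasurable_funD mab mab.
- exact: emeasurable_funD maa mbb.
- by move=> x _; exact: le_e.
Qed.

Lemma integral_amgm_eq :
  (\int[m]_x ((k x)%:E * (a x * a x)) + \int[m]_x ((k x)%:E * (b x * b x)) <=
   \int[m]_x ((k x)%:E * (a x * b x)) + \int[m]_x ((k x)%:E * (a x * b x)))%E ->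
  (\int[m]_x ((k x)%:E * (a x * b x)) < +oo)%E ->
  {ae m, forall x, a x = b x /\ (a x < +oo)%E}.
Proof.
rewrite -(ge0_integralD m measurableT (fun x _ => pab x) mab (fun x _ => pab x) mab).
rewrite -(ge0_integralD m measurableT (fun x _ => paa x) maa (fun x _ => pbb x) mbb).
move=> h1 h2.
have fin : {ae m, forall x, setT x -> e a b x \is a fin_num}.
  apply: integrable_ae => //; apply/integrableP; split; first exact: mab.
  by under eq_integral do rewrite gee0_abs ?pab//.
have h3 : (\int[m]_x (e a b x + e a b x) < +oo)%E.
  rewrite (ge0_integralD m measurableT (fun x _ => pab x) mab (fun x _ => pab x) mab).
  exact: lte_add_pinfty.
have H := ae_eq_of_integral_le (emeasurable_funD maa mbb)
  (emeasurable_funD mab mab) (fun x => adde_ge0 (pab x) (pab x)) le_e h1 h3.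
apply: filterS2 H fin => x ex /(_ I) fx.
apply: (amgm_ereal_eq (k0 x)) => //.
by rewrite -ge0_fin_numE//; exact: pab.
Qed.

End weighted_amgm.

Section energy.
Context (R : realType) (n : nat).
Local Notation mu := (lebesgue_Rn R n).
Local Notation leb := (@lebesgue_measure R).
Local Notation W := (measurableTypeR R * Rn R n)%type.
Local Notation mW := (product_sf leb mu).
Implicit Types f g : Rn R n -> R.

Definition energy (l : R) f g : \bar R :=
  (\int[mu]_x \int[mu]_y (f x * g y * edist x y `^ (- l))%:E)%E.

Definition gtransform f (w : W) : \bar R := (\int[mu]_x (f x * gfeature w x)%:E)%E.

Lemma gtransform_ge0 f w : (forall x, 0 <= f x) -> (0 <= gtransform f w)%E.
Proof.
by move=> f0; apply: integral_ge0 => x _; rewrite lee_fin mulr_ge0 ?gfeature_ge0.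
Qed.

Lemma measurable_gtransform f : measurable_fun setT f -> (forall x, 0 <= f x) ->
  measurable_fun setT (gtransform f).
Proof.
move=> mf f0.
apply: (@measurable_fun_fubini_tonelli_F _ _ W _ R mu
   (fun p : W * Rn R n => (f p.2 * gfeature p.1 p.2)%:E)).
  apply/measurable_EFinP; apply: measurable_funM.
    exact: (measurableT_comp mf measurable_snd).
  exact: measurable_gfeature.
by move=> p; rewrite lee_fin mulr_ge0 ?gfeature_ge0.
Qed.

(** The factorisation of the kernel and Tonelli's theorem; the diagonal, on which
    the kernel takes a conventional value, is null. *)
Lemma energy_gtransform (l : R) : (0 < n)%N -> 0 < l -> exists2 k : R -> R,
  measurable_fun setT k /\ (forall t, 0 < k t) &
  forall f g, measurable_fun setT f -> measurable_fun setT g ->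
  (forall x, 0 <= f x) -> (forall x, 0 <= g x) ->
  (energy l f g =
   \int[mW]_w ((k w.1)%:E * (gtransform f w * gtransform g w)))%E.
Proof.
move=> n0 l0; have [k [mk k0] kE] := riesz_gauss n l0.
exists k; first by [].
move=> f g mf mg f0 g0.
have mkw : measurable_fun setT (fun w : W => k w.1).
  exact: (measurableT_comp mk).
have mJ x : measurable_fun setT (fun p : Rn R n * W =>
    (f x * g p.1 * (k p.2.1 * gfeature p.2 x * gfeature p.2 p.1))%:E).
  apply/measurable_EFinP; apply: measurable_funM.
    apply: measurable_funM; first exact: measurable_cst.
    exact: (measurableT_comp mg measurable_fst).
  apply: measurable_funM; last exact: measurable_gfeature.
  apply: measurable_funM; first exact: (measurableT_comp mkw measurable_snd).
  by apply: measurable_gfeature => //; exact: measurable_cst.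
have J0 x (p : Rn R n * W) :
    (0 <= (f x * g p.1 * (k p.2.1 * gfeature p.2 x * gfeature p.2 p.1))%:E)%E.
  rewrite lee_fin; apply: mulr_ge0; first exact: mulr_ge0.
  apply: mulr_ge0; last exact: gfeature_ge0.
  by apply: mulr_ge0; [exact: ltW|exact: gfeature_ge0].
transitivity (\int[mu]_x \int[mu]_y \int[mW]_w
    (f x * g y * (k w.1 * gfeature w x * gfeature w y))%:E)%E.
  apply: eq_integral => x _; apply: ge0_ae_eq_integral => //.
  - apply/measurable_EFinP; apply: measurable_funM; last exact: measurable_edist_powR.
    by apply: measurable_funM => //; exact: measurable_cst.
  - exact: (measurable_fun_fubini_tonelli_F (m2 := mW) _ (mJ x) (J0 x)).
  - by move=> y _; rewrite lee_fin mulr_ge0 ?powR_ge0// mulr_ge0.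
  - by move=> y _; apply: integral_ge0 => w _; exact: (J0 x (y, w)).
  apply: filterS (ae_neq x n0) => y yx _.
  rewrite EFinM -kE; last exact: nesym.
  rewrite -ge0_integralZl_EFin ?mulr_ge0//.
  - by move=> w _; rewrite lee_fin !mulr_ge0 ?gfeature_ge0// ltW.
  - apply/measurable_EFinP; do 2?[apply: measurable_funM => //];
      by apply: measurable_gfeature => //; exact: measurable_cst.
transitivity (\int[mu]_x \int[mW]_w \int[mu]_y
    (f x * g y * (k w.1 * gfeature w x * gfeature w y))%:E)%E.
  apply: eq_integral => x _.
  apply: (@fubini_tonelli _ _ _ _ _ mu mW (fun p : Rn R n * W =>
    (f x * g p.1 * (k p.2.1 * gfeature p.2 x * gfeature p.2 p.1))%:E)).
    exact: mJ.
  exact: J0.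
transitivity (\int[mu]_x \int[mW]_w
  ((f x * (k w.1 * gfeature w x))%:E * gtransform g w))%E.
  apply: eq_integral => x _; apply: eq_integral => w _.
  rewrite /gtransform -ge0_integralZl_EFin//.
  - by apply: eq_integral => y _; rewrite -EFinM; congr EFin; ring.
  - by move=> y _; rewrite lee_fin mulr_ge0 ?gfeature_ge0.
  - apply/measurable_EFinP; apply: measurable_funM => //.
    by apply: measurable_gfeature => //; exact: measurable_cst.
  - by apply: mulr_ge0 => //; apply: mulr_ge0; [exact: ltW|exact: gfeature_ge0].
transitivity (\int[mW]_w \int[mu]_x
  ((f x * (k w.1 * gfeature w x))%:E * gtransform g w))%E.
  apply: (@fubini_tonelli _ _ _ _ _ mu mW (fun p : Rn R n * W =>
     ((f p.1 * (k p.2.1 * gfeature p.2 p.1))%:E * gtransform g p.2))%E).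
    apply: emeasurable_funM; last first.
      exact: (measurableT_comp (measurable_gtransform mg g0) measurable_snd).
    apply/measurable_EFinP; apply: measurable_funM.
      exact: (measurableT_comp mf measurable_fst).
    apply: measurable_funM; first exact: (measurableT_comp mkw measurable_snd).
    exact: measurable_gfeature.
  move=> p; apply: mule_ge0; last exact: gtransform_ge0.
  rewrite lee_fin; apply: mulr_ge0 => //.
  by apply: mulr_ge0; [exact: ltW|exact: gfeature_ge0].
apply: eq_integral => w _.
have mfw : measurable_fun setT (fun x => f x * gfeature w x).
  apply: measurable_funM => //.
  by apply: measurable_gfeature => //; exact: measurable_cst.
have fw0 x : 0 <= f x * gfeature w x by rewrite mulr_ge0 ?gfeature_ge0.
have kw0 : 0 <= k w.1 by exact: ltW.
rewrite ge0_integralZr//; last 3 first.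
- apply/measurable_EFinP; apply: measurable_funM => //.
  apply: measurable_funM => //.
  by apply: measurable_gfeature => //; exact: measurable_cst.
- by move=> x _; rewrite lee_fin mulrCA mulr_ge0.
- exact: gtransform_ge0.
rewrite muleA; congr (_ * _)%E; rewrite /gtransform -ge0_integral_realZ//.
by apply: eq_integral => x _; congr EFin; ring.
Qed.

Section cauchy.
Variables (l : R) (n0 : (0 < n)%N) (l0 : 0 < l).
Variables f g : Rn R n -> R.
Hypotheses (mf : measurable_fun setT f) (mg : measurable_fun setT g).
Hypotheses (f0 : forall x, 0 <= f x) (g0 : forall x, 0 <= g x).

Let tf := measurable_gtransform mf f0.
Let tg := measurable_gtransform mg g0.
Let tf0 w : (0 <= gtransform f w)%E := gtransform_ge0 w f0.
Let tg0 w : (0 <= gtransform g w)%E := gtransform_ge0 w g0.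

Lemma energy_amgm :
  (energy l f g + energy l f g <= energy l f f + energy l g g)%E.
Proof.
have [k [mk k0] kE] := energy_gtransform n0 l0.
rewrite (kE f g mf mg f0 g0) (kE f f mf mf f0 f0) (kE g g mg mg g0 g0).
exact: (integral_amgm mW (measurableT_comp mk measurable_fst) tf tg
  (fun w => k0 w.1) tf0 tg0).
Qed.

Lemma energy_amgm_eq :
  (energy l f f + energy l g g <= energy l f g + energy l f g)%E ->
  (energy l f g < +oo)%E ->
  {ae mW, forall w, gtransform f w = gtransform g w /\ (gtransform f w < +oo)%E}.
Proof.
have [k [mk k0] kE] := energy_gtransform n0 l0.
rewrite (kE f g mf mg f0 g0) (kE f f mf mf f0 f0) (kE g g mg mg g0 g0).
exact: (integral_amgm_eq (m := mW) (measurableT_comp mk measurable_fst) tf tg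
  (fun w => k0 w.1) tf0 tg0).
Qed.

End cauchy.

End energy.

(** * Gaussian transforms determine a function *)

Section dominated.
Context d (T : measurableType d) (R : realType).
Variable m : {measure set T -> \bar R}.

Lemma dominated_cvg_real (E : set T) (h_ : nat -> T -> R) (h G : T -> R) :
  measurable E -> (forall k, measurable_fun setT (h_ k)) ->
  measurable_fun setT h -> measurable_fun setT G ->
  (forall x, (h_ k x @[k --> \oo] --> h x)%classic) ->
  (forall k x, 0 <= h_ k x <= G x) -> (\int[m]_(x in E) (G x)%:E < +oo)%E ->
  ((\int[m]_(x in E) (h_ k x)%:E)%E @[k --> \oo] --> (\int[m]_(x in E) (h x)%:E)%E)%classic.
Proof.
move=> mE mh_ mh mG hc hG Goo.
have G0 x : 0 <= G x by case/andP: (hG 0%N x) => /le_trans; exact.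
have [] := @dominated_convergence _ _ _ m E mE (fun k x => (h_ k x)%:E)
  (fun x => (h x)%:E) (fun x => (G x)%:E) => //.
- by move=> k; apply/measurable_EFinP; exact: measurable_funTS.
- by apply/measurable_EFinP; exact: measurable_funTS.
- apply: nearW => x _; apply/cvg_EFin; first by near=> k.
  exact: hc.
- apply/integrableP; split.
    by apply/measurable_EFinP; exact: measurable_funTS.
  by under eq_integral do rewrite gee0_abs ?lee_fin//.
- apply: nearW => x k _; rewrite /= lee_fin.
  by case/andP: (hG k x) => h0 ?; rewrite ger0_norm.
Unshelve. all: by end_near.
Qed.

End dominated.

Section gauss_integrals.
Context (R : realType) (n : nat).
Local Notation mu := (lebesgue_Rn R n).
Implicit Types (f g : Rn R n -> R) (E : set (Rn R n)).

Definition gauss (s : R) (u x : Rn R n) : R := expR (- (s * sqdist x u)).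

Lemma gauss_ge0 s u x : 0 <= gauss s u x.
Proof. exact: expR_ge0. Qed.

Lemma gauss_le1 s u x : 0 <= s -> gauss s u x <= 1.
Proof.
by move=> s0; rewrite -expR0 ler_expR oppr_le0 mulr_ge0 ?sqdist_ge0.
Qed.

Lemma measurable_gauss_sym s u : measurable_fun setT (gauss s u).
Proof.
apply: measurable_expR_comp; apply: measurable_funN; apply: measurable_funM => //.
exact: (measurable_sqdist (@measurable_id _ _ setT) (measurable_cst u)).
Qed.

(** Completing the square: a product of Gaussians is a multiple of a Gaussian. *)
Lemma gauss_mul s r (u c : Rn R n) : 0 < s -> 0 < r ->
  exists K v, 0 <= K /\ forall x, gauss s u x * gauss r c x = K * gauss (s + r) v x.
Proof.
move=> s0 r0; have sr : s + r != 0 by rewrite gt_eqF// addr_gt0.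
pose v : Rn R n := [tuple (s * tnth u i + r * tnth c i) / (s + r) | i < n].
exists (expR (- (s * r / (s + r) * sqdist u c))), v; split; first exact: expR_ge0.
move=> x; rewrite /gauss -!expRD; congr expR; rewrite -!opprD; congr (- _).
rewrite /sqdist !mulr_sumr -!big_split /=; apply: eq_bigr => i _.
by rewrite tnth_mktuple; field.
Qed.

(** The integral is restricted to a set [E] because [E] will run through all
    measurable sets. *)
Definition gint f E s u : \bar R := (\int[mu]_(x in E) (f x * gauss s u x)%:E)%E.

Lemma measurable_fgauss f s u : measurable_fun setT f ->
  measurable_fun setT (fun x => f x * gauss s u x).
Proof. by move=> mf; apply: measurable_funM => //; exact: measurable_gauss_sym. Qed.

Lemma gint_ge0 f E s u : (forall x, 0 <= f x) -> (0 <= gint f E s u)%E.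
Proof.
by move=> f0; apply: integral_ge0 => x _; rewrite lee_fin mulr_ge0 ?gauss_ge0.
Qed.

Lemma gint_setT f E s u : measurable E -> measurable_fun setT f ->
  (forall x, 0 <= f x) -> (gint f E s u <= gint f setT s u)%E.
Proof.
move=> mE mf f0; apply: ge0_subset_integral => //.
  by apply/measurable_EFinP; exact: measurable_fgauss.
by move=> x _; rewrite lee_fin mulr_ge0 ?gauss_ge0.
Qed.

End gauss_integrals.

Section from_almost_all_gaussians.
Context (R : realType) (n : nat).
Local Notation mu := (lebesgue_Rn R n).
Local Notation leb := (@lebesgue_measure R).
Local Notation W := (measurableTypeR R * Rn R n)%type.
Local Notation mW := (product_sf leb mu).

(** A property of almost every feature holds for features whose centre and rate
    approach any given ones from above, since the corresponding boxes have
    positive measure. *)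
Lemma ae_feature_dense (P : W -> Prop) (s e : R) (u : Rn R n) :
  {ae mW, forall w, P w} -> 0 < s -> 0 < e ->
  exists2 w, P w & s < 2 * expR w.1 < s + e /\
    (forall i, tnth u i < tnth w.2 i < tnth u i + e).
Proof.
move=> [N [mN N0 sub]] s0 e0.
pose A (i : 'I_n) : set (measurableTypeR R) := `]tnth u i, tnth u i + e[%classic.
have mA i : measurable (A i) by exact: measurable_itv.
pose B := [set t : Rn R n | forall i, A i (tnth t i)].
have mB : measurable B by exact: measurable_box.
pose I : set (measurableTypeR R) := `]ln (s / 2), ln ((s + e) / 2)[%classic.
have mI : measurable I by exact: measurable_itv.
have lnlt : ln (s / 2) < ln ((s + e) / 2).
  by rewrite ltr_ln ?posrE ?divr_gt0 ?addr_gt0// ltr_pM2r// ltrDl.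
have IB : (0 < mW (I `*` B))%E.
  rewrite [X in (_ < X)%E](_ : _ = leb I * mu B)%E; last exact: product_measure1E.
  rewrite lebesgue_Rn_box// (eq_bigr (fun=> e%:E)); last first.
    move=> i _; rewrite /A lebesgue_measure_itv/= lte_fin ltrDl e0 -EFinB.
    by congr EFin; ring.
  rewrite prodEFin prodr_const card_ord /I lebesgue_measure_itv/= lte_fin lnlt.
  by rewrite -EFinB -EFinM lte_fin mulr_gt0 ?subr_gt0// exprn_gt0.
have [w [[wI wB] wN]] : exists w, (I `*` B) w /\ ~ N w.
  apply: contrapT => /forallNP h.
  have : (mW (I `*` B) <= mW N)%E.
    apply: le_measure; rewrite ?inE//; first exact: measurableX.
    by move=> w IBw; apply: contrapT => Nw; exact: (h w).
  by rewrite leNgt [X in (X < _)%E]N0 IB.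
exists w; first by apply: contrapT => Pw; apply: wN; exact: sub.
split; last by move=> i; have := wB i; rewrite /A /= in_itv.
move: wI; rewrite /I /= in_itv /= => /andP[h1 h2].
have [p1 p2] : 0 < s / 2 /\ 0 < (s + e) / 2 by rewrite !divr_gt0// addr_gt0.
have k1 : s / 2 < expR w.1 by rewrite -[ltLHS]lnK ?posrE// ltr_expR.
have k2 : expR w.1 < (s + e) / 2 by rewrite -[ltRHS]lnK ?posrE// ltr_expR.
by apply/andP; split; lra.
Qed.

Variables f g : Rn R n -> R.
Hypotheses (mf : measurable_fun setT f) (mg : measurable_fun setT g).
Hypotheses (f0 : forall x, 0 <= f x) (g0 : forall x, 0 <= g x).
Hypothesis fg : {ae mW, forall w,
  gtransform f w = gtransform g w /\ (gtransform f w < +oo)%E}.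


(** A Gaussian is dominated by a multiple of any wider one with another centre. *)
Lemma gint_finite_aux (h : Rn R n -> R) s (u : Rn R n) :
  measurable_fun setT h -> (forall x, 0 <= h x) ->
  {ae mW, forall w, (gtransform h w < +oo)%E} -> 0 < s ->
  (gint h setT s u < +oo)%E.
Proof.
move=> mh h0 hoo s0; have s4 : 0 < s / 4 by rewrite divr_gt0.
have [w woo [/andP[w1 w2] _]] := ae_feature_dense u hoo s4 s4.
apply: (@le_lt_trans _ _ (\int[mu]_x (expR (s * sqdist u w.2) *
    (h x * gauss (2 * expR w.1) w.2 x))%:E)%E).
  apply: ge0_le_integral_real.
  - exact: measurable_fgauss.
  - by apply: measurable_funM => //; exact: measurable_fgauss.
  - by move=> x; rewrite mulr_ge0 ?gauss_ge0.
  - move=> x; rewrite mulrCA ler_wpM2l// /gauss -expRD ler_expR.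
    have := sqdist_triangle x u w.2; have := sqdist_ge0 x w.2.
    move: (sqdist x w.2) (sqdist x u) (sqdist u w.2) => a b c ? ?.
    have : 2 * expR w.1 * a <= s / 2 * a by rewrite ler_wpM2r//; lra.
    nra.
rewrite ge0_integral_realZ ?expR_ge0//; last 2 first.
- exact: measurable_fgauss.
- by move=> x; rewrite mulr_ge0 ?gauss_ge0.
by apply: lte_mul_pinfty; rewrite ?lee_fin ?expR_ge0//; exact: woo.
Qed.

Lemma gint_finite s u : 0 < s -> (gint f setT s u < +oo)%E.
Proof. by apply: gint_finite_aux => //; apply: filterS fg => w []. Qed.

Lemma gint_finiteg s u : 0 < s -> (gint g setT s u < +oo)%E.
Proof. by apply: gint_finite_aux => //; apply: filterS fg => w [-> ]. Qed.

(** Dominated convergence along a sequence of good features: approximating the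
    rate from above keeps the features below a fixed wider Gaussian. *)
Lemma gint_eq s u : 0 < s -> gint f setT s u = gint g setT s u.
Proof.
move=> s0.
have W_ k : exists w : W, gtransform f w = gtransform g w /\
    (s < 2 * expR w.1 < s + k.+1%:R^-1 /\
    (forall i, tnth u i < tnth w.2 i < tnth u i + k.+1%:R^-1)).
  have ae1 : {ae mW, forall w, gtransform f w = gtransform g w}.
    by apply: filterS fg => w [].
  have k0 : 0 < k.+1%:R^-1 :> R by rewrite invr_gt0.
  by have [w ? ?] := ae_feature_dense u ae1 s0 k0; exists w.
have [w_ hw] := choice W_.
have s_cvg : 2 * expR (w_ k).1 @[k --> \oo] --> s.
  apply: (@squeeze_cvgr _ _ _ _ (fun=> s) (fun k => s + k.+1%:R^-1)).
  - apply: nearW => k; have [_ [/andP[h1 h2] _]] := hw k.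
    by rewrite !ltW.
  - exact: cvg_cst.
  - by rewrite -[X in _ --> X]addr0; apply: cvgD; [exact: cvg_cst|exact: cvg_harmonic].
have u_cvg i : tnth (w_ k).2 i @[k --> \oo] --> tnth u i.
  apply: (@squeeze_cvgr _ _ _ _ (fun=> tnth u i) (fun k => tnth u i + k.+1%:R^-1)).
  - apply: nearW => k; have [_ [_ /(_ i) /andP[h1 h2]]] := hw k.
    by rewrite !ltW.
  - exact: cvg_cst.
  - by rewrite -[X in _ --> X]addr0; apply: cvgD; [exact: cvg_cst|exact: cvg_harmonic].
have q_cvg x : sqdist x (w_ k).2 @[k --> \oo] --> sqdist x u.
  apply: cvg_big => //; first exact: add_continuous.
  move=> i _; apply: (@cvg_comp _ _ _ _ (fun y : R => y ^+ 2)); last exact: exprn_continuous.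
  by apply: cvgB; [exact: cvg_cst|exact: u_cvg].
have lim (h : Rn R n -> R) : measurable_fun setT h -> (forall x, 0 <= h x) ->
    (forall s u, 0 < s -> (gint h setT s u < +oo)%E) ->
    (gtransform h (w_ k) @[k --> \oo] --> gint h setT s u)%classic.
  move=> mh h0 hoo.
  apply: (@dominated_cvg_real _ _ _ mu setT
    (fun k x => h x * gfeature (w_ k) x) _
    (fun x => expR (s * n%:R) * (h x * gauss (s / 2) u x))) => //.
  - by move=> k; apply: measurable_funM => //; apply: measurable_gfeature => //; exact: measurable_cst.
  - exact: measurable_fgauss.
  - by apply: measurable_funM => //; exact: measurable_fgauss.
  - move=> x; apply: cvgM; first exact: cvg_cst.
    apply: (@cvg_comp _ _ _ (fun k => - (2 * expR (w_ k).1 * sqdist x (w_ k).2))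
      expR _ _ _ _ (@continuous_expR R _)).
    by apply: cvgN; apply: cvgM.
  - move=> k x; rewrite mulr_ge0 ?gfeature_ge0//= mulrCA ler_wpM2l//.
    rewrite /gfeature /gauss -expRD ler_expR.
    have [_ [/andP[h1 _] h2]] := hw k.
    have qn : sqdist (w_ k).2 u <= n%:R.
      rewrite /sqdist (le_trans (ler_sum _ (_ : forall i, true -> _ <= 1)))//; last first.
        by rewrite sumr_const card_ord.
      move=> i _; have /andP[i1 i2] := h2 i.
      have : k.+1%:R^-1 <= 1 :> R by rewrite invf_le1// ler1n.
      move: i1 i2; move: (tnth u i) (tnth (w_ k).2 i) (k.+1%:R^-1 : R) => a b c.
      by rewrite expr2 => *; nra.
    have := sqdist_triangle x (w_ k).2 u; have := sqdist_ge0 x (w_ k).2.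
    move: (sqdist x (w_ k).2) (sqdist x u) (sqdist (w_ k).2 u) qn => a b c ? ? ?.
    have : s * a <= 2 * expR (w_ k).1 * a by rewrite ler_wpM2r// ltW.
    nra.
  - rewrite ge0_integral_realZ ?expR_ge0//; last 2 first.
    - exact: measurable_fgauss.
    - by move=> x; rewrite mulr_ge0 ?gauss_ge0.
    apply: lte_mul_pinfty; rewrite ?lee_fin ?expR_ge0//.
    by apply: hoo; rewrite divr_gt0.
have L1 := lim f mf f0 gint_finite.
have L2 := lim g mg g0 gint_finiteg.
have E : (fun k => gtransform f (w_ k)) = (fun k => gtransform g (w_ k)).
  by apply/funext => k; have [] := hw k.
by move: L1; rewrite E => L1; exact: (cvg_unique _ L1 L2).
Qed.

End from_almost_all_gaussians.

Section gaussians_determine.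
Context (R : realType) (n : nat).
Local Notation mu := (lebesgue_Rn R n).
Variables f g : Rn R n -> R.
Hypotheses (mf : measurable_fun setT f) (mg : measurable_fun setT g).
Hypotheses (f0 : forall x, 0 <= f x) (g0 : forall x, 0 <= g x).
Hypothesis foo : forall s u, 0 < s -> (gint f setT s u < +oo)%E.
Hypothesis goo : forall s u, 0 < s -> (gint g setT s u < +oo)%E.
Hypothesis fg : forall s u, 0 < s -> gint f setT s u = gint g setT s u.

(** Agreement on the whole space is the hypothesis; it will be transferred to
    every measurable set, where it amounts to equality almost everywhere. *)
Definition gauss_agree (E : set (Rn R n)) :=
  forall s u, 0 < s -> gint f E s u = gint g E s u.

(** Gaussians multiplied by powers of [1 - gauss r c], which serve as smooth
    approximations of the indicator function of the outside of a ball. *)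
Definition gpint (h : Rn R n -> R) (E : set (Rn R n)) s u r c N : \bar R :=
  (\int[mu]_(x in E) (h x * gauss s u x * (1 - gauss r c x) ^+ N)%:E)%E.

Lemma measurable_gpower (h : Rn R n -> R) s u r c N : measurable_fun setT h ->
  measurable_fun setT (fun x => h x * gauss s u x * (1 - gauss r c x) ^+ N).
Proof.
move=> mh; apply: measurable_funM; first exact: measurable_fgauss.
apply: measurable_funX; apply: measurable_funB; first exact: measurable_cst.
exact: measurable_gauss_sym.
Qed.

Lemma gpower_itv r c N (x : Rn R n) : 0 < r -> 0 <= (1 - gauss r c x) ^+ N <= 1.
Proof.
move=> r0; have h1 := gauss_ge0 r c x; have h2 := gauss_le1 c x (ltW r0).
have h3 : 0 <= 1 - gauss r c x by rewrite subr_ge0.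
rewrite exprn_ge0//= exprn_ile1//.
by rewrite gerBl.
Qed.

Lemma gpint_recr E s u r c N : measurable E -> 0 < s -> 0 < r ->
  exists K v, 0 <= K /\ forall h' : Rn R n -> R,
    measurable_fun setT h' -> (forall x, 0 <= h' x) ->
  (gpint h' E s u r c N.+1 + K%:E * gpint h' E (s + r) v r c N =
   gpint h' E s u r c N)%E.
Proof.
move=> mE s0 r0; have [K [v [K0 Kv]]] := gauss_mul u c s0 r0.
exists K, v; split => // h' mh' h'0; rewrite /gpint.
have p0 a b k x : 0 <= h' x * gauss a b x * (1 - gauss r c x) ^+ k.
  by case/andP: (gpower_itv c k x r0) => p _; rewrite !mulr_ge0 ?gauss_ge0.
have mm a b k : measurable_fun E (fun x => (h' x * gauss a b x * (1 - gauss r c x) ^+ k)%:E).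
  by apply/measurable_EFinP; apply: measurable_funTS; exact: measurable_gpower.
have pE a b k x : E x -> (0 <= (h' x * gauss a b x * (1 - gauss r c x) ^+ k)%:E)%E.
  by move=> _; rewrite lee_fin.
have mK : measurable_fun E (fun x =>
    (K%:E * (h' x * gauss (s + r) v x * (1 - gauss r c x) ^+ N)%:E)%E).
  by apply: emeasurable_funM => //; exact: measurable_cst.
rewrite -ge0_integralZl_EFin//; last exact: pE.
rewrite -ge0_integralD//; last 2 first.
- exact: pE.
- by move=> x _; rewrite mule_ge0// lee_fin.
apply: eq_integral => x _; rewrite -EFinM -EFinD; congr EFin.
have := Kv x; rewrite exprS.
move: (gauss s u x) (gauss r c x) (gauss (s + r) v x) ((1 - gauss r c x) ^+ N) => a b d e h1.
have -> : K * (h' x * d * e) = h' x * (K * d) * e by ring.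
by rewrite -h1; ring.
Qed.

Lemma gpint_finite (h : Rn R n -> R) E s u r c N : measurable E ->
  measurable_fun setT h -> (forall x, 0 <= h x) -> 0 < s -> 0 < r ->
  (gint h setT s u < +oo)%E ->
  (0 <= gpint h E s u r c N)%E /\ (gpint h E s u r c N < +oo)%E.
Proof.
move=> mE mh h0 s0 r0 hoo.
have p0 x : 0 <= h x * gauss s u x * (1 - gauss r c x) ^+ N.
  by case/andP: (gpower_itv c N x r0) => p _; rewrite !mulr_ge0 ?gauss_ge0.
split; first by apply: integral_ge0 => x _; rewrite lee_fin.
apply: le_lt_trans (le_lt_trans (gint_setT s u mE mh h0) hoo).
apply: ge0_le_integral => //.
- by move=> x _; rewrite lee_fin.
- by apply/measurable_EFinP; apply: measurable_funTS; exact: measurable_gpower.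
- by apply/measurable_EFinP; apply: measurable_funTS; exact: measurable_fgauss.
- move=> x _; rewrite lee_fin ler_piMr//; first by rewrite mulr_ge0 ?gauss_ge0.
  by case/andP: (gpower_itv c N x r0).
Qed.

(** Expanding one factor of the power, the other Gaussian is absorbed in the
    first one by [gauss_mul]; hence an induction on the exponent. *)
Lemma gauss_agree_power E r c N s u : measurable E -> gauss_agree E ->
  0 < r -> 0 < s -> gpint f E s u r c N = gpint g E s u r c N.
Proof.
move=> mE aE r0; elim: N s u => [|N IH] s u s0.
  rewrite /gpint; under eq_integral do rewrite expr0 mulr1.
  by under [RHS]eq_integral do rewrite expr0 mulr1; exact: aE.
have sr : 0 < s + r by rewrite addr_gt0.
have [K [v [K0 KE]]] := gpint_recr u c N mE s0 r0.
have := KE f mf f0; have := KE g mg g0; rewrite -(IH s u s0) -(IH (s + r) v sr).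
have [] := gpint_finite c N.+1 mE mf f0 s0 r0 (foo u s0).
have [] := gpint_finite c N.+1 mE mg g0 s0 r0 (goo u s0).
have [] := gpint_finite c N mE mf f0 sr r0 (foo v sr).
move: (gpint f E s u r c N.+1) (gpint g E s u r c N.+1) (gpint f E (s + r) v r c N)
  (gpint f E s u r c N) => [a||] [b||] [d||] [e||] //= _ _ _ _ _ _.
by rewrite -!EFinM -!EFinD => -[h1] [h2]; congr EFin; lra.
Qed.

End gaussians_determine.

Section cutoff.
Context (R : realType).

(** For [q = 2^(-m y)] and [N = m 2^m], the product [N q] is at least [m] when
    [y <= 1] and tends to 0 when [y > 1], so that [(1 - q)^N] tends to the
    indicator function of [y > 1]. Here [m] is [k.+1]. *)
Definition cutoff (k : nat) (y : R) : R :=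
  (1 - expR (- (k.+1%:R * ln 2 * y))) ^+ (k.+1 * 2 ^ k.+1)%N.

Lemma ln2_gt0 : 0 < ln 2 :> R.
Proof. by rewrite ln_gt0// ltr1n. Qed.

Lemma bernoulli_le (q : R) N : 0 <= q <= 1 -> 1 - N%:R * q <= (1 - q) ^+ N.
Proof.
move=> /andP[q0 q1]; elim: N => [|N IH]; first by rewrite mul0r subr0 expr0.
rewrite exprS; apply: (@le_trans _ _ ((1 - q) * (1 - N%:R * q))); last first.
  by rewrite ler_wpM2l// subr_ge0.
rewrite -natr1; have : 0 <= N%:R * q * q by rewrite !mulr_ge0.
nra.
Qed.

Lemma power_le_expR (q : R) N : 0 <= q <= 1 -> (1 - q) ^+ N <= expR (- (N%:R * q)).
Proof.
move=> /andP[q0 q1]; rewrite -mulrN expRM_natl; apply: lerXn2r.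
- by rewrite nnegrE subr_ge0.
- by rewrite nnegrE expR_ge0.
- exact: expR_ge1Dx.
Qed.

Lemma cutoff_power (k : nat) : (2 ^ k)%:R = expR (k%:R * ln 2) :> R.
Proof. by rewrite expRM_natl lnK ?posrE// natrX. Qed.

Lemma cvg_cutoff_in (y : R) : 0 <= y -> y <= 1 -> cutoff k y @[k --> \oo] --> (0 : R).
Proof.
move=> y0 y1; apply: (@squeeze_cvgr _ _ _ _ (fun=> 0) harmonic).
- apply: nearW => k; set q := expR (- (k.+1%:R * ln 2 * y)).
  have q01 : 0 <= q <= 1.
    rewrite expR_ge0 /= expR_le1 oppr_le0 !mulr_ge0//.
    exact: ltW ln2_gt0.
  apply/andP; split.
    by rewrite exprn_ge0// subr_ge0; case/andP: q01.
  apply: le_trans (power_le_expR _ q01) _.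
  have h : k.+1%:R <= (k.+1 * 2 ^ k.+1)%:R * q.
    rewrite natrM -mulrA ler_peMr// cutoff_power /q -expRD -[leLHS]expR0 ler_expR.
    have := ltW ln2_gt0; have : 0 <= k.+1%:R :> R by [].
    move: (ln 2) (k.+1%:R : R) => a b b0 a0.
    have : 0 <= b * a * (1 - y) by rewrite !mulr_ge0// subr_ge0.
    by rewrite mulrBr mulr1.
  apply: (@le_trans _ _ (expR (- k.+1%:R))); first by rewrite ler_expR lerN2.
  rewrite expRN lef_pV2 ?posrE ?expR_gt0//.
  by rewrite (le_trans _ (expR_ge1Dx _))// lerDr.
- exact: cvg_cst.
- exact: cvg_harmonic.
Qed.

Lemma cvg_cutoff_out (y : R) : 1 < y -> cutoff k y @[k --> \oo] --> (1 : R).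
Proof.
move=> y1; have d0 : 0 < (y - 1) * ln 2 by rewrite mulr_gt0 ?subr_gt0 ?ln2_gt0.
set dl := (y - 1) * ln 2 in d0.
apply: (@squeeze_cvgr _ _ _ _ (fun k => 1 - 2 / dl ^+ 2 * k.+1%:R^-1) (fun=> 1)).
- apply: nearW => k; set q := expR (- (k.+1%:R * ln 2 * y)).
  have q01 : 0 <= q <= 1.
    rewrite expR_ge0 /= expR_le1 oppr_le0 !mulr_ge0//.
      exact: ltW ln2_gt0.
    by rewrite ltW// (lt_trans _ y1).
  apply/andP; split; last first.
    by case/andP: q01 => ? ?; rewrite exprn_ile1 ?subr_ge0// gerBl.
  apply: le_trans (bernoulli_le _ q01).
  rewrite lerB// natrM -mulrA cutoff_power /q -expRD.
  have -> : k.+1%:R * ln 2 - k.+1%:R * ln 2 * y = - (k.+1%:R * dl) by rewrite /dl; ring.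
  have k0 : 0 < k.+1%:R :> R by [].
  set m := k.+1%:R in k0 *; clearbody m dl.
  have md : 0 < m * dl by rewrite mulr_gt0.
  have h := @expR_ge1Dxn R (m * dl) 1 (ltW md).
  rewrite expRN ler_pdivrMr ?expR_gt0//.
  have : (m * dl) ^+ 2 / 2 <= expR (m * dl).
    by apply: le_trans h; rewrite lerDr.
  move=> /(ler_wpM2l (_ : 0 <= 2 / dl ^+ 2 * m^-1)) h2.
  apply: le_trans (h2 _); last first.
    by rewrite !mulr_ge0 ?invr_ge0 ?exprn_ge0// ltW.
  rewrite le_eqVlt; apply/orP; left; apply/eqP; field.
  by rewrite !gt_eqF.
- rewrite -[X in _ --> X]subr0 -[X in _ --> _ - X](mulr0 (2 / dl ^+ 2)).
  apply: cvgB; first exact: cvg_cst.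
  by apply: cvgM; [exact: cvg_cst|exact: cvg_harmonic].
- exact: cvg_cst.
Qed.

End cutoff.

Lemma adde_cancel (R : realType) (x y z : \bar R) : x \is a fin_num ->
  (x + y = x + z)%E -> y = z.
Proof.
case: x => // x _; case: y => [y||]; case: z => [z||] //=.
by rewrite -!EFinD => -[] /addrI ->.
Qed.

Section gaussian_agreement.
Context (R : realType) (n : nat).
Local Notation mu := (lebesgue_Rn R n).
Variables f g : Rn R n -> R.
Hypotheses (mf : measurable_fun setT f) (mg : measurable_fun setT g).
Hypotheses (f0 : forall x, 0 <= f x) (g0 : forall x, 0 <= g x).
Hypothesis foo : forall s u, 0 < s -> (gint f setT s u < +oo)%E.
Hypothesis goo : forall s u, 0 < s -> (gint g setT s u < +oo)%E.
Hypothesis fg : forall s u, 0 < s -> gint f setT s u = gint g setT s u.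
Local Notation agree := (gauss_agree f g).

(** The Gaussian rate [m ln 2 / r^2] makes the argument of the cutoff equal to the
    squared distance to the centre in units of [r]. *)
Lemma cvg_gpint_diff (h : Rn R n -> R) E s u c r : measurable E ->
  measurable_fun setT h -> (forall x, 0 <= h x) -> 0 < r -> 0 < s ->
  (gint h setT s u < +oo)%E ->
  (gpint h E s u (k.+1%:R * ln 2 / r ^+ 2) c (k.+1 * 2 ^ k.+1)%N @[k --> \oo]
    --> gint h (E `\` eball c r) s u)%classic.
Proof.
move=> mE mh h0 r0 s0 hoo.
have mB := measurable_eball c r.
have r20 : 0 < r ^+ 2 by rewrite exprn_gt0.
have -> : gint h (E `\` eball c r) s u =
    (\int[mu]_(x in E) (h x * gauss s u x * \1_(~` eball c r) x)%:E)%E.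
  rewrite /gint setDE integral_mkcondr; apply: eq_integral => x _.
  by rewrite patchE indicE; case: ifPn => _; rewrite ?mulr1 ?mulr0.
have mhg := measurable_fgauss s u mh.
apply: (@dominated_cvg_real _ _ _ mu E _ _ (fun x => h x * gauss s u x)) => //.
- by move=> k; exact: measurable_gpower.
- by apply: measurable_funM => //; exact: measurable_indic (measurableC mB).
- move=> x; apply: cvgM; first exact: cvg_cst.
  have qr : (edist c x <= r) = (sqdist x c / r ^+ 2 <= 1).
    rewrite ler_pdivrMr// mul1r -sqr_edist edistC ler_pXn2r// nnegrE.
      exact: edist_ge0.
    exact: ltW.
  rewrite (_ : (fun k => _) = (fun k => cutoff k (sqdist x c / r ^+ 2))); last first.
    apply/funext => k; rewrite /cutoff /gauss; congr ((1 - expR (- _)) ^+ _).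
    by field; rewrite gt_eqF.
  rewrite indicE; have [xB|xB] := boolP (x \in ~` eball c r).
    apply: cvg_cutoff_out; move: xB; rewrite inE /eball /= => /negP.
    by rewrite qr -ltNge.
  apply: cvg_cutoff_in; first by rewrite divr_ge0 ?sqdist_ge0// ltW.
  by rewrite -qr; apply: contraNT xB => xr; rewrite inE /eball /=; exact/negP.
- move=> k x; have rk : 0 < k.+1%:R * ln 2 / r ^+ 2 :> R.
    by rewrite divr_gt0// mulr_gt0 ?ln2_gt0.
  have /andP[p1 p2] := gpower_itv c (k.+1 * 2 ^ k.+1)%N x rk.
  have hg : 0 <= h x * gauss s u x by rewrite mulr_ge0 ?gauss_ge0.
  by rewrite mulr_ge0//= ler_piMr.
- exact: le_lt_trans (gint_setT s u mE mh h0) hoo.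
Qed.

Lemma gauss_agree_diff E c r : measurable E -> agree E -> 0 < r ->
  agree (E `\` eball c r).
Proof.
move=> mE aE r0 s u s0.
have L1 := cvg_gpint_diff (c := c) mE mf f0 r0 s0 (foo u s0).
have L2 := cvg_gpint_diff (c := c) mE mg g0 r0 s0 (goo u s0).
have e : (fun k : nat => gpint f E s u (k.+1%:R * ln 2 / r ^+ 2) c (k.+1 * 2 ^ k.+1)%N) =
    (fun k : nat => gpint g E s u (k.+1%:R * ln 2 / r ^+ 2) c (k.+1 * 2 ^ k.+1)%N).
  apply/funext => k; apply: gauss_agree_power => //.
  by rewrite divr_gt0 ?exprn_gt0// mulr_gt0 ?ln2_gt0.
by move: L1; rewrite e => L1; exact: (cvg_unique _ L1 L2).
Qed.

Lemma gint_diff (h : Rn R n -> R) E A s u : measurable E -> measurable A ->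
  measurable_fun setT h -> (forall x, 0 <= h x) ->
  gint h E s u = (gint h (E `&` A) s u + gint h (E `\` A) s u)%E.
Proof.
move=> mE mA mh h0; rewrite /gint -{1}(setUIDK E A) ge0_integral_setU//.
- exact: measurableI.
- exact: measurableD.
- by apply/measurable_EFinP; apply: measurable_funTS; exact: measurable_fgauss.
- by move=> x _; rewrite lee_fin mulr_ge0 ?gauss_ge0.
- by apply/disj_set2P; rewrite setDE setIACA setICr setI0.
Qed.

Lemma gauss_agree_compl E A : measurable E -> measurable A -> agree E ->
  agree (E `&` A) <-> agree (E `\` A).
Proof.
move=> mE mA aE.
have fin (h : Rn R n -> R) B s u : measurable B -> measurable_fun setT h ->
    (forall x, 0 <= h x) -> (gint h setT s u < +oo)%E -> gint h B s u \is a fin_num.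
  move=> mB mh h0 hoo; rewrite ge0_fin_numE ?gint_ge0//.
  exact: le_lt_trans (gint_setT s u mB mh h0) hoo.
have mI : measurable (E `&` A) by exact: measurableI.
have mD : measurable (E `\` A) by exact: measurableD.
split => h s u s0; have := aE s u s0;
  rewrite (gint_diff s u mE mA mf f0) (gint_diff s u mE mA mg g0) h//.
  by apply: adde_cancel; exact: (fin g _ s u mI mg g0 (goo u s0)).
rewrite addeC [RHS]addeC; apply: adde_cancel.
exact: (fin g _ s u mD mg g0 (goo u s0)).
Qed.

(** Quantifying over every [E] on which agreement holds makes these sets closed
    under intersection, hence a sigma-algebra and not merely a lambda-system. *)
Definition agree_stable : set (set (Rn R n)) := [set A | measurable A /\
  forall E, measurable E -> agree E -> agree (E `&` A)].

Lemma agree_stableC A : agree_stable A -> agree_stable (~` A).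
Proof.
move=> [mA sA]; split; first exact: measurableC.
move=> E mE aE; rewrite -setDE; apply: (proj1 (gauss_agree_compl mE mA aE)).
exact: sA.
Qed.

Lemma agree_stableU A B : agree_stable A -> agree_stable B -> agree_stable (A `|` B).
Proof.
move=> sA sB; have [mCA cA] := agree_stableC sA; have [mCB cB] := agree_stableC sB.
rewrite -[_ `|` _]setCK setCU; apply: agree_stableC; split.
  exact: measurableI.
move=> E mE aE; rewrite setIA; apply: cB; last exact: cA.
exact: measurableI.
Qed.

Lemma agree_stable0 : agree_stable set0.
Proof. by split => // E mE aE s u s0; rewrite setI0 /gint !integral_set0. Qed.

Lemma agree_stable_bigcup (F : nat -> set (Rn R n)) :
  (forall k, agree_stable (F k)) -> agree_stable (\bigcup_k F k).
Proof.
move=> sF; pose U k := \big[setU/set0]_(i < k) F i.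
have sU k : agree_stable (U k).
  rewrite /U; elim: k => [|k IH]; first by rewrite big_ord0; exact: agree_stable0.
  by rewrite big_ord_recr; exact: agree_stableU.
have UE : \bigcup_k F k = \bigcup_k U k.
  rewrite eqEsubset; split => x [k _ Fx].
    by exists k.+1 => //; rewrite /U big_ord_recr; right.
  by move: Fx; rewrite /U -bigcup_mkord => -[i _ Fi]; exists i.
rewrite UE; split; first by apply: bigcupT_measurable => k; have [] := sU k.
move=> E mE aE s u s0; rewrite setI_bigcupr.
have mono : {homo (fun k => E `&` U k) : a b / (a <= b)%N >-> (a <= b)%O}.
  by move=> a b ab; apply/subsetPset; apply: setIS; exact: subset_bigsetU.
have mEU k : measurable (E `&` U k) by apply: measurableI => //; have [] := sU k.
have L (h : Rn R n -> R) : measurable_fun setT h -> (forall x, 0 <= h x) ->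
    (gint h (E `&` U k) s u @[k --> \oo] --> gint h (\bigcup_k (E `&` U k)) s u)%classic.
  move=> mh h0; apply: ge0_nondecreasing_set_cvg_integral => //.
  - by move=> i; apply/measurable_EFinP; apply: measurable_funTS; exact: measurable_fgauss.
  - by move=> i x _; rewrite lee_fin mulr_ge0 ?gauss_ge0.
have L1 := L f mf f0; have L2 := L g mg g0.
have e : (fun k => gint f (E `&` U k) s u) = (fun k => gint g (E `&` U k) s u).
  by apply/funext => k; have [_ sUk] := sU k; exact: sUk.
by move: L1; rewrite e => L1; exact: (cvg_unique _ L1 L2).
Qed.

Lemma agree_stable_eball c r : 0 < r -> agree_stable (eball c r).
Proof.
move=> r0; split; first exact: measurable_eball.
move=> E mE aE.
apply: (proj2 (gauss_agree_compl mE (measurable_eball c r) aE)).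
exact: gauss_agree_diff.
Qed.

(** A half-space is a union of balls of radius [m] whose boundary stays at
    distance [1/m] from the bounding hyperplane. *)
Lemma agree_stable_halfspace (i : 'I_n) (a : R) :
  agree_stable [set x | tnth x i < a].
Proof.
pose c k : Rn R n := [tuple (if j == i then a - k.+1%:R - k.+1%:R^-1 else 0) | j < n].
have -> : [set x : Rn R n | tnth x i < a] = \bigcup_k eball (c k) k.+1%:R.
  have dE k x : (eball (c k) k.+1%:R x) =
      ((a - k.+1%:R - k.+1%:R^-1 - tnth x i) ^+ 2 +
        \sum_(j < n | j != i) tnth x j ^+ 2 <= k.+1%:R ^+ 2) :> Prop.
    rewrite /eball /= -(ler_pXn2r (_ : (0 < 2)%N)) ?nnegrE ?edist_ge0//.
    rewrite sqr_edist /sqdist (bigD1 i)//= tnth_mktuple eqxx.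
    rewrite (eq_bigr (fun j => tnth x j ^+ 2))// => j ji.
    by rewrite tnth_mktuple (negbTE ji) sub0r sqrrN.
  rewrite eqEsubset; split => x /=.
    move=> xa; set S := \sum_(j < n | j != i) tnth x j ^+ 2.
    have S0 : 0 <= S by apply: sumr_ge0 => j _; exact: sqr_ge0.
    pose d := a - tnth x i; have d0 : 0 < d by rewrite subr_gt0.
    (* The defect of the i-th coordinate is at least of order m d for large m, and
       it has to absorb the squared norm S of the other coordinates. *)
    pose k := Num.truncn (2 / d + (S + d ^+ 2) / d).
    have kb : 2 / d + (S + d ^+ 2) / d < k.+1%:R.
      by rewrite /k; apply: real_truncnS_gt; exact: num_real.
    exists k => //; rewrite dE -/S.
    have k0 : 1 <= k.+1%:R :> R by rewrite ler1n.
    set m : R := k.+1%:R in kb k0 *; clearbody m k.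
    have -> : a - m - m^-1 - tnth x i = d - m - m^-1 by rewrite /d; ring.
    have md : 2 + (S + d ^+ 2) < m * d.
      by move: kb; rewrite -mulrDl ltr_pdivrMr.
    have m0 : 0 < m by exact: lt_le_trans ltr01 k0.
    have mi : m * m^-1 = 1 by rewrite mulfV// gt_eqF.
    have mi0 : 0 < m^-1 by rewrite invr_gt0.
    have mi1 : m^-1 <= 1 by rewrite invf_le1.
    clearbody d S; move: mi mi0 mi1; move: (m^-1) => e mi mi0 mi1.
    have de : 0 <= e * d by rewrite mulr_ge0// ltW.
    have ee : e * e <= 1 by nra.
    rewrite !expr2 in S0 md *; nra.
  move=> [k _]; rewrite dE.
  have S0 : 0 <= \sum_(j < n | j != i) tnth x j ^+ 2 by apply: sumr_ge0 => j _; exact: sqr_ge0.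
  have k0 : 0 < k.+1%:R^-1 :> R by rewrite invr_gt0.
  have k1 : 0 < k.+1%:R :> R by [].
  move: S0 k0 k1; move: (\sum_(j < n | j != i) _) (k.+1%:R^-1 : R) (k.+1%:R : R) (tnth x i) => S e m y S0 e0 m0 h.
  by rewrite ltNge; apply/negP => ya; move: h; rewrite expr2 expr2; nra.
by apply: agree_stable_bigcup => k; exact: agree_stable_eball.
Qed.

Lemma sigma_algebra_agree_stable : sigma_algebra setT agree_stable.
Proof.
split; first exact: agree_stable0.
- by move=> A sA; rewrite setTD; exact: agree_stableC.
- exact: agree_stable_bigcup.
Qed.

(** The sigma-algebra of stable sets makes every coordinate measurable. *)
Lemma measurable_agree_stable A : measurable A -> agree_stable A.
Proof.
move=> mA; pose T' := g_sigma_algebraType agree_stable.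
have T'E B : measurable (B : set T') -> agree_stable B.
  by rewrite /measurable /= (sigma_algebra_id sigma_algebra_agree_stable).
have ET' B : agree_stable B -> measurable (B : set T').
  by move=> ?; exact: sub_sigma_algebra.
have mid : measurable_fun [set: T'] (fun x : T' => (x : Rn R n)).
  apply/measurable_fun_tnthP => i.
  apply: (measurability _ (RGenInftyO.measurableE R)).
  move=> _ [_ [a ->] <-]; rewrite setTI; apply: ET'.
  rewrite (_ : _ @^-1` _ = [set x : Rn R n | tnth x i < a]).
    exact: agree_stable_halfspace.
  by apply/seteqP; split => x /=; rewrite in_itv.
apply: T'E; rewrite -[X in measurable X]setTI; exact: mid.
Qed.

(** Agreement on all measurable sets, for a single positive Gaussian. *)
Lemma gaussian_unique : {ae mu, forall x, f x = g x}.
Proof.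
have aT : agree setT by [].
have aA A : measurable A -> agree A.
  by move=> /measurable_agree_stable[_ h]; rewrite -[A]setTI; exact: h.
have h1 : ae_eq mu setT (fun x => (f x * gauss 1 origin x)%:E)
    (fun x => (g x * gauss 1 origin x)%:E).
  apply: integral_ae_eq => //.
  - apply/integrableP; split.
      by apply/measurable_EFinP; exact: measurable_fgauss.
    under eq_integral do rewrite gee0_abs ?lee_fin ?mulr_ge0 ?gauss_ge0//.
    exact: foo.
  - by apply/measurable_EFinP; exact: measurable_fgauss.
  - by move=> E _ mE; exact: aA.
apply: filterS h1 => x /(_ I) [] /mulIf; apply.
by rewrite gt_eqF// expR_gt0.
Qed.

End gaussian_agreement.

(** * Strict positive definiteness of the Riesz energy *)

Section strict_positivity.
Context (R : realType) (n : nat).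
Local Notation mu := (lebesgue_Rn R n).

(** Equality in the inequality between means, integrated against a positive
    density, forces the Gaussian transforms of [f] and [g] to agree almost
    everywhere, and they determine the functions. *)
Lemma energy_strict (l : R) (f g : Rn R n -> R) : (0 < n)%N -> 0 < l ->
  measurable_fun setT f -> measurable_fun setT g ->
  (forall x, 0 <= f x) -> (forall x, 0 <= g x) ->
  (energy l f f + energy l g g <= energy l f g + energy l f g)%E ->
  (energy l f g < +oo)%E -> {ae mu, forall x, f x = g x}.
Proof.
move=> n0 l0 mf mg f0 g0 h1 h2.
have fg := energy_amgm_eq n0 l0 mf mg f0 g0 h1 h2.
apply: gaussian_unique => //.
- by move=> s u s0; exact: (gint_finite mf f0 fg u s0).
- by move=> s u s0; exact: (gint_finiteg mg g0 fg u s0).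
- by move=> s u s0; exact: (gint_eq mf mg f0 g0 fg u s0).
Qed.

End strict_positivity.

(** * Iterated triple integrals *)

Section triple_integrals.
Context (R : realType) (n : nat).
Local Notation mu := (lebesgue_Rn R n).
Local Notation V := (Rn R n).
Implicit Types h s : V -> V -> V -> R.

Definition measurable3 h := measurable_fun setT (fun w : V * V * V => h w.1.1 w.1.2 w.2).

Definition integral3 h : \bar R := (\int[mu]_x \int[mu]_y \int[mu]_z (h x y z)%:E)%E.

Lemma measurable_tri1 : measurable_fun setT (fun w : V * V * V => w.1.1).
Proof. exact: (measurableT_comp measurable_fst measurable_fst). Qed.

Lemma measurable_tri2 : measurable_fun setT (fun w : V * V * V => w.1.2).
Proof. exact: (measurableT_comp measurable_snd measurable_fst). Qed.

Lemma measurable_tri3 : measurable_fun setT (fun w : V * V * V => w.2).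
Proof. exact: measurable_snd. Qed.

Lemma measurable3_comp d (T : measurableType d) h (a b c : T -> V) : measurable3 h ->
  measurable_fun setT a -> measurable_fun setT b -> measurable_fun setT c ->
  measurable_fun setT (fun t => h (a t) (b t) (c t)).
Proof.
move=> mh ma mb mc.
apply: (measurableT_comp mh (g := fun t => ((a t, b t), c t))).
by apply: measurable_fun_pair => //; exact: measurable_fun_pair.
Qed.

Lemma measurable3_inner h : measurable3 h -> (forall x y z, 0 <= h x y z) ->
  measurable_fun setT (fun w : V * V => \int[mu]_z (h w.1 w.2 z)%:E)%E.
Proof.
move=> mh h0.
apply: (measurable_fun_fubini_tonelli_F (m2 := mu)
  (fun w : V * V * V => (h w.1.1 w.1.2 w.2)%:E)).
  exact/measurable_EFinP.
by move=> w; rewrite lee_fin.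
Qed.

Lemma integral3E h : measurable3 h -> (forall x y z, 0 <= h x y z) ->
  (\int[mu \x mu \x mu]_w (h w.1.1 w.1.2 w.2)%:E = integral3 h)%E.
Proof.
move=> mh h0.
rewrite (fubini_tonelli1 (m1 := product_sf mu mu) (m2 := mu)
  (fun w : V * V * V => (h w.1.1 w.1.2 w.2)%:E)); last 2 first.
- exact/measurable_EFinP.
- by move=> w; rewrite lee_fin.
rewrite /fubini_F (fubini_tonelli1 (m1 := mu) (m2 := mu)
  (fun w : V * V => \int[mu]_z (h w.1 w.2 z)%:E)%E)//.
- exact: measurable3_inner.
- by move=> w; apply: integral_ge0 => z _; rewrite lee_fin.
Qed.

Lemma integral3_swap12 h : measurable3 h -> (forall x y z, 0 <= h x y z) ->
  integral3 (fun x y z => h y x z) = integral3 h.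
Proof.
move=> mh h0; rewrite /integral3.
rewrite (fubini_tonelli (m1 := mu) (m2 := mu)
  (fun w : V * V => \int[mu]_z (h w.2 w.1 z)%:E)%E)//.
- apply: (measurable3_inner (h := fun x y z => h y x z)) => //.
  by apply: (measurable3_comp mh);
    [exact: measurable_tri2|exact: measurable_tri1|exact: measurable_tri3].
- by move=> w; apply: integral_ge0 => z _; rewrite lee_fin.
Qed.

Lemma integral3_swap23 h : measurable3 h -> (forall x y z, 0 <= h x y z) ->
  integral3 (fun x y z => h x z y) = integral3 h.
Proof.
move=> mh h0; rewrite /integral3; apply: eq_integral => x _.
rewrite (fubini_tonelli (m1 := mu) (m2 := mu)
  (fun w : V * V => (h x w.2 w.1)%:E))//.
- apply/measurable_EFinP; apply: (measurable3_comp mh) => //.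
- by move=> w; rewrite lee_fin.
Qed.

Lemma measurable3D h s : measurable3 h -> measurable3 s ->
  measurable3 (fun x y z => h x y z + s x y z).
Proof. by move=> mh ms; exact: measurable_funD. Qed.

Lemma le_integral3 h s : measurable3 h -> measurable3 s ->
  (forall x y z, 0 <= h x y z) -> (forall x y z, h x y z <= s x y z) ->
  (integral3 h <= integral3 s)%E.
Proof.
move=> mh ms h0 hs; have s0 x y z : 0 <= s x y z by exact: le_trans (hs x y z).
rewrite -!integral3E//.
by apply: (ge0_le_integral_real (mu \x mu \x mu)%E mh ms).
Qed.

Lemma integral3D h s : measurable3 h -> measurable3 s ->
  (forall x y z, 0 <= h x y z) -> (forall x y z, 0 <= s x y z) ->
  integral3 (fun x y z => h x y z + s x y z) = (integral3 h + integral3 s)%E.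
Proof.
move=> mh ms h0 s0; rewrite -!integral3E//.
- by apply: (ge0_integral_realD (mu \x mu \x mu)%E mh ms).
- exact: measurable_funD.
- by move=> x y z; exact: addr_ge0.
Qed.

(** The form in which domination is used: the bound of the integrand singles out
    one of the three variables, and the three choices have the same integral. *)
Lemma integral3_sum3_lty h s : measurable3 h -> measurable3 s ->
  (forall x y z, 0 <= h x y z) -> (forall x y z, 0 <= s x y z) ->
  (forall x y z, h x y z <= s x y z + s y x z + s z x y) ->
  (integral3 s < +oo)%E -> (integral3 h < +oo)%E.
Proof.
move=> mh ms h0 s0 hs soo.
have ms1 : measurable3 (fun x y z => s y x z).
  by apply: (measurable3_comp ms);
    [exact: measurable_tri2|exact: measurable_tri1|exact: measurable_tri3].
have ms2 : measurable3 (fun x y z => s z x y).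
  by apply: (measurable3_comp ms);
    [exact: measurable_tri3|exact: measurable_tri1|exact: measurable_tri2].
have ms12 := measurable3D ms ms1.
have s120 x y z : 0 <= s x y z + s y x z by exact: addr_ge0.
have ms123 := measurable3D ms12 ms2.
apply: (le_lt_trans (le_integral3 mh ms123 h0 hs)).
have H2 := integral3D ms12 ms2 s120 (fun x y z => s0 z x y).
have H3 := integral3D ms ms1 s0 (fun x y z => s0 y x z).
have E1 := integral3_swap12 ms s0.
have E2 : integral3 (fun x y z => s z x y) = integral3 (fun x y z => s y x z).
  exact: (integral3_swap23 ms1 (fun x y z => s0 y x z)).
rewrite H2 H3 E2 E1.
exact: (lte_add_pinfty (lte_add_pinfty soo soo) soo).
Qed.

End triple_integrals.

(** * Finiteness of the form on square-integrable functions *)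

Ltac measurable_tac := repeat
  lazymatch goal with
  | |- measurable_fun _ (fun w => (@?a w * @?b w)%R) =>
      apply: (@measurable_funM _ _ _ _ a b)
  | |- measurable_fun _ (fun w => (@?a w + @?b w)%R) =>
      apply: (@measurable_funD _ _ _ _ a b)
  | |- measurable_fun _ (fun w => (@?a w ^+ _)%R) => apply: (@measurable_funX _ _ _ _ a)
  | |- measurable_fun _ (fun w => (@?a w `^ _)%R) => apply: (@measurable_powRl _ _ _ a)
  | |- measurable_fun _ (fun w => Num.min (@?a w) (@?b w)) =>
      apply: (@measurable_minr _ _ _ _ a b)
  | |- measurable_fun _ (fun w => Defs.edist (@?a w) (@?b w)) =>
      apply: (@measurable_edist _ _ _ _ a b)
  | |- measurable_fun _ (fun w => w.1.1) => exact: measurable_tri1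
  | |- measurable_fun _ (fun w => w.1.2) => exact: measurable_tri2
  | |- measurable_fun _ (fun w => w.1) => exact: measurable_fst
  | |- measurable_fun _ (fun w => w.2) => exact: measurable_snd
  | |- measurable_fun _ (fun w => w) => exact: measurable_id
  | H : measurable_fun setT ?f |- measurable_fun _ (fun w => ?f (@?c w)) =>
      apply: (measurableT_comp H (g := c))
  | |- _ => exact: measurable_cst
  end.

Section real_inequalities.
Context (R : realType).

Lemma le_add_of_sqr (L P Q : R) : 0 <= P -> 0 <= Q -> L ^+ 2 = P * Q -> L <= P + Q.
Proof. by rewrite !expr2 => *; nra. Qed.

Lemma mul_le_sqrD (x y : R) : x * y <= x ^+ 2 + y ^+ 2.
Proof. by have := sqr_ge0 (x - y); have := sqr_ge0 (x + y); rewrite !expr2; nra. Qed.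

Lemma powR_half_mul (x : R) : 0 <= x -> x `^ 2^-1 * x `^ 2^-1 = x.
Proof. by move=> x0; rewrite powR12_sqrt// -expr2 sqr_sqrtr. Qed.

(** Of three factors, the smallest is at most the geometric mean of the two
    others. *)
Lemma mul3_le_stars (u v w : R) : 0 <= u -> 0 <= v -> 0 <= w ->
  u * v * w <= u `^ (3 / 2) * v `^ (3 / 2) + u `^ (3 / 2) * w `^ (3 / 2)
    + v `^ (3 / 2) * w `^ (3 / 2).
Proof.
have main (x y z : R) : 0 <= x -> 0 <= y -> 0 <= z -> z <= x -> z <= y ->
    x * y * z <= x `^ (3 / 2) * y `^ (3 / 2).
  move=> x0 y0 z0 zx zy; rewrite -powRM//.
  have xy0 : 0 <= x * y by rewrite mulr_ge0.
  have [xy|xy] := eqVneq (x * y) 0.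
    by rewrite xy mul0r powR_ge0.
  have -> : 3 / 2 = 1 + 2^-1 :> R by field.
  rewrite powRD ?xy ?implybT// powRr1// ler_wpM2l//.
  rewrite -[leLHS](powR_half_mul z0) -powRM//; apply: ge0_ler_powR => //.
  - by rewrite nnegrE mulr_ge0.
  - by apply: ler_pM.
move=> u0 v0 w0; have p x y : 0 <= x `^ (3 / 2) * y `^ (3 / 2) :> R.
  by rewrite mulr_ge0 ?powR_ge0.
have := p u v; have := p u w; have := p v w => p1 p2 p3.
have [uv|/ltW uv] := leP u v.
  have [uw|/ltW wu] := leP u w.
    have := main v w u v0 w0 u0 uv uw; lra.
  by have := main u v w u0 v0 w0 wu (le_trans wu uv); lra.
have [vw|/ltW wv] := leP v w.
  by have := main u w v u0 w0 v0 uv vw; lra.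
by have := main u v w u0 v0 w0 (le_trans wv uv) wv; lra.
Qed.

End real_inequalities.

Section square_integrable.
Context (R : realType) (n : nat).
Local Notation mu := (lebesgue_Rn R n).
Local Notation V := (Rn R n).

(** Integration from the last variable to the first, one uniform bound at a time. *)
Lemma integral3_chain (A k l : V -> R) (p : V -> V -> R) (q : V -> V -> V -> R) :
  measurable_fun setT A -> measurable_fun setT k -> measurable_fun setT l ->
  measurable_fun setT (fun w : V * V => p w.1 w.2) -> measurable3 q ->
  (forall x, 0 <= A x) -> (forall x, 0 <= k x) -> (forall x, 0 <= l x) ->
  (forall x y, 0 <= p x y) -> (forall x y z, 0 <= q x y z) ->
  (forall x y, (\int[mu]_z (q x y z)%:E <= (k x)%:E)%E) ->
  (forall x, (\int[mu]_y (p x y)%:E <= (l x)%:E)%E) ->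
  (integral3 (fun x y z => (A x * p x y) * q x y z)%R
    <= \int[mu]_x (A x * k x * l x)%:E)%E.
Proof.
move=> mA mk ml mp mq A0 k0 l0 p0 q0 qk pl; rewrite /integral3.
have mpair (x : V) : measurable_fun setT (fun y : V => (x, y)).
  by apply: measurable_fun_pair => //; exact: measurable_cst.
have mpx x : measurable_fun setT (p x).
  exact: (measurableT_comp mp (mpair x)).
have mqxy x y : measurable_fun setT (q x y).
  by apply: (measurable3_comp mq) => //; exact: measurable_cst.
have mApq : measurable3 (fun x y z => A x * p x y * q x y z).
  exact: (measurable_funM (measurable_funM (measurableT_comp mA (@measurable_tri1 R n))
    (measurableT_comp mp measurable_fst)) mq).
apply: ge0_le_integral => //.
- move=> x _; apply: integral_ge0 => y _; apply: integral_ge0 => z _.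
  by rewrite lee_fin !mulr_ge0.
- apply: (measurable_fun_fubini_tonelli_F (m2 := mu) (fun w : V * V =>
    (\int[mu]_z (A w.1 * p w.1 w.2 * q w.1 w.2 z)%:E)%E)).
    apply: (measurable3_inner mApq).
    by move=> x y z; rewrite !mulr_ge0.
  by move=> w; apply: integral_ge0 => z _; rewrite lee_fin !mulr_ge0.
- by apply/measurable_EFinP; do 2?[apply: measurable_funM => //].
move=> x _; apply: (@le_trans _ _ (\int[mu]_y (A x * k x * p x y)%:E)%E).
  apply: ge0_le_integral => //.
  - move=> y _; apply: integral_ge0 => z _.
    by rewrite lee_fin !mulr_ge0.
  - apply: (measurableT_comp (measurable3_inner mApq _) (mpair x)).
    by move=> *; rewrite !mulr_ge0.
  - by apply/measurable_EFinP; exact: measurable_funM.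
  - move=> y _; rewrite ge0_integral_realZ//; last by rewrite mulr_ge0.
    apply: (@le_trans _ _ ((A x * p x y)%:E * (k x)%:E)%E).
      by rewrite lee_wpmul2l// lee_fin mulr_ge0.
    by rewrite -EFinM lee_fin mulrAC.
rewrite ge0_integral_realZ//; last by rewrite mulr_ge0.
rewrite [leRHS]EFinM lee_wpmul2l// lee_fin; exact: mulr_ge0.
Qed.

Variable g : V -> R.
Hypotheses (mg : measurable_fun setT g) (g0 : forall x, 0 <= g x).
Hypothesis g2 : (\int[mu]_x (g x ^+ 2)%:E < +oo)%E.
Hypothesis n0 : (0 < n)%N.

Definition weight (a : R) (x : V) : R := edist origin x `^ (- a).
Definition riesz (b : R) (x y : V) : R := edist x y `^ (- b).

Lemma weight_ge0 a x : 0 <= weight a x. Proof. exact: powR_ge0. Qed.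
Lemma riesz_ge0 b x y : 0 <= riesz b x y. Proof. exact: powR_ge0. Qed.
Lemma rieszC b x y : riesz b x y = riesz b y x.
Proof. by rewrite /riesz edistC. Qed.
Lemma measurable_weight a : measurable_fun setT (weight a).
Proof. exact: measurable_edist_powR. Qed.
Lemma measurable_riesz b : measurable_fun setT (fun w : V * V => riesz b w.1 w.2).
Proof. by apply: measurable_powRl; exact: measurable_edist. Qed.
Lemma measurable_rieszr b x : measurable_fun setT (riesz b x).
Proof. exact: measurable_edist_powR. Qed.

(** The integrand left when one of the three kernels is discarded: the variable
    [x] is joined to [y] and to [z], which are not joined to each other. *)
Definition star (a c : R) (x y z : V) : R :=
  g x * g y * g z * (weight a x * weight a y * weight a z) *
  (riesz c x y * riesz c x z).

Lemma star_ge0 a c x y z : 0 <= star a c x y z.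
Proof. by rewrite /star; do !apply: mulr_ge0; rewrite ?powR_ge0 ?g0. Qed.

Lemma measurable_star a c : measurable3 (star a c).
Proof. by rewrite /measurable3 /star /weight /riesz; measurable_tac. Qed.

(** Without weights the exponents are critical and no bound is uniform. Cutting [g]
    at the level [m] repairs this: inside the ball of radius [m^(-2/n)] the cut function is
    replaced by [m], outside it the inequality between means brings in the square
    of [g], and for this radius both parts are of order [m^(1/2)]. *)
Lemma integral_truncated_riesz : exists2 C : R, 0 <= C &
  forall m x, 0 <= m ->
  (\int[mu]_y (Num.min (g y) m * riesz (3 / 4 * n%:R) x y)%:E <= (C * m `^ 2^-1)%:E)%E.
Proof.
have nR : 0 < n%:R :> R by rewrite ltr0n.
have [C1 C10 near] : exists2 C : R, 0 <= C & forall (c : V) r, 0 < r ->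
    (\int[mu]_y (\1_(eball c r) y * riesz (3 / 4 * n%:R) c y)%:E
      <= (C * r `^ (n%:R - 3 / 4 * n%:R))%:E)%E.
  by apply: integral_edist_near; apply/andP; split; lra.
have h2 : n%:R < 3 / 2 * n%:R :> R by lra.
have [C2 C20 far] := integral_edist_far h2.
pose G := fine (\int[mu]_x (g x ^+ 2)%:E).
have GE : (\int[mu]_x (g x ^+ 2)%:E)%E = G%:E.
  rewrite fineK// ge0_fin_numE//; apply: integral_ge0 => x _.
  by rewrite lee_fin sqr_ge0.
have G0 : 0 <= G.
  by rewrite -lee_fin -GE; apply: integral_ge0 => x _; rewrite lee_fin sqr_ge0.
exists (C1 + (G + C2)); first by rewrite !addr_ge0.
move=> m x; rewrite le_eqVlt => /predU1P[<-|m0].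
  rewrite powR0 ?invr_eq0// mulr0 integral0_eq// => y _.
  by rewrite min_r// mul0r.
pose r := m `^ (- (2 / n%:R)); have r0 : 0 < r by rewrite powR_gt0.
have mh0 : 0 <= m `^ 2^-1 by exact: powR_ge0.
have mhm : m `^ 2^-1 * m `^ 2^-1 = m by rewrite powR_half_mul// ltW.
pose N y : R := \1_(eball x r) y * riesz (3 / 4 * n%:R) x y.
pose F y : R := \1_(~` eball x r) y * riesz (3 / 2 * n%:R) x y.
have mN : measurable_fun setT N.
  apply: measurable_funM; last exact: measurable_rieszr.
  exact: measurable_indic (measurable_eball x r).
have mF : measurable_fun setT F.
  apply: measurable_funM; last exact: measurable_rieszr.
  exact: measurable_indic (measurableC (measurable_eball x r)).
have N0 y : 0 <= N y by rewrite mulr_ge0 ?powR_ge0.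
have F0 y : 0 <= F y by rewrite mulr_ge0 ?powR_ge0.
have NE : (\int[mu]_y (N y)%:E <= (C1 * (m `^ 2^-1)^-1)%:E)%E.
  apply: le_trans (near x r r0) _; rewrite lee_fin ler_wpM2l//.
  rewrite /r -powRrM -powRN le_eqVlt; apply/orP; left; apply/eqP; congr powR.
  by field; rewrite gt_eqF.
have FE : (\int[mu]_y (F y)%:E <= (C2 * m)%:E)%E.
  apply: le_trans (far x r r0) _; rewrite lee_fin ler_wpM2l//.
  rewrite /r -powRrM -[leRHS](powRr1 (ltW m0)) le_eqVlt; apply/orP; left; apply/eqP.
  by congr powR; field; rewrite gt_eqF.
have riesz2 y : riesz (3 / 2 * n%:R) x y = riesz (3 / 4 * n%:R) x y ^+ 2.
  by rewrite /riesz -powR_mulrn ?powR_ge0// -powRrM; congr powR; field.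
have NE' y : N y = \1_(eball x r) y * riesz (3 / 4 * n%:R) x y by [].
have FE' y : F y = \1_(~` eball x r) y * riesz (3 / 4 * n%:R) x y ^+ 2.
  by rewrite -riesz2.
have mh_gt0 : 0 < m `^ 2^-1 by rewrite powR_gt0.
move: (m `^ 2^-1) mh0 mhm NE mh_gt0 => t t0 tt NE tgt0.
clearbody N F; clear near far riesz2.
have dom y : Num.min (g y) m * riesz (3 / 4 * n%:R) x y <=
    m * N y + (t * g y ^+ 2 + t^-1 * F y).
  have := riesz_ge0 (3 / 4 * n%:R) x y; move: (NE' y) (FE' y).
  move: (N y) (F y) (riesz (3 / 4 * n%:R) x y) => Ny Fy k NyE FyE k0.
  have [yx|yx] := boolP (y \in eball x r).
    rewrite NyE FyE !indicE in_setC yx /= mul1r mul0r mulr0 addr0.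
    apply: ler_wpDr; first by rewrite mulr_ge0 ?sqr_ge0.
    by rewrite ler_wpM2r// ge_min lexx orbT.
  rewrite NyE FyE !indicE in_setC (negbTE yx) /= mul0r mulr0 add0r mul1r.
  apply: (@le_trans _ _ (g y * k)); first by rewrite ler_wpM2r// ge_min lexx.
  have -> : g y * k = t * (g y * (t^-1 * k)) by field; rewrite gt_eqF.
  have -> : t * g y ^+ 2 + t^-1 * k ^+ 2 = t * (g y ^+ 2 + (t^-1 * k) ^+ 2).
    by field; rewrite gt_eqF.
  by rewrite ler_wpM2l// mul_le_sqrD.
have ti0 : 0 <= t^-1 by rewrite invr_ge0.
have m0' := ltW m0.
have mg2 : measurable_fun setT (fun y => g y ^+ 2) by exact: measurable_funX.
have p1 y : 0 <= m * N y by exact: mulr_ge0.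
have p2 y : 0 <= t * g y ^+ 2 by rewrite mulr_ge0 ?sqr_ge0.
have p3 y : 0 <= t^-1 * F y by exact: mulr_ge0.
have mm1 : measurable_fun setT (fun y => m * N y) by exact: measurable_funM.
have mm2 : measurable_fun setT (fun y => t * g y ^+ 2) by exact: measurable_funM.
have mm3 : measurable_fun setT (fun y => t^-1 * F y) by exact: measurable_funM.
apply: (@le_trans _ _ (\int[mu]_y (m * N y + (t * g y ^+ 2 + t^-1 * F y))%:E)%E).
  apply: ge0_le_integral_real => //.
  - apply: measurable_funM; last exact: measurable_rieszr.
    by apply: measurable_minr => //; exact: measurable_cst.
  - by apply: measurable_funD => //; exact: measurable_funD.
  - by move=> y; rewrite mulr_ge0 ?riesz_ge0// le_min g0 m0'.
rewrite ge0_integral_realD//; last 2 first.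
- exact: measurable_funD.
- by move=> y; exact: addr_ge0.
rewrite ge0_integral_realD// !ge0_integral_realZ//; last by move=> y; exact: sqr_ge0.
rewrite GE.
have -> : (C1 + (G + C2)) * t = m * (C1 * t^-1) + (t * G + t^-1 * (C2 * m)).
  by rewrite -tt; field; rewrite gt_eqF.
rewrite !EFinD; apply: leeD; last apply: leeD => //.
  by rewrite [leRHS]EFinM lee_wpmul2l ?lee_fin.
by rewrite [leRHS]EFinM lee_wpmul2l ?lee_fin.
Qed.

(** The truncated bounds apply once the variables are ordered by the value of [g]:
    the largest of the three values is the level at which the two others are cut,
    and [m^(1/2)] is gained twice, leaving the integral of [g^2]. *)
Lemma star_finite_unweighted : (integral3 (star 0 (3 / 4 * n%:R)) < +oo)%E.
Proof.
have [C C0 HC] := integral_truncated_riesz.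
set c := 3 / 4 * n%:R in HC *.
pose tr (m : R) x y := Num.min (g y) m * riesz c x y.
have tr0 m x y : 0 <= m -> 0 <= tr m x y.
  by move=> m0; rewrite mulr_ge0 ?riesz_ge0// le_min g0 m0.
(* x carries the largest value; it is the middle of the path in h1 and an end of
   the path in h2. *)
pose h1 x y z := (g x * tr (g x) x y) * tr (g x) x z.
pose h2 x y z := (g x * tr (g x) x y) * tr (g x) y z.
pose k x := C * g x `^ 2^-1.
have mk : measurable_fun setT k.
  by apply: measurable_funM; [exact: measurable_cst|exact: measurable_powRl].
have k0 x : 0 <= k x by rewrite mulr_ge0 ?powR_ge0.
have mtr : measurable_fun setT (fun w : V * V => tr (g w.1) w.1 w.2).
  by rewrite /tr /riesz; measurable_tac.
have mq1 : measurable3 (fun x y z => tr (g x) x z).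
  by rewrite /measurable3 /tr /riesz; measurable_tac.
have mq2 : measurable3 (fun x y z => tr (g x) y z).
  by rewrite /measurable3 /tr /riesz; measurable_tac.
have mh1 : measurable3 h1.
  by rewrite /measurable3 /h1 /tr /riesz; measurable_tac.
have mh2 : measurable3 h2.
  by rewrite /measurable3 /h2 /tr /riesz; measurable_tac.
have h10 x y z : 0 <= h1 x y z by apply: mulr_ge0; [apply: mulr_ge0|]; rewrite ?tr0.
have h20 x y z : 0 <= h2 x y z by apply: mulr_ge0; [apply: mulr_ge0|]; rewrite ?tr0.
have fin : (\int[mu]_x (g x * k x * k x)%:E < +oo)%E.
  have e x : g x * k x * k x = C ^+ 2 * g x ^+ 2.
    have := powR_half_mul (g0 x); rewrite /k; move: (g x `^ 2^-1) => t tt.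
    by rewrite -tt; ring.
  under eq_integral do rewrite e.
  rewrite ge0_integral_realZ ?sqr_ge0//; last 2 first.
  - exact: measurable_funX.
  - by move=> x; exact: sqr_ge0.
  by apply: lte_mul_pinfty; rewrite ?lee_fin ?sqr_ge0.
have h1oo : (integral3 h1 < +oo)%E.
  apply: le_lt_trans fin.
  apply: (@integral3_chain g k k (fun x y => tr (g x) x y)
    (fun x y z => tr (g x) x z)) => //.
  - by move=> x y; exact: tr0.
  - by move=> x y z; exact: tr0.
  - by move=> x y; exact: HC.
  - by move=> x; exact: HC.
have h2oo : (integral3 h2 < +oo)%E.
  apply: le_lt_trans fin.
  apply: (@integral3_chain g k k (fun x y => tr (g x) x y)
    (fun x y z => tr (g x) y z)) => //.
  - by move=> x y; exact: tr0.
  - by move=> x y z; exact: tr0.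
  - by move=> x y; exact: HC.
  - by move=> x; exact: HC.
have h12oo : (integral3 (fun x y z => h1 x y z + h2 x y z)%R < +oo)%E.
  have e := integral3D mh1 mh2 h10 h20.
  by rewrite e; exact: (lte_add_pinfty h1oo h2oo).
apply: (integral3_sum3_lty _ _ _ _ _ h12oo).
- exact: measurable_star.
- exact: measurable3D.
- by move=> x y z; exact: star_ge0.
- by move=> x y z; exact: addr_ge0.
move=> x y z; rewrite /star /weight oppr0 !powRr0 !mulr1.
have := addr_ge0 (h10 y x z) (h20 y x z).
have := addr_ge0 (h10 z x y) (h20 z x y).
have := addr_ge0 (h10 x y z) (h20 x y z).
have := h10 x y z; have := h20 x y z; have := h10 y x z; have := h20 y x z.
have := h10 z x y; have := h20 z x y.
have e1 : g y <= g x -> g z <= g x ->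
    g x * g y * g z * (riesz c x y * riesz c x z) = h1 x y z.
  by move=> yx zx; rewrite /h1 /tr !min_l//; ring.
have e2 : g x <= g y -> g z <= g y ->
    g x * g y * g z * (riesz c x y * riesz c x z) = h2 y x z.
  by move=> yx zx; rewrite /h2 /tr !min_l// (rieszC c y x); ring.
have e3 : g x <= g z -> g y <= g z ->
    g x * g y * g z * (riesz c x y * riesz c x z) = h2 z x y.
  by move=> yx zx; rewrite /h2 /tr !min_l// (rieszC c z x); ring.
clearbody h1 h2.
have [xy|/ltW yx] := leP (g x) (g y).
  have [zy|/ltW yz] := leP (g z) (g y); first by rewrite e2//; lra.
  by rewrite e3//; [lra|exact: le_trans yz].
have [zx|/ltW xz] := leP (g z) (g x); first by rewrite e1//; lra.
by rewrite e3//; [lra|exact: le_trans xz].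
Qed.

End square_integrable.

Section weighted_star.
Context (R : realType) (n : nat).
Local Notation mu := (lebesgue_Rn R n).
Local Notation V := (Rn R n).
Variable g : V -> R.
Hypotheses (mg : measurable_fun setT g) (g0 : forall x, 0 <= g x).
Hypothesis g2 : (\int[mu]_x (g x ^+ 2)%:E < +oo)%E.

Lemma powR_sqr (x r : R) : (x `^ r) ^+ 2 = x `^ (r * 2).
Proof. by rewrite -powR_mulrn ?powR_ge0// -powRrM. Qed.

(** By the inequality between means the star at [c] is at most [h u c v + h v c u],
    where [h u c v] carries the square of [g] at its first variable only and the
    first power at [c]. The variable [v] is then integrated by composing Riesz
    kernels, whose value cancels the factor [|c|^(b/2)]; the variable [c] by
    splitting off [g c ^+ 2] and composing Riesz kernels once more. *)
Lemma star_finite_weighted (a b : R) : 0 < a -> 0 < b -> a + b = n%:R / 2 ->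
  (integral3 (star g a (3 / 2 * b)) < +oo)%E.
Proof.
move=> a0 b0 ab; have nE : n%:R = 2 * a + 2 * b by lra.
(* The exponent for which |z|^-s and |x - z|^(-2b) compose to |x|^(-b/2). *)
pose s := 2 * a + b / 2.
have [C C0 HC] : exists2 C : R, 0 <= C & forall x : V, 0 < edist origin x ->
    (\int[mu]_z (weight s z * riesz (2 * b) x z)%:E <= (C * weight (b / 2) x)%:E)%E.
  have [C C0 HC] := @integral_riesz_le R n s (2 * b)
    (ltac:(rewrite /s nE; apply/andP; split; lra))
    (ltac:(rewrite nE; apply/andP; split; lra)) (ltac:(rewrite /s nE; lra)).
  exists C => // x ox; apply: le_trans (HC origin x ox) _.
  by rewrite /weight lee_fin /s nE (_ : _ - _ - _ = - (b / 2))//; lra.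
have [D D0 HD] : exists2 D : R, 0 <= D & forall y : V, 0 < edist origin y ->
    (\int[mu]_x (weight (2 * a + b) x * riesz (2 * b) y x)%:E <= (D * weight b y)%:E)%E.
  have [D D0 HD] := @integral_riesz_le R n (2 * a + b) (2 * b)
    (ltac:(rewrite nE; apply/andP; split; lra))
    (ltac:(rewrite nE; apply/andP; split; lra)) (ltac:(rewrite nE; lra)).
  exists D => // y oy; apply: le_trans (HD origin y oy) _.
  by rewrite /weight lee_fin nE (_ : _ - _ - _ = - b)//; lra.
have sE : s = 2 * a + b / 2 by [].
pose G := fine (\int[mu]_x (g x ^+ 2)%:E).
have GE : (\int[mu]_x (g x ^+ 2)%:E)%E = G%:E.
  rewrite fineK// ge0_fin_numE//; apply: integral_ge0 => x _.
  by rewrite lee_fin sqr_ge0.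
have G0 : 0 <= G.
  by rewrite -lee_fin -GE; apply: integral_ge0 => x _; rewrite lee_fin sqr_ge0.
clearbody s G.
pose p (r c : V) := g c * (weight (a + b / 2) c * (edist origin r `^ (b / 2) * riesz b r c)).
pose q (c v : V) := edist origin c `^ (b / 2) * (weight s v * riesz (2 * b) c v).
pose h r c v := (g r ^+ 2 * p r c) * q c v.
have p0 x y : 0 <= p x y by rewrite /p; do !apply: mulr_ge0; rewrite ?powR_ge0 ?g0.
have q0 x y : 0 <= q x y by rewrite /q; do !apply: mulr_ge0; rewrite ?powR_ge0.
have mp : measurable_fun setT (fun w : V * V => p w.1 w.2).
  by rewrite /p /weight /riesz; measurable_tac.
have mq : measurable3 (fun x y z => q y z).
  by rewrite /measurable3 /q /weight /riesz; measurable_tac.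
have mh : measurable3 h.
  by rewrite /measurable3 /h /p /q /weight /riesz; measurable_tac.
have h0 x y z : 0 <= h x y z by apply: mulr_ge0 => //; rewrite mulr_ge0 ?sqr_ge0.
have mg2 : measurable_fun setT (fun y => g y ^+ 2) by exact: measurable_funX.
have qC x : (\int[mu]_z (q x z)%:E <= C%:E)%E.
  rewrite /q ge0_integral_realZ ?powR_ge0//; last 2 first.
  - apply: measurable_funM; [exact: measurable_weight|exact: measurable_rieszr].
  - by move=> z; rewrite mulr_ge0 ?powR_ge0.
  have [ox|/eqP ox] := eqVneq (edist origin x) 0.
    by rewrite ox powR0 ?mul0e ?lee_fin// gt_eqF// divr_gt0.
  have ox0 : 0 < edist origin x by rewrite lt_neqAle edist_ge0 andbT eq_sym; exact/eqP.
  apply: (@le_trans _ _ ((edist origin x `^ (b / 2))%:E * (C * weight (b / 2) x)%:E)%E).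
    by rewrite lee_wpmul2l ?lee_fin ?powR_ge0//; exact: HC.
  rewrite -EFinM lee_fin /weight powRN mulrCA mulfV ?mulr1//.
  by rewrite gt_eqF// powR_gt0.
have pGD x : (\int[mu]_y (p x y)%:E <= (G + D)%:E)%E.
  pose e (y : V) := edist origin x `^ b * (weight (2 * a + b) y * riesz (2 * b) x y).
  have me : measurable_fun setT (fun y : V => weight (2 * a + b) y * riesz (2 * b) x y).
    apply: measurable_funM; [exact: measurable_weight|exact: measurable_rieszr].
  have e0 (y : V) : 0 <= weight (2 * a + b) y * riesz (2 * b) x y.
    by rewrite mulr_ge0 ?powR_ge0.
  apply: (@le_trans _ _ (\int[mu]_y (g y ^+ 2 + e y)%:E)%E).
    apply: ge0_le_integral_real => //.
    - apply: (measurableT_comp mp (g := fun y => (x, y))).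
      by apply: measurable_fun_pair => //; exact: measurable_cst.
    - by apply: measurable_funD => //; apply: measurable_funM => //; exact: measurable_cst.
    - move=> y; apply: le_trans (mul_le_sqrD _ _) _.
      rewrite lerD2l /e /weight /riesz !exprMn !powR_sqr mulrCA.
      by rewrite (_ : b / 2 * 2 = b) ?divfK// (_ : - (a + _) * 2 = - (2 * a + b));
        [rewrite mulNr (mulrC b)|field].
  rewrite ge0_integral_realD//; last 3 first.
  - by apply: measurable_funM => //; exact: measurable_cst.
  - by move=> y; exact: sqr_ge0.
  - by move=> y; rewrite mulr_ge0 ?powR_ge0.
  rewrite GE EFinD leeD2l// /e ge0_integral_realZ ?powR_ge0//.
  have [ox|/eqP ox] := eqVneq (edist origin x) 0.
    by rewrite ox powR0 ?mul0e ?lee_fin// gt_eqF.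
  have ox0 : 0 < edist origin x by rewrite lt_neqAle edist_ge0 andbT eq_sym; exact/eqP.
  apply: (@le_trans _ _ ((edist origin x `^ b)%:E * (D * weight b x)%:E)%E).
    by rewrite lee_wpmul2l ?lee_fin ?powR_ge0//; exact: HD.
  rewrite -EFinM lee_fin /weight powRN mulrCA mulfV ?mulr1//.
  by rewrite gt_eqF// powR_gt0.
have hoo : (integral3 h < +oo)%E.
  apply: (@le_lt_trans _ _ (\int[mu]_x (g x ^+ 2 * C * (G + D))%:E)%E).
    apply: (@integral3_chain R n (fun x => g x ^+ 2) (fun=> C) (fun=> G + D) p
      (fun x y z => q y z)) => //.
    - by move=> x; exact: sqr_ge0.
    - by move=> x; exact: addr_ge0.
  rewrite (eq_integral (fun x => (C * (G + D) * g x ^+ 2)%:E)); last first.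
    by move=> x _; congr EFin; ring.
  rewrite ge0_integral_realZ//; last 2 first.
  - by rewrite mulr_ge0// addr_ge0.
  - by move=> x; exact: sqr_ge0.
  by apply: lte_mul_pinfty; rewrite ?lee_fin ?GE ?ltry ?mulr_ge0 ?addr_ge0.
apply: (integral3_sum3_lty _ mh _ h0 _ hoo).
- exact: measurable_star.
- by move=> x y z; exact: star_ge0.
move=> c u v; rewrite -addrA; apply: ler_wpDl; first exact: h0.
have na : - a != 0 by rewrite oppr_eq0 gt_eqF.
have nb : - (3 / 2 * b) != 0 by rewrite oppr_eq0 gt_eqF// mulr_gt0.
have huv := addr_ge0 (h0 u c v) (h0 v c u).
have pos (x y : V) : edist x y <> 0 -> 0 < edist x y.
  by move=> xy; rewrite lt_neqAle edist_ge0 andbT eq_sym; exact/eqP.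
have [oc|/eqP /pos oc] := eqVneq (edist origin c) 0.
  by rewrite {1}/star {1}/weight oc powR0// !mul0r mulr0 mul0r.
have [ou|/eqP /pos ou] := eqVneq (edist origin u) 0.
  by rewrite /star {2}/weight ou powR0// mulr0 !mul0r mulr0 mul0r.
have [ov|/eqP /pos ov] := eqVneq (edist origin v) 0.
  by rewrite /star {3}/weight ov powR0// !mulr0 mul0r.
have [cu|/eqP /pos cu] := eqVneq (edist c u) 0.
  by rewrite /star {1}/riesz cu powR0// mul0r mulr0.
have [cv|/eqP /pos cv] := eqVneq (edist c v) 0.
  by rewrite /star {2}/riesz cv powR0// !mulr0.
apply: le_add_of_sqr => //.
have D' (x y r : R) : 0 < r -> r `^ x * r `^ y = r `^ (x + y).
  by move=> r0; rewrite powRD// (gt_eqF r0) implybT.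
have E1 : weight (a + b / 2) c * edist origin c `^ (b / 2) = weight a c.
  by rewrite /weight D'//; congr powR; ring.
have E2 (x : V) : 0 < edist origin x -> edist origin x `^ (b / 2) * weight s x = weight a x ^+ 2.
  by move=> ox; rewrite /weight D'// powR_sqr; congr powR; rewrite sE; ring.
have E3 (x : V) : 0 < edist c x -> riesz b x c * riesz (2 * b) c x = riesz (3 / 2 * b) c x ^+ 2.
  by move=> cx; rewrite rieszC /riesz D'// powR_sqr; congr powR; field.
rewrite /h /p /q /star.
have := E2 u ou; have := E2 v ov; have := E3 u cu; have := E3 v cv; move: E1.
move: (weight _ c) (weight _ c) (edist origin c `^ _) (weight a u) (weight a v)
  (riesz _ c u) (riesz _ c v) => w1 w2 w3 wu wv ku kv.
move: (edist origin u `^ _) (edist origin v `^ _) (weight s u) (weight s v)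
  (riesz b u c) (riesz b v c) (riesz _ c u) (riesz _ c v) =>
  x1 x2 x3 x4 x5 x6 r1 r2 e1 e2 e3 e4 e5.
transitivity (g c ^+ 2 * g u ^+ 2 * g v ^+ 2 * (w2 * w3) ^+ 2 * (x1 * x3) *
  (x2 * x4) * (x5 * ku) * (x6 * kv)); last by ring.
by rewrite e1 e2 e3 e4 e5; ring.
Qed.

End weighted_star.

Section trilinear_finiteness.
Context (R : realType) (n : nat).
Local Notation mu := (lebesgue_Rn R n).
Local Notation V := (Rn R n).

Definition triform (f1 f2 f3 : V -> R) (a l : R) (x y z : V) : R :=
  f1 x * f2 y * f3 z * (sw_weight a x * sw_weight a y * sw_weight a z)
  * sw_kernel l x y z.

Lemma sw_weightE (a : R) (x : V) : sw_weight a x = weight a x.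
Proof. by rewrite /sw_weight /weight enormE. Qed.

Lemma sw_kernelE (l : R) (x y z : V) :
  sw_kernel l x y z = riesz l x y * riesz l x z * riesz l y z.
Proof. by []. Qed.

Lemma triform_ge0 f1 f2 f3 a l x y z : (forall x, 0 <= f1 x) ->
  (forall x, 0 <= f2 x) -> (forall x, 0 <= f3 x) -> 0 <= triform f1 f2 f3 a l x y z.
Proof.
move=> h1 h2 h3; rewrite /triform /sw_kernel /sw_weight.
by do !apply: mulr_ge0; rewrite ?powR_ge0 ?h1 ?h2 ?h3.
Qed.

Lemma measurable_triform f1 f2 f3 a l : measurable_fun setT f1 ->
  measurable_fun setT f2 -> measurable_fun setT f3 ->
  measurable3 (triform f1 f2 f3 a l).
Proof.
move=> m1 m2 m3; rewrite /measurable3 /triform.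
under eq_fun do rewrite sw_kernelE !sw_weightE.
have c1 h := fun mh : measurable_fun setT h =>
  measurableT_comp mh (@measurable_tri1 R n).
have c2 h := fun mh : measurable_fun setT h =>
  measurableT_comp mh (@measurable_tri2 R n).
have c3 h := fun mh : measurable_fun setT h =>
  measurableT_comp mh (@measurable_tri3 R n).
have ck (u v : V * V * V -> V) : measurable_fun setT u -> measurable_fun setT v ->
    measurable_fun setT (fun w => riesz l (u w) (v w)).
  by move=> mu' mv; apply: measurable_powRl; exact: measurable_edist.
have mw := @measurable_weight R n a.
apply: measurable_funM; first apply: measurable_funM.
- exact: measurable_funM (measurable_funM (c1 _ _ _ m1) (c2 _ _ _ m2)) (c3 _ _ _ m3).
- exact: measurable_funM (measurable_funM (c1 _ _ _ mw) (c2 _ _ _ mw)) (c3 _ _ _ mw).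
have t1 := @measurable_tri1 R n; have t2 := @measurable_tri2 R n.
have t3 := @measurable_tri3 R n.
exact: measurable_funM (measurable_funM (ck _ _ t1 t2) (ck _ _ t1 t3)) (ck _ _ t2 t3).
Qed.

(** The smallest of the three kernels is discarded, leaving a star. *)
Lemma triform_finite_square (g : V -> R) (a b : R) : (0 < n)%N ->
  measurable_fun setT g -> (forall x, 0 <= g x) ->
  (\int[mu]_x (g x ^+ 2)%:E < +oo)%E ->
  0 <= a -> 0 < b -> a + b = n%:R / 2 ->
  (integral3 (triform g g g a b) < +oo)%E.
Proof.
move=> n0 mg g0 g2 a0 b0 ab.
have soo : (integral3 (star g a (3 / 2 * b)) < +oo)%E.
  move: a0; rewrite le_eqVlt => /predU1P[a0|a0]; last exact: star_finite_weighted.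
  have -> : 3 / 2 * b = 3 / 4 * n%:R by lra.
  by rewrite -a0; exact: star_finite_unweighted.
apply: (integral3_sum3_lty _ _ _ _ _ soo).
- exact: measurable_triform.
- exact: measurable_star.
- by move=> x y z; exact: triform_ge0.
- by move=> x y z; exact: star_ge0.
move=> x y z; rewrite /triform sw_kernelE !sw_weightE /star.
have kE u v : riesz (3 / 2 * b) u v = riesz b u v `^ (3 / 2) :> R.
  by rewrite /riesz -powRrM; congr powR; ring.
rewrite !kE (rieszC b y x) (rieszC b z x) (rieszC b z y).
have W0 : 0 <= g x * g y * g z * (weight a x * weight a y * weight a z).
  by do !apply: mulr_ge0; rewrite ?powR_ge0 ?g0.
have := mul3_le_stars (riesz_ge0 b x y) (riesz_ge0 b x z) (riesz_ge0 b y z).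
move: W0; move: (riesz b x y) (riesz b x z) (riesz b y z) => u v w.
move: (u `^ _) (v `^ _) (w `^ _) => u' v' w'.
move: (g x) (g y) (g z) (weight a x) (weight a y) (weight a z) => gx gy gz wx wy wz.
move=> W0 /(ler_wpM2l W0) /le_trans; apply; rewrite le_eqVlt; apply/orP; left.
by apply/eqP; ring.
Qed.

(** Both factors are bounded by powers of a common majorant of [X] and [Y]. *)
Lemma geometric_mean_le (X Y t : R) : 0 <= X -> 0 <= Y -> 0 <= t <= 1 ->
  X `^ t * Y `^ (1 - t) <= X + Y.
Proof.
move=> X0 Y0 /andP[t0 t1].
have main (M x y : R) : 0 <= x -> 0 <= y -> 0 < M -> x <= M -> y <= M ->
    x `^ t * y `^ (1 - t) <= M.
  move=> x0 y0 M0 xM yM; apply: (@le_trans _ _ (M `^ t * M `^ (1 - t))).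
    by apply: ler_pM; rewrite ?powR_ge0//; apply: ge0_ler_powR;
      rewrite ?nnegrE ?subr_ge0 ?(ltW M0).
  rewrite -powRD ?(gt_eqF M0) ?implybT// addrCA subrr addr0 powRr1//.
  exact: ltW.
have [XY|XY] := eqVneq (X + Y) 0.
  have [-> ->] : X = 0 /\ Y = 0 by split; lra.
  rewrite addr0; have [->|t00] := eqVneq t 0.
    by rewrite subr0 powRr1// mulr0.
  by rewrite powR0// mul0r.
apply: main => //; last 2 first.
- by rewrite lerDl.
- by rewrite lerDr.
by rewrite lt_neqAle eq_sym XY addr_ge0.
Qed.

End trilinear_finiteness.

(** * Young's inequality *)

Section young.
Context (R : realType).

(** The strict form of Young's inequality comes from the strict tangent
    inequality of the exponential at the weighted mean of the logarithms of [a^p]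
    and [b^p]. *)
Lemma strict_young (p a b : R) : 1 < p -> 0 <= a -> 0 <= b -> a <> b ->
  a * b `^ (p - 1) < a `^ p / p + (1 - p^-1) * b `^ p.
Proof.
move=> p1 a0 b0 ab; have p0 : 0 < p by lra.
have pi0 : 0 < p^-1 by rewrite invr_gt0.
have q0 : 0 < 1 - p^-1 by rewrite subr_gt0 invf_lt1.
move: b0; rewrite le_eqVlt => /predU1P[b0|b0].
  rewrite -b0 !powR0 ?mulr0 ?addr0; try by lra.
  by rewrite divr_gt0// powR_gt0// lt_neqAle a0 andbT; apply/eqP; rewrite b0; exact/nesym.
move: a0; rewrite le_eqVlt => /predU1P[a0|a0].
  by rewrite -a0 powR0 ?mul0r ?add0r; [rewrite mulr_gt0 ?powR_gt0|lra].
have A r : a `^ r = expR (r * ln a) by rewrite /powR gt_eqF.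
have B r : b `^ r = expR (r * ln b) by rewrite /powR gt_eqF.
have -> : a * b `^ (p - 1) = expR (ln a + (p - 1) * ln b).
  by rewrite expRD lnK ?posrE// B.
have lab : ln a <> ln b by move=> /ln_inj h; apply: ab; rewrite h// posrE.
set y := ln a + _.
have Ya : expR y * (1 + (p * ln a - y)) < a `^ p.
  have -> : a `^ p = expR y * expR (p * ln a - y).
    by rewrite A -expRD; congr expR; ring.
  rewrite ltr_pM2l ?expR_gt0//; apply: expR_gt1Dx.
  apply/eqP => h; have : (p - 1) * (ln a - ln b) = 0 by rewrite -h /y; ring.
  by move/eqP; rewrite mulf_eq0 !subr_eq0 => /orP[] /eqP // h'; lra.
have Yb : expR y * (1 + (p * ln b - y)) <= b `^ p.
  have -> : b `^ p = expR y * expR (p * ln b - y).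
    by rewrite B -expRD; congr expR; ring.
  by rewrite ler_pM2l ?expR_gt0//; exact: expR_ge1Dx.
have -> : expR y = expR y * (1 + (p * ln a - y)) / p
    + (1 - p^-1) * (expR y * (1 + (p * ln b - y))).
  have -> : ln a = y - (p - 1) * ln b by rewrite /y addrK.
  by clearbody y; field; rewrite gt_eqF.
by apply: ltr_leD; [rewrite ltr_pM2r|rewrite ler_pM2l].
Qed.

Lemma young_root (p H : R) : 1 < p -> 0 <= H -> H `^ p^-1 <= H / p + (1 - p^-1).
Proof.
move=> p1 H0; have p0 : p != 0 by rewrite gt_eqF//; lra.
have HE : (H `^ p^-1) `^ p = H by rewrite -powRrM mulVf// powRr1.
have [h|/eqP h] := eqVneq (H `^ p^-1) 1.
  by rewrite -[in leRHS]HE h powR1 -subr_ge0 le_eqVlt; apply/orP; left;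
    apply/eqP; field.
have := strict_young p1 (powR_ge0 H p^-1) ler01 h.
by rewrite HE !powR1 !mulr1 => /ltW.
Qed.

End young.

(** * Finiteness of the form for general exponents *)

Section unit_functions.
Context (R : realType) (n : nat).
Local Notation mu := (lebesgue_Rn R n).
Local Notation V := (Rn R n).
Implicit Types f g h : V -> R.

Definition unit_function (p : R) f := [/\ measurable_fun setT f,
  (forall x, 0 <= f x) & (\int[mu]_x (f x `^ p)%:E = 1)%E].

Lemma unit_function_support (p : R) f (P : V -> Prop) : 0 < p -> unit_function p f ->
  {ae mu, forall x, P x} -> exists x, P x /\ 0 < f x.
Proof.
move=> p0 [mf f0 f1] aeP; apply: contrapT => nP.
have f00 : {ae mu, forall x, f x = 0}.
  apply: filterS aeP => x Px; apply/eqP; rewrite -[_ == _]negbK; apply/negP => fx.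
  by apply: nP; exists x; split => //; rewrite lt_neqAle eq_sym fx f0.
have e : (\int[mu]_x (f x `^ p)%:E = \int[mu]_(x in setT) cst 0 x)%E.
  apply: ae_eq_integral => //.
  - by apply/measurable_EFinP; exact: measurable_powRl.
  - by apply: filterS f00 => x /= -> _; rewrite powR0// gt_eqF.
by move: f1; rewrite e integral0 => /esym/eqP; rewrite onee_eq0.
Qed.

Lemma integral3_prod f g h (a b c : R) :
  measurable_fun setT f -> measurable_fun setT g -> measurable_fun setT h ->
  (forall x, 0 <= f x) -> (forall x, 0 <= g x) -> (forall x, 0 <= h x) ->
  (\int[mu]_x (f x)%:E = a%:E)%E -> (\int[mu]_x (g x)%:E = b%:E)%E ->
  (\int[mu]_x (h x)%:E = c%:E)%E ->
  integral3 (fun x y z => f x * g y * h z) = (a * b * c)%:E.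
Proof.
move=> mf mg mh f0 g0 h0 fa gb hc; rewrite /integral3.
have c0 : 0 <= c by rewrite -lee_fin -hc; apply: integral_ge0 => x _; rewrite lee_fin.
have b0 : 0 <= b by rewrite -lee_fin -gb; apply: integral_ge0 => x _; rewrite lee_fin.
transitivity (\int[mu]_x ((b * c) * f x)%:E)%E.
  apply: eq_integral => x _.
  transitivity (\int[mu]_y ((f x * c) * g y)%:E)%E.
    apply: eq_integral => y _.
    by rewrite ge0_integral_realZ ?mulr_ge0// hc -EFinM mulrAC.
  by rewrite ge0_integral_realZ ?mulr_ge0// gb -EFinM; congr EFin; ring.
by rewrite ge0_integral_realZ ?mulr_ge0// fa -EFinM; congr EFin; ring.
Qed.

End unit_functions.

Section general_exponent.
Context (R : realType) (n : nat).
Local Notation mu := (lebesgue_Rn R n).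
Local Notation V := (Rn R n).
Variables p alpha lambda : R.
Hypotheses (n0 : (0 < n)%N) (p1 : 1 < p) (p2 : 1 <= 2 / p).
Hypotheses (alpha0 : 0 <= alpha) (lambda0 : 0 < lambda).
Hypothesis scaling : 1 / p + (alpha + lambda) / n%:R = 1.

(** Writing [f] as [(f^p)^(2/p-1) * (f^(p/2))^(2-2/p)] exhibits the integrand as a
    geometric mean of the product of the three copies of [f^p] and of an integrand
    built on the square-integrable function [f^(p/2)]. The weights and kernels of
    the latter have their exponents multiplied by [p/(2(p-1))], and the scaling
    condition turns their sum into [n/2]. *)
Lemma triform_finite_diag (f : V -> R) : measurable_fun setT f -> (forall x, 0 <= f x) ->
  (\int[mu]_x (f x `^ p)%:E < +oo)%E ->
  (integral3 (triform f f f alpha lambda) < +oo)%E.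
Proof.
move=> mf f0 fp; have p0 : 0 < p by exact: lt_trans ltr01 p1.
have pn0 : p != 0 by rewrite gt_eqF.
have q0 : 0 < p - 1 by rewrite subr_gt0.
have qn0 : p - 1 != 0 by rewrite gt_eqF.
have nR : n%:R != 0 :> R by rewrite pnatr_eq0 -lt0n.
pose a := alpha * (p / (p - 1) / 2); pose b := lambda * (p / (p - 1) / 2).
pose t := 2 / p - 1.
have t01 : 0 <= t <= 1.
  by rewrite /t subr_ge0 p2 lerBlDr ler_pdivrMr//; lra.
have r0 : 0 < p / (p - 1) / 2 by rewrite !divr_gt0.
have r1 : p / (p - 1) / 2 * (1 - t) = 1.
  by rewrite /t; field; rewrite ?pn0 ?qn0.
have ab : a + b = n%:R / 2.
  have : alpha + lambda = n%:R * (1 - 1 / p).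
    by rewrite -[X in X - 1 / p]scaling; field; rewrite ?pn0 ?qn0 ?nR.
  by rewrite /a /b -mulrDl => ->; field; rewrite ?pn0 ?qn0 ?nR.
pose A x := f x `^ p; pose g x := f x `^ (p / 2).
have mA : measurable_fun setT A by exact: measurable_powRl.
have mg : measurable_fun setT g by exact: measurable_powRl.
have A0 x : 0 <= A x by exact: powR_ge0.
have g0 x : 0 <= g x by exact: powR_ge0.
have g2 x : g x ^+ 2 = A x by rewrite /g powR_sqr divfK.
have goo : (\int[mu]_x (g x ^+ 2)%:E < +oo)%E.
  by under eq_integral do rewrite g2.
have Ag x : A x `^ t * g x `^ (1 - t) = f x.
  have [fx|/eqP fx] := eqVneq (f x) 0.
    have t1 : 1 - t != 0.
      apply/eqP => h; have : p / (p - 1) / 2 * (1 - t) = 1 by [].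
      by rewrite h mulr0 => /esym/eqP; rewrite oner_eq0.
    rewrite /A /g fx [in X in _ * X]powR0; last by rewrite gt_eqF// divr_gt0.
    by rewrite (powR0 t1) mulr0.
  rewrite -!powRrM -powRD; last by rewrite (introF eqP fx) implybT.
  have -> : p * t + p / 2 * (1 - t) = 1 by rewrite /t; field.
  exact: powRr1.
have a0 : 0 <= a by rewrite mulr_ge0// ltW.
have b0 : 0 < b by rewrite mulr_gt0.
have Yoo := triform_finite_square n0 mg g0 goo a0 b0 ab.
pose X x y z := A x * A y * A z.
have Aint : (\int[mu]_x (A x)%:E = (fine (\int[mu]_x (A x)%:E))%:E)%E.
  by rewrite fineK// ge0_fin_numE//; apply: integral_ge0 => x _; rewrite lee_fin.
have Xoo : (integral3 X < +oo)%E.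
  by rewrite (integral3_prod mA mA mA A0 A0 A0 Aint Aint Aint) ltry.
have mX : measurable3 X.
  exact: measurable_funM (measurable_funM (measurableT_comp mA (@measurable_tri1 R n))
    (measurableT_comp mA (@measurable_tri2 R n)))
    (measurableT_comp mA (@measurable_tri3 R n)).
have X0 x y z : 0 <= X x y z by rewrite !mulr_ge0.
have mY : measurable3 (triform g g g a b) by exact: measurable_triform.
have Y0 x y z : 0 <= triform g g g a b x y z by exact: triform_ge0.
have XYoo : (integral3 (fun x y z => X x y z + triform g g g a b x y z)%R < +oo)%E.
  have e := integral3D mX mY X0 Y0.
  rewrite e; exact: (lte_add_pinfty Xoo Yoo).
apply: le_lt_trans XYoo; apply: le_integral3.
- exact: measurable_triform.
- exact: measurable3D.
- by move=> x y z; exact: triform_ge0.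
move=> x y z; apply: le_trans (geometric_mean_le (X0 x y z) (Y0 x y z) t01).
have wE (u : V) : weight alpha u = weight a u `^ (1 - t).
  by rewrite /weight -powRrM mulNr /a -(mulrA alpha) r1 mulr1.
have kE (u v : V) : riesz lambda u v = riesz b u v `^ (1 - t).
  by rewrite /riesz -powRrM mulNr /b -(mulrA lambda) r1 mulr1.
rewrite le_eqVlt; apply/orP; left; apply/eqP.
rewrite /X /triform !sw_kernelE !sw_weightE -(Ag x) -(Ag y) -(Ag z) !wE !kE.
move: (A0 x) (A0 y) (A0 z) (g0 x) (g0 y) (g0 z).
move: (weight_ge0 a x) (weight_ge0 a y) (weight_ge0 a z).
move: (riesz_ge0 b x y) (riesz_ge0 b x z) (riesz_ge0 b y z).
move: (riesz b x y) (riesz b x z) (riesz b y z) => k1 k2 k3 k10 k20 k30.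
move: (weight a x) (weight a y) (weight a z) => w1 w2 w3 w10 w20 w30.
move: (A x) (A y) (A z) (g x) (g y) (g z) => A1 A2 A3 g1 g2' g3 *.
rewrite !powRM ?mulr_ge0//.
move: (A1 `^ _) (A2 `^ _) (A3 `^ _) (g1 `^ _) (g2' `^ _) (g3 `^ _) => *.
move: (w1 `^ _) (w2 `^ _) (w3 `^ _) (k1 `^ _) (k2 `^ _) (k3 `^ _) => *.
by ring.
Qed.

Lemma triform_finite (f1 f2 f3 : V -> R) :
  unit_function p f1 -> unit_function p f2 -> unit_function p f3 ->
  (integral3 (triform f1 f2 f3 alpha lambda) < +oo)%E.
Proof.
move=> [m1 p1' i1] [m2 p2' i2] [m3 p3' i3]; have p0 : 0 < p by exact: lt_trans ltr01 p1.
pose F x := Num.max (f1 x) (Num.max (f2 x) (f3 x)).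
have mF : measurable_fun setT F by apply: measurable_maxr => //; exact: measurable_maxr.
have F0 x : 0 <= F x by rewrite le_max p1'.
have mP f : measurable_fun setT f -> measurable_fun setT (fun x : V => f x `^ p).
  by move=> mf; exact: measurable_powRl.
have P0 (f : V -> R) x : 0 <= f x `^ p by exact: powR_ge0.
have FP x : F x `^ p <= f1 x `^ p + (f2 x `^ p + f3 x `^ p).
  have a1 := P0 f1 x; have a2 := P0 f2 x; have a3 := P0 f3 x; rewrite /F.
  have [_|_] := leP (f1 x) (Num.max (f2 x) (f3 x)); last by rewrite lerDl addr_ge0.
  have [_|_] := leP (f2 x) (f3 x); first by rewrite addrA lerDr addr_ge0.
  by rewrite addrCA lerDl addr_ge0.
have m23 := measurable_funD (mP _ m2) (mP _ m3).
have p23 x : 0 <= f2 x `^ p + f3 x `^ p by exact: addr_ge0.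
have Foo : (\int[mu]_x (F x `^ p)%:E < +oo)%E.
  have h := ge0_le_integral_real mu (mP _ mF) (measurable_funD (mP _ m1) m23) (P0 F) FP.
  apply: (le_lt_trans h).
  rewrite (ge0_integral_realD mu (mP _ m1) m23 (P0 f1) p23).
  rewrite (ge0_integral_realD mu (mP _ m2) (mP _ m3) (P0 f2) (P0 f3)).
  by rewrite i1 i2 i3 -!EFinD ltry.
apply: le_lt_trans (triform_finite_diag mF F0 Foo); apply: le_integral3.
- exact: measurable_triform.
- exact: measurable_triform.
- by move=> x y z; exact: triform_ge0.
move=> x y z; rewrite /triform.
have F1 u : f1 u <= F u by rewrite le_max lexx.
have F2 u : f2 u <= F u by rewrite !le_max lexx orbT.
have F3 u : f3 u <= F u by rewrite !le_max lexx !orbT.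
rewrite sw_kernelE !sw_weightE.
apply: ler_wpM2r; first by rewrite !mulr_ge0 ?riesz_ge0.
apply: ler_wpM2r; first by rewrite !mulr_ge0 ?weight_ge0.
by rewrite !ler_pM ?mulr_ge0.
Qed.

End general_exponent.

(** * Polarisation of the trilinear form *)

Section polarization.
Local Open Scope ereal_scope.
Context d (T : measurableType d) (R : realType).
Variable m : {measure set T -> \bar R}.

(** The two diagonal terms are each at most the maximum [C], which the mixed term
    attains; so the integrated inequality between means is reversed. *)
Lemma ae_polarization (s11 s12 s22 : T -> \bar R) (C : R) :
  measurable_fun setT s11 -> measurable_fun setT s12 -> measurable_fun setT s22 ->
  (forall z, 0 <= s11 z) -> (forall z, 0 <= s12 z) -> (forall z, 0 <= s22 z) ->
  (forall z, s12 z + s12 z <= s11 z + s22 z) ->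
  \int[m]_z s12 z = C%:E -> \int[m]_z s11 z <= C%:E -> \int[m]_z s22 z <= C%:E ->
  {ae m, forall z, s11 z + s22 z = s12 z + s12 z} /\ {ae m, forall z, s12 z < +oo}.
Proof.
move=> m11 m12 m22 p11 p12 p22 amgm i12 i11 i22; split.
  apply: ae_eq_of_integral_le => //.
  - exact: emeasurable_funD.
  - exact: emeasurable_funD.
  - by move=> z; exact: adde_ge0.
  - by rewrite !ge0_integralD// i12; exact: leeD.
  - by rewrite !ge0_integralD// i12 -EFinD ltry.
have : m.-integrable setT s12.
  apply/integrableP; split => //; under eq_integral do rewrite gee0_abs//.
  by rewrite i12 ltry.
move/integrable_ae => /(_ measurableT); apply: filterS => z /(_ I).
by rewrite ge0_fin_numE.
Qed.

Lemma pos_cancel (c : R) (e11 e12 e22 : \bar R) : (0 < c)%R ->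
  c%:E * (e11 + e22) = c%:E * (e12 + e12) -> c%:E * e12 < +oo ->
  e11 + e22 = e12 + e12 /\ e12 < +oo.
Proof.
move=> c0 h1 h2; split.
  have iff x y := @lee_pmul2l R c%:E isT c0 x y.
  by apply/eqP; rewrite eq_le -(iff (e11 + e22)) -(iff (e12 + e12)) h1 lexx.
by rewrite ltey; apply/eqP => e; move: h2; rewrite e gt0_muley ?lte_fin// ltxx.
Qed.

End polarization.

Section trilinear_form.
Context (R : realType) (n : nat).
Local Notation mu := (lebesgue_Rn R n).
Local Notation V := (Rn R n).
Variables alpha lambda : R.
Implicit Types f g h : V -> R.

Definition trilinear f g h : \bar R := integral3 (triform f g h alpha lambda).

Lemma triform_swap12 f g h x y z :
  triform g f h alpha lambda x y z = triform f g h alpha lambda y x z.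
Proof.
rewrite /triform !sw_kernelE !sw_weightE (rieszC lambda y x).
move: (riesz lambda x y) (riesz lambda x z) (riesz lambda y z) => k1 k2 k3.
move: (f y) (g x) (h z) (weight alpha x) (weight alpha y) (weight alpha z) => *.
by ring.
Qed.

Lemma triform_swap23 f g h x y z :
  triform f h g alpha lambda x y z = triform f g h alpha lambda x z y.
Proof.
rewrite /triform !sw_kernelE !sw_weightE (rieszC lambda z y).
move: (riesz lambda x y) (riesz lambda x z) (riesz lambda y z) => k1 k2 k3.
move: (f x) (g z) (h y) (weight alpha x) (weight alpha y) (weight alpha z) => *.
by ring.
Qed.

Section symmetry.
Variables f g h : V -> R.
Hypotheses (mf : measurable_fun setT f) (mg : measurable_fun setT g).
Hypotheses (mh : measurable_fun setT h) (f0 : forall x, 0 <= f x).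
Hypotheses (g0 : forall x, 0 <= g x) (h0 : forall x, 0 <= h x).

Let mt : measurable3 (triform f g h alpha lambda) := measurable_triform _ _ mf mg mh.
Let t0 x y z : 0 <= triform f g h alpha lambda x y z := triform_ge0 _ _ _ _ _ f0 g0 h0.

Lemma trilinear_swap12 : trilinear g f h = trilinear f g h.
Proof.
rewrite /trilinear -(integral3_swap12 mt t0); congr integral3.
by apply/funext => x; apply/funext => y; apply/funext => z; exact: triform_swap12.
Qed.

Lemma trilinear_swap23 : trilinear f h g = trilinear f g h.
Proof.
rewrite /trilinear -(integral3_swap23 mt t0); congr integral3.
by apply/funext => x; apply/funext => y; apply/funext => z; exact: triform_swap23.
Qed.

Definition slice (z : V) : \bar R :=
  (\int[mu]_x \int[mu]_y (triform f g h alpha lambda x y z)%:E)%E.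

Lemma slice_ge0 z : (0 <= slice z)%E.
Proof.
by apply: integral_ge0 => x _; apply: integral_ge0 => y _; rewrite lee_fin t0.
Qed.

Let mt' : measurable3 (fun z x y => triform f g h alpha lambda x y z).
Proof.
by apply: (measurable3_comp mt);
  [exact: measurable_tri2|exact: measurable_tri3|exact: measurable_tri1].
Qed.

Lemma measurable_slice : measurable_fun setT slice.
Proof.
have mi := measurable3_inner mt' (fun z x y => t0 x y z).
apply: (measurable_fun_fubini_tonelli_F (m2 := mu) (fun w : V * V =>
  (\int[mu]_y (triform f g h alpha lambda w.2 y w.1)%:E)%E) mi).
by move=> w; apply: integral_ge0 => y _; rewrite lee_fin t0.
Qed.

Lemma trilinear_slice : trilinear f g h = (\int[mu]_z slice z)%E.
Proof.
rewrite /trilinear -(integral3_swap23 mt t0).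
have ms : measurable3 (fun x y z => triform f g h alpha lambda x z y).
  by apply: (measurable3_comp mt);
    [exact: measurable_tri1|exact: measurable_tri3|exact: measurable_tri2].
by rewrite -(integral3_swap12 ms (fun x y z => t0 x z y)).
Qed.

(** What the weights and the fixed third point [z] leave of a factor of the form:
    the remaining kernel couples two such functions into an energy. *)
Definition interaction (z : V) (u : V -> R) (x : V) : R :=
  u x * weight alpha x * riesz lambda x z.

Lemma slice_energy z : slice z = ((h z * weight alpha z)%:E *
  energy lambda (interaction z f) (interaction z g))%E.
Proof.
pose K (x y : V) := interaction z f x * interaction z g y * edist x y `^ (- lambda).
have K0 x y : 0 <= K x y.
  by rewrite /K /interaction; do !apply: mulr_ge0; rewrite ?powR_ge0 ?f0 ?g0.
have mi u : measurable_fun setT u -> measurable_fun setT (interaction z u).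
  move=> mu'; apply: measurable_funM; first apply: measurable_funM => //.
    exact: measurable_weight.
  by under eq_fun do rewrite rieszC; exact: measurable_rieszr.
have mK : measurable_fun setT (fun w : V * V => K w.1 w.2).
  exact: measurable_funM (measurable_funM (measurableT_comp (mi _ mf) measurable_fst)
    (measurableT_comp (mi _ mg) measurable_snd)) (measurable_riesz _).
have c0 : 0 <= h z * weight alpha z by rewrite mulr_ge0 ?weight_ge0.
have KE x y : triform f g h alpha lambda x y z = h z * weight alpha z * K x y.
  rewrite /triform sw_kernelE !sw_weightE /K /interaction.
  change (edist x y `^ (- lambda)) with (riesz lambda x y).
  move: (riesz lambda x y) (riesz lambda x z) (riesz lambda y z) => k1 k2 k3.
  move: (f x) (g y) (h z) (weight alpha x) (weight alpha y) (weight alpha z) => *.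
  by ring.
have -> : energy lambda (interaction z f) (interaction z g) =
  (\int[mu]_x \int[mu]_y (K x y)%:E)%E by [].
clearbody K; rewrite /slice.
rewrite (eq_integral (fun x => (h z * weight alpha z)%:E * \int[mu]_y (K x y)%:E)%E).
  rewrite ge0_integralZl_EFin//.
  - by move=> x _; apply: integral_ge0 => y _; rewrite lee_fin.
  - apply: (measurable_fun_fubini_tonelli_F (m2 := mu) (fun w : V * V => (K w.1 w.2)%:E)).
      exact/measurable_EFinP.
    by move=> w; rewrite lee_fin.
move=> x _; rewrite -ge0_integral_realZ//.
  by apply: eq_integral => y _; rewrite KE.
exact: (measurableT_comp mK (measurable_pair1 x)).
Qed.

End symmetry.

Lemma energy_ge0 f g : (forall x, 0 <= f x) -> (forall x, 0 <= g x) ->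
  (0 <= energy lambda f g)%E.
Proof.
move=> f0 g0; apply: integral_ge0 => x _; apply: integral_ge0 => y _.
by rewrite lee_fin !mulr_ge0 ?powR_ge0.
Qed.

Section maximizers.
Variable p : R.
Hypotheses (n0 : (0 < n)%N) (p0 : 0 < p) (lambda0 : 0 < lambda).
Variable C : R.
Hypothesis maxC : forall f g h, unit_function p f -> unit_function p g ->
  unit_function p h -> (trilinear f g h <= C%:E)%E.

Lemma edist_gt0_origin (x : V) : x <> origin -> 0 < weight alpha x.
Proof. by move=> xo; rewrite powR_gt0// edist_gt0//; exact/nesym. Qed.

(** Freezing the third variable turns the form into a Riesz energy, so replacing
    [(f, g)] by [(f, f)] and by [(g, g)] cannot decrease the average of the form.
    At a maximum the energies of the slices must agree, and a single slice at
    which [h] and the weight are positive suffices to conclude, by strict positive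
    definiteness. *)
Lemma maximizer_eq12 f g h : unit_function p f -> unit_function p g ->
  unit_function p h -> trilinear f g h = C%:E -> {ae mu, forall x, f x = g x}.
Proof.
move=> uf ug uh fghC; have ffC := maxC uf uf uh; have ggC := maxC ug ug uh.
have [mf f0 _] := uf; have [mg g0 _] := ug; have [mh h0 _] := uh.
have mi u z : measurable_fun setT u -> measurable_fun setT (interaction z u).
  move=> mu'; apply: measurable_funM; first apply: measurable_funM => //.
    exact: measurable_weight.
  by under eq_fun do rewrite rieszC; exact: measurable_rieszr.
have i0 (u : V -> R) z x : (forall x, 0 <= u x) -> 0 <= interaction z u x.
  by move=> u0; rewrite /interaction !mulr_ge0 ?powR_ge0.
have c0 z : 0 <= h z * weight alpha z by rewrite mulr_ge0 ?weight_ge0.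
have en0 (u v : V -> R) z : (forall x, 0 <= u x) -> (forall x, 0 <= v x) ->
    (0 <= energy lambda (interaction z u) (interaction z v))%E.
  by move=> u0 v0; apply: energy_ge0 => x; exact: i0.
have s12E := slice_energy mf mg f0 g0 h0.
have s11E := slice_energy mf mf f0 f0 h0.
have s22E := slice_energy mg mg g0 g0 h0.
have eqle (x y : \bar R) : x = y -> (x <= y)%E by move=> ->.
have d12E z : (slice f g h z + slice f g h z = (h z * weight alpha z)%:E *
    (energy lambda (interaction z f) (interaction z g)
     + energy lambda (interaction z f) (interaction z g)))%E.
  have e := en0 f g z f0 g0.
  exact: (etrans (congr2 adde (s12E z) (s12E z)) (esym (ge0_muleDr _ e e))).
have d1122E z : (slice f f h z + slice g g h z = (h z * weight alpha z)%:E *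
    (energy lambda (interaction z f) (interaction z f)
     + energy lambda (interaction z g) (interaction z g)))%E.
  have e1 := en0 f f z f0 f0; have e2 := en0 g g z g0 g0.
  exact: (etrans (congr2 adde (s11E z) (s22E z)) (esym (ge0_muleDr _ e1 e2))).
have amgm z : (slice f g h z + slice f g h z <= slice f f h z + slice g g h z)%E.
  have c0' : (0 <= (h z * weight alpha z)%:E)%E by rewrite lee_fin.
  have e3 := lee_wpmul2l c0' (energy_amgm n0 lambda0 (mi f z mf) (mi g z mg)
    (fun x => i0 f z x f0) (fun x => i0 g z x g0)).
  exact: (le_trans (eqle _ _ (d12E z)) (le_trans e3 (eqle _ _ (esym (d1122E z))))).
have [eqz finz] := ae_polarization (measurable_slice mf mf mh f0 f0 h0)
  (measurable_slice mf mg mh f0 g0 h0) (measurable_slice mg mg mh g0 g0 h0)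
  (slice_ge0 f0 f0 h0) (slice_ge0 f0 g0 h0) (slice_ge0 g0 g0 h0) amgm
  (etrans (esym (trilinear_slice mf mg mh f0 g0 h0)) fghC)
  (le_trans (eqle _ _ (esym (trilinear_slice mf mf mh f0 f0 h0))) ffC)
  (le_trans (eqle _ _ (esym (trilinear_slice mg mg mh g0 g0 h0))) ggC).
have [z [[ez fz zo] hz]] : exists z, ([/\ (slice f f h z + slice g g h z =
    slice f g h z + slice f g h z)%E, (slice f g h z < +oo)%E & z <> origin]) /\ 0 < h z.
  apply: (unit_function_support p0 uh).
  by apply: filterS3 eqz finz (ae_neq origin n0) => z; split.
have wz : 0 < h z * weight alpha z by exact: (mulr_gt0 hz (edist_gt0_origin zo)).
have [ez' fz'] := pos_cancel wz (etrans (esym (d1122E z)) (etrans ez (d12E z)))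
  (le_lt_trans (eqle _ _ (esym (s12E z))) fz).
have : {ae mu, forall x, interaction z f x = interaction z g x}.
  apply: (energy_strict n0 lambda0 (mi f z mf) (mi g z mg)).
  - by move=> x; exact: i0.
  - by move=> x; exact: i0.
  - exact: (eqle _ _ ez').
  - exact: fz'.
move=> ae1; apply: filterS3 ae1 (ae_neq origin n0) (ae_neq z n0) => x.
rewrite /interaction => e /edist_gt0_origin wx xz.
have kx : 0 < riesz lambda x z by rewrite powR_gt0 ?edist_gt0.
move: e wx kx; move: (f x) (g x) (weight alpha x) (riesz lambda x z) => a b w k e w0 k0.
have wk : w * k != 0 := mulf_neq0 (lt0r_neq0 w0) (lt0r_neq0 k0).
by apply: (mulIf wk); rewrite 2!mulrA.
Qed.

End maximizers.

End trilinear_form.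

(** * The equality case of duality *)

Section duality.
Context d (T : measurableType d) (R : realType).
Variable m : {measure set T -> \bar R}.
Variables (p : R) (F v eta : T -> R).
Hypotheses (p1 : 1 < p) (mF : measurable_fun setT F) (mv : measurable_fun setT v).
Hypotheses (meta : measurable_fun setT eta) (F0 : forall x, 0 <= F x).
Hypotheses (v0 : forall x, 0 <= v x) (eta0 : forall x, 0 < eta x).
Hypothesis etap : (\int[m]_x (eta x `^ p)%:E < +oo)%E.
Hypothesis Fp : (\int[m]_x (F x `^ p)%:E = 1)%E.
Hypothesis Fv : (\int[m]_x (F x * v x)%:E = 1)%E.
Hypothesis dual : forall (h : T -> R) (H : R), measurable_fun setT h ->
  (forall x, 0 <= h x) -> (\int[m]_x (h x `^ p)%:E = H%:E)%E ->
  (\int[m]_x (h x * v x)%:E <= (H / p + (1 - p^-1))%:E)%E.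

(** The pointwise maximiser of [t * v x - t ^ p / p] is [v x ^ (1/(p-1))]; it is
    truncated to remain in the space, but at a height strictly above [F] so that
    [h] improves on [F] wherever [F] is not optimal. *)
Let h x := Num.min (v x `^ (p - 1)^-1) (F x + eta x).

Let h0 x : 0 <= h x.
Proof. by rewrite /h le_min powR_ge0 addr_ge0 // ltW. Qed.

Let improvement x : h x <> F x -> F x * v x + h x `^ p / p < h x * v x + F x `^ p / p.
Proof.
move=> hF; have pn0 : 0 < p by exact: lt_trans p1.
have q0 : p - 1 != 0 by rewrite subr_eq0 gt_eqF.
have Fh : F x <> h x by exact/nesym.
have := strict_young p1 (F0 x) (h0 x) Fh.
have hp : h x `^ p = h x * h x `^ (p - 1).
  have [e|/eqP e] := eqVneq (h x) 0; first by rewrite e mul0r powR0 ?gt_eqF.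
  rewrite -[X in X * _]powRr1// -powRD; last by rewrite (introF eqP e) implybT.
  by congr powR; ring.
have step : (h x - F x) * h x `^ (p - 1) <= (h x - F x) * v x.
  have vE : (v x `^ (p - 1)^-1) `^ (p - 1) = v x.
    by rewrite -powRrM mulVf// powRr1.
  rewrite /h; have [le|/ltW le] := leP (v x `^ (p - 1)^-1) (F x + eta x).
    by rewrite vE.
  have ep : 0 <= F x + eta x by rewrite addr_ge0// ltW.
  apply: ler_wpM2l; first by rewrite addrAC subrr add0r ltW.
  rewrite -[leRHS]vE; apply: ge0_ler_powR; rewrite ?nnegrE ?powR_ge0//.
  by rewrite subr_ge0 ltW.
move: step; rewrite hp; move: (h x) (F x) (v x) (h x `^ _) (F x `^ _) => a b c e g.
by move=> *; lra.
Qed.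

(** Testing duality with [h] gives, after integration, the reverse of the pointwise
    improvement; hence [h = F] almost everywhere, and as [h] is cut strictly above
    [F] it is then the untruncated maximiser. *)
Lemma dual_equality : {ae m, forall x, v x = F x `^ (p - 1)}.
Proof.
have pn0 : 0 < p by exact: lt_trans p1.
have pi0 : 0 <= p^-1 by rewrite invr_ge0 ltW.
have mh : measurable_fun setT h.
  by apply: measurable_minr; [exact: measurable_powRl|exact: measurable_funD].
have mP (g : T -> R) : measurable_fun setT g -> measurable_fun setT (fun x => g x `^ p).
  by move=> mg; exact: measurable_powRl.
have P0 (g : T -> R) x : 0 <= g x `^ p by exact: powR_ge0.
have hp : (\int[m]_x (h x `^ p)%:E < +oo)%E.
  have b0 x : 0 <= 2 `^ p * F x `^ p + 2 `^ p * eta x `^ p.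
    by rewrite addr_ge0// mulr_ge0.
  have hle x : h x `^ p <= 2 `^ p * F x `^ p + 2 `^ p * eta x `^ p.
    have e0 := ltW (eta0 x); have hx : h x <= F x + eta x by rewrite /h ge_min lexx orbT.
    rewrite -!powRM//; have [Fe|/ltW eF] := leP (F x) (eta x).
      apply: (@le_trans _ _ ((2 * eta x) `^ p)); last by rewrite lerDr powR_ge0.
      apply: ge0_ler_powR; rewrite ?nnegrE ?(ltW pn0)//; first by rewrite mulr_ge0.
      by apply: le_trans hx _; rewrite mulr_natl mulr2n lerD2r.
    apply: (@le_trans _ _ ((2 * F x) `^ p)); last by rewrite lerDl powR_ge0.
    apply: ge0_ler_powR; rewrite ?nnegrE ?(ltW pn0)//; first by rewrite mulr_ge0.
    by apply: le_trans hx _; rewrite mulr_natl mulr2n lerD2l.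
  have m1 : measurable_fun setT (fun x => 2 `^ p * F x `^ p).
    by apply: measurable_funM; [exact: measurable_cst|exact: mP].
  have m2 : measurable_fun setT (fun x => 2 `^ p * eta x `^ p).
    by apply: measurable_funM; [exact: measurable_cst|exact: mP].
  have l0 := ge0_le_integral_real m (mP _ mh) (measurable_funD m1 m2) (P0 h) hle.
  apply: (le_lt_trans l0); rewrite ge0_integral_realD//; last 2 first.
  - by move=> x; exact: mulr_ge0.
  - by move=> x; exact: mulr_ge0.
  rewrite !ge0_integral_realZ//; [|exact: mP|exact: mP].
  rewrite Fp mule1; apply: lte_add_pinfty; rewrite ?ltry//.
  by apply: lte_mul_pinfty; rewrite ?lee_fin.
pose H := fine (\int[m]_x (h x `^ p)%:E).
have HE : (\int[m]_x (h x `^ p)%:E = H%:E)%E.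
  by rewrite fineK// ge0_fin_numE//; apply: integral_ge0 => x _; rewrite lee_fin.
have hv := dual mh h0 HE.
have imp := improvement; have hE x : h x = Num.min (v x `^ (p - 1)^-1) (F x + eta x) by [].
clearbody h H.
have ap0 x (g : T -> R) : 0 <= g x `^ p / p by rewrite mulr_ge0.
have mp (g : T -> R) : measurable_fun setT g -> measurable_fun setT (fun x => g x `^ p / p).
  by move=> mg; apply: measurable_funM; [exact: mP|exact: measurable_cst].
have ip (g : T -> R) : measurable_fun setT g ->
    (\int[m]_x (g x `^ p / p)%:E = p^-1%:E * \int[m]_x (g x `^ p)%:E)%E.
  move=> mg; under eq_integral do rewrite mulrC.
  by rewrite ge0_integral_realZ//; exact: mP.
have mhv : measurable_fun setT (fun x => h x * v x) by exact: measurable_funM.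
have mFv : measurable_fun setT (fun x => F x * v x) by exact: measurable_funM.
have hv0 x : 0 <= h x * v x by exact: mulr_ge0.
have Fv0 x : 0 <= F x * v x by exact: mulr_ge0.
have i1 := ge0_integral_realD m mhv (mp _ mF) hv0 (ap0 ^~ F).
have i2 := ge0_integral_realD m mFv (mp _ mh) Fv0 (ap0 ^~ h).
rewrite ip// Fp mule1 in i1; rewrite ip// HE Fv -EFinM -EFinD in i2.
have imp' x : F x * v x + h x `^ p / p <= h x * v x + F x `^ p / p.
  by have [->|/eqP /imp /ltW] := eqVneq (h x) (F x).
have := @ae_eq_of_integral_le _ _ _ m
  (fun x => (h x * v x + F x `^ p / p)%:E) (fun x => (F x * v x + h x `^ p / p)%:E).
move=> /(_ _ _ _ _ _ _) H1.
have : {ae m, forall x, (h x * v x + F x `^ p / p)%:E = (F x * v x + h x `^ p / p)%:E}.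
  apply: H1.
  - by apply/measurable_EFinP; apply: measurable_funD => //; exact: mp.
  - by apply/measurable_EFinP; apply: measurable_funD => //; exact: mp.
  - by move=> x; rewrite lee_fin addr_ge0.
  - by move=> x; rewrite lee_fin.
  - rewrite i1 i2; apply: (@le_trans _ _ ((H / p + (1 - p^-1))%:E + p^-1%:E)%E).
      exact: leeD.
    by rewrite -EFinD lee_fin; lra.
  - by rewrite i2 ltry.
apply: filterS => x [ex].
have hF : h x = F x.
  by apply/eqP; rewrite -[_ == _]negbK; apply/negP => /eqP/imp; rewrite ex ltxx.
have q0 : p - 1 != 0 by rewrite subr_eq0 gt_eqF.
move: hF; rewrite hE => /eqP; rewrite minEle; case: ifPn => _ /eqP.
  by move=> <-; rewrite -powRrM mulVf// powRr1.
by move/eqP; rewrite -subr_eq0 addrAC subrr add0r gt_eqF.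
Qed.

End duality.

(** * The Euler-Lagrange equation *)

Section source.
Context (R : realType) (n : nat).
Local Notation V := (Rn R n).
Variables (alpha lambda : R) (F : V -> R).
Implicit Types h : V -> R.

Definition source (x y z : V) : R :=
  F y * sw_weight alpha y * (F z * sw_weight alpha z) * sw_kernel lambda x y z.

Lemma triform_source h x y z :
  triform h F F alpha lambda x y z = h x * weight alpha x * source x y z.
Proof.
rewrite /source /triform !sw_weightE; move: (sw_kernel _ _ _ _) => K.
move: (h x) (F y) (F z) (weight alpha x) (weight alpha y) (weight alpha z) => *.
by ring.
Qed.

(** Up to the weights of the last two variables, the source is the integrand of
    an unweighted form whose first function is constant. *)
Lemma measurable_source : measurable_fun setT F -> measurable3 source.
Proof.
move=> mF.
have m1 : measurable3 (triform (fun=> 1) F F 0 lambda).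
  by apply: measurable_triform => //; exact: measurable_cst.
have mw : measurable_fun setT (fun x : V => weight alpha x) by exact: measurable_weight.
have : measurable3 (fun x y z => weight alpha y * weight alpha z *
    triform (fun=> 1) F F 0 lambda x y z).
  exact: measurable_funM (measurable_funM (measurableT_comp mw (@measurable_tri2 R n))
    (measurableT_comp mw (@measurable_tri3 R n))) m1.
rewrite /measurable3; congr measurable_fun; apply/funext => w.
rewrite /source /triform !sw_weightE /weight !oppr0 !powRr0.
by move: (sw_kernel _ _ _ _) (_ `^ _) (_ `^ _) (F _) (F _) => *; ring.
Qed.

End source.

Section euler_lagrange.
Context (R : realType) (n : nat).
Local Notation mu := (lebesgue_Rn R n).
Local Notation V := (Rn R n).
Variables (p alpha lambda : R).
Implicit Types h : V -> R.
Hypotheses (n0 : (0 < n)%N) (p1 : 1 < p).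

(** A Gaussian. Pairing with it shows that the potential is finite almost
    everywhere, and it provides the room above [F] in the truncation. *)
Lemma positive_unit_function : exists eta : V -> R,
  unit_function p eta /\ forall x, 0 < eta x.
Proof.
have pn0 : 0 < p by exact: lt_trans p1.
have M0 := gauss_mass_gt0 n pn0; set M := gauss_mass n p in M0.
have MM : M^-1 `^ p^-1 `^ p = M^-1.
  by rewrite -powRrM mulVf ?gt_eqF// powRr1// invr_ge0 ltW.
have c0 : 0 < M^-1 `^ p^-1 by rewrite powR_gt0// invr_gt0.
exists (fun x => M^-1 `^ p^-1 * expR (- (1 * sqdist origin x))).
split; last by move=> x; rewrite mulr_gt0 ?expR_gt0.
have mg : measurable_fun setT (fun x : V => expR (- (1 * sqdist origin x))).
  exact: measurable_gauss.
split; first by apply: measurable_funM => //; exact: measurable_cst.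
  by move=> x; rewrite mulr_ge0 ?expR_ge0 ?ltW.
rewrite (eq_integral (fun x => (M^-1 * expR (- (p * sqdist origin x)))%:E)); last first.
  move=> x _; rewrite powRM ?expR_ge0 ?(ltW c0)// MM; congr (_ * _)%:E.
  by rewrite mul1r /powR gt_eqF ?expR_gt0// expRK; congr expR; ring.
rewrite ge0_integral_realZ ?expR_ge0 ?invr_ge0 ?(ltW M0)//; last first.
  exact: measurable_gauss.
by rewrite integral_gauss// -EFinM mulVf// gt_eqF.
Qed.

Variables (C : R) (F : V -> R).
Hypothesis C0 : 0 < C.
Hypothesis uF : unit_function p F.
Hypothesis maxF : forall h, unit_function p h -> (trilinear alpha lambda h F F <= C%:E)%E.
Hypothesis FC : trilinear alpha lambda F F F = C%:E.

Local Notation source := (source alpha lambda F).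

Definition potential (x : V) : \bar R := (\int[mu]_y \int[mu]_z (source x y z)%:E)%E.

Let mF : measurable_fun setT F. Proof. by case: uF. Qed.
Let F0 x : 0 <= F x. Proof. by case: uF. Qed.

Lemma source_ge0 x y z : 0 <= source x y z.
Proof.
by rewrite /source /sw_kernel /sw_weight; do !apply: mulr_ge0; rewrite ?powR_ge0 ?F0.
Qed.

Lemma potential_ge0 x : (0 <= potential x)%E.
Proof.
by apply: integral_ge0 => y _; apply: integral_ge0 => z _; rewrite lee_fin source_ge0.
Qed.

Lemma measurable_potential : measurable_fun setT potential.
Proof.
apply: (measurable_fun_fubini_tonelli_F (m2 := mu) (fun w : V * V =>
  (\int[mu]_z (source w.1 w.2 z)%:E)%E)).
  exact: measurable3_inner (measurable_source alpha lambda mF) source_ge0.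
by move=> w; apply: integral_ge0 => z _; rewrite lee_fin source_ge0.
Qed.

Lemma potentialE x : potential x = (\int[mu \x mu]_w (source x w.1 w.2)%:E)%E.
Proof.
rewrite (fubini_tonelli1 (m1 := mu) (m2 := mu)
  (fun w : V * V => (source x w.1 w.2)%:E))//.
- apply/measurable_EFinP; apply: (measurable3_comp (measurable_source alpha lambda mF)) => //.
- by move=> w; rewrite lee_fin source_ge0.
Qed.

Lemma trilinear_potential h : measurable_fun setT h -> (forall x, 0 <= h x) ->
  trilinear alpha lambda h F F =
  (\int[mu]_x ((h x * weight alpha x)%:E * potential x))%E.
Proof.
move=> mh h0; rewrite /trilinear /integral3; apply: eq_integral => x _.
have ms := (measurable_source alpha lambda mF); have s0 := source_ge0.
have tE := triform_source alpha lambda F h x.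
rewrite /potential; move: (source) ms s0 tE => S ms s0 tE.
have c0 : 0 <= h x * weight alpha x by rewrite mulr_ge0 ?weight_ge0.
rewrite -ge0_integralZl_EFin//; last 2 first.
- by move=> y _; apply: integral_ge0 => z _; rewrite lee_fin.
- apply: (measurableT_comp (measurable3_inner ms s0) (measurable_pair1 x)).
apply: eq_integral => y _; rewrite -ge0_integral_realZ//.
  by apply: eq_integral => z _; rewrite tE.
by apply: (measurable3_comp ms) => //; exact: measurable_cst.
Qed.

Lemma potential_finite : {ae mu, forall x, (potential x < +oo)%E}.
Proof.
have [eta [ueta eta0]] := positive_unit_function; have [me _ _] := ueta.
have e0 x := ltW (eta0 x).
have := maxF ueta; rewrite (trilinear_potential me e0) => le.
have p0 := potential_ge0.
have w0 x : 0 <= eta x * weight alpha x by rewrite mulr_ge0 ?weight_ge0.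
have g0 x : (0 <= (eta x * weight alpha x)%:E * potential x)%E.
  by rewrite mule_ge0 ?lee_fin.
have : mu.-integrable setT (fun x => (eta x * weight alpha x)%:E * potential x)%E.
  apply/integrableP; split.
    apply: emeasurable_funM; last exact: measurable_potential.
    by apply/measurable_EFinP; apply: measurable_funM => //; exact: measurable_weight.
  under eq_integral do rewrite (gee0_abs (g0 _)).
  by apply: le_lt_trans le _; rewrite ltry.
move/integrable_ae => /(_ measurableT) fin.
apply: filterS2 fin (ae_neq origin n0) => x /(_ I) fx xo.
have wx : 0 < eta x * weight alpha x.
  exact: (mulr_gt0 (eta0 x) (edist_gt0_origin alpha xo)).
move: fx; rewrite ge0_fin_numE// => fx; rewrite ltey; apply/eqP => e.
by move: fx; rewrite e gt0_muley ?lte_fin// ltxx.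
Qed.

(** The weighted potential, divided by [C], has dual norm at most 1, and [F] is a
    unit function at which this norm is attained. *)
Lemma euler_lagrange : {ae mu, forall x,
  (F x `^ (p - 1))%:E = ((C^-1)%:E * (sw_weight alpha x)%:E * potential x)%E}.
Proof.
pose v x := C^-1 * (weight alpha x * fine (potential x)).
have Ci0 : 0 <= C^-1 by rewrite invr_ge0 ltW.
have v0 x : 0 <= v x by rewrite /v !mulr_ge0 ?weight_ge0 ?fine_ge0 ?potential_ge0.
have mv : measurable_fun setT v.
  apply: measurable_funM; first exact: measurable_cst.
  apply: measurable_funM; first exact: measurable_weight.
  exact: (measurableT_comp (@fine_measurable R setT measurableT) measurable_potential).
have vE : {ae mu, forall x, (C * v x)%:E = ((weight alpha x)%:E * potential x)%E}.
  apply: filterS potential_finite => x fx.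
  rewrite /v mulrA mulfV ?gt_eqF// mul1r EFinM fineK// ge0_fin_numE//.
  exact: potential_ge0.
have triE (h : V -> R) : measurable_fun setT h -> (forall x, 0 <= h x) ->
    trilinear alpha lambda h F F = (C%:E * \int[mu]_x (h x * v x)%:E)%E.
  move=> mh h0; rewrite trilinear_potential// -ge0_integral_realZ ?(ltW C0)//; last 2 first.
  - exact: measurable_funM.
  - by move=> x; exact: mulr_ge0.
  apply: ae_eq_integral => //.
  - apply: emeasurable_funM; last exact: measurable_potential.
    by apply/measurable_EFinP; apply: measurable_funM => //; exact: measurable_weight.
  - by apply/measurable_EFinP; do 2!apply: measurable_funM => //.
  - apply: filterS vE => x e _; rewrite EFinM -muleA -e -EFinM; congr EFin; ring.
have pn0 : 0 < p by exact: lt_trans p1.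
have [_ _ Fp] := uF.
have [eta [[meta _ etap] eta0]] := positive_unit_function.
have Cp x y := @lee_pmul2l R C%:E isT C0 x y.
have Fv : (\int[mu]_x (F x * v x)%:E = 1)%E.
  have e : (C%:E * \int[mu]_x (F x * v x)%:E = C%:E * 1)%E by rewrite -triE// mule1.
  by apply/eqP; rewrite eq_le -(Cp _ 1%E) -(Cp 1%E) e lexx.
have := @dual_equality _ _ _ mu p F v eta p1 mF mv meta F0 v0 eta0 _ Fp Fv.
move=> /(_ _ _) concl; have : {ae mu, forall x, v x = F x `^ (p - 1)}.
  apply: concl; first by rewrite etap ltry.
  move=> h H mh h0 HE; have H0 : 0 <= H.
    by rewrite -lee_fin -HE; apply: integral_ge0 => x _; rewrite lee_fin powR_ge0.
  move: H0; rewrite le_eqVlt => /predU1P[H0|H0].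
    have hp0 : (\int[mu]_x (h x `^ p)%:E = 0)%E by rewrite HE -H0.
    have := @ae_eq0_of_integral _ _ _ mu (fun x => (h x `^ p)%:E).
    move=> /(_ _ _ hp0) h1; rewrite (@ae_eq_integral _ _ _ mu setT (cst 0%E))//.
    + by rewrite integral0 lee_fin -H0 mul0r add0r subr_ge0 invf_le1// ltW.
    + by apply/measurable_EFinP; exact: measurable_funM.
    + have := h1 _ _; move=> h2; apply: filterS (h2 _ _).
      * move=> x [/eqP]; rewrite powR_eq0 => /andP[/eqP hx _] _.
        by rewrite hx mul0r.
      * by apply/measurable_EFinP; exact: measurable_powRl.
      * by move=> x; rewrite lee_fin powR_ge0.
  apply: (@le_trans _ _ (H `^ p^-1)%:E); last first.
    by rewrite lee_fin; exact: young_root (ltW H0).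
  have r0 : 0 < H `^ p^-1 by rewrite powR_gt0.
  have ri0 : 0 <= (H `^ p^-1)^-1 by rewrite invr_ge0 ltW.
  pose k x := (H `^ p^-1)^-1 * h x.
  have mk : measurable_fun setT k by apply: measurable_funM => //; exact: measurable_cst.
  have k0 x : 0 <= k x by exact: mulr_ge0.
  have uk : unit_function p k.
    have rp : (H `^ p^-1)^-1 `^ p = H^-1.
      by rewrite -powRN -powRrM mulNr mulVf ?gt_eqF// powRN powRr1// ltW.
    split; [exact: mk|exact: k0|].
    rewrite (eq_integral (fun x => (H^-1 * h x `^ p)%:E)); last first.
      by move=> x _; rewrite /k (powRM _ ri0 (h0 x)) rp.
    rewrite ge0_integral_realZ ?invr_ge0 ?(ltW H0)//; last 2 first.
    - exact: measurable_powRl.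
    - by move=> x; exact: powR_ge0.
    by rewrite HE -EFinM mulVf// gt_eqF.
  have := maxF uk; rewrite (triE _ mk k0) -[leRHS]mule1 Cp.
  have -> : (\int[mu]_x (k x * v x)%:E =
      ((H `^ p^-1)^-1)%:E * \int[mu]_x (h x * v x)%:E)%E.
    rewrite -(ge0_integral_realZ mu (measurable_funM mh mv) ri0
      (fun x => mulr_ge0 (h0 x) (v0 x))).
    by apply: eq_integral => x _; congr EFin; rewrite (mulrA _ (h x) (v x)).
  move: (\int[mu]_x _)%E => I; rewrite -(@lee_pmul2l _ (H `^ p^-1)%:E) ?lte_fin//.
  by rewrite muleA -EFinM mulfV ?gt_eqF// mul1e mule1.
move=> vF; apply: filterS2 vF potential_finite => x <- fx.
rewrite /v -[in RHS](@fineK _ (potential x)) ?ge0_fin_numE ?potential_ge0//.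
by rewrite -!EFinM sw_weightE mulrA.
Qed.

End euler_lagrange.

(** * Extremal triples *)

Lemma ae_conj d (T : measurableType d) (R : realType) (m : {measure set T -> \bar R})
    (P Q : T -> Prop) :
  {ae m, forall x, P x} -> {ae m, forall x, Q x} -> {ae m, forall x, P x /\ Q x}.
Proof. by apply: filterS2. Qed.

Section lebesgue_space.
Context (R : realType) (n : nat).
Local Notation mu := (lebesgue_Rn R n).
Local Notation V := (Rn R n).
Variable p : R.
Hypothesis p1 : 1 < p.

(** Absolute values turn almost everywhere nonnegative functions into everywhere
    nonnegative ones without leaving their class. *)
Lemma Lp_unit_normr (f : V -> R) : Lp_unit p f ->
  measurable_fun setT f /\ unit_function p (fun x => `|f x|).
Proof.
move=> [fL fN]; have mf : measurable_fun setT f.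
  by have := sub_Lfun_mfun fL; rewrite inE.
have pn0 : p != 0 by rewrite gt_eqF// (lt_trans ltr01).
split=> //; split.
- exact: (measurableT_comp (@normr_measurable R setT) mf).
- by move=> x; exact: normr_ge0.
- have := poweR_Lnorm mu (EFin \o f) pn0; rewrite fN poweR1r => ->.
  by apply: eq_integral => x _.
Qed.

Lemma unit_function_Lp (f : V -> R) : unit_function p f -> Lp_unit p f.
Proof.
move=> [mf f0 f1]; have fN : ('N[mu]_(p%:E)[EFin \o f] = 1)%E.
  rewrite unlock /Lnorm -(poweR1r p^-1); congr (_ `^ _)%E.
  by rewrite -f1; apply: eq_integral => x _ /=; rewrite ger0_norm.
split=> //; rewrite inE; apply/andP; split; rewrite inE//=.
by rewrite /finite_norm fN ltry.
Qed.

End lebesgue_space.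

Section stein_weiss_form.
Context (R : realType) (n : nat).
Local Notation mu := (lebesgue_Rn R n).
Local Notation V := (Rn R n).
Variables (alpha lambda : R).

Lemma sw_form_trilinear (f g h : V -> R) : measurable_fun setT f ->
  measurable_fun setT g -> measurable_fun setT h -> (forall x, 0 <= f x) ->
  (forall x, 0 <= g x) -> (forall x, 0 <= h x) ->
  sw_form alpha lambda f g h = trilinear alpha lambda f g h.
Proof.
move=> mf mg mh f0 g0 h0.
exact: (integral3E (measurable_triform alpha lambda mf mg mh)
  (fun x y z => triform_ge0 alpha lambda x y z f0 g0 h0)).
Qed.

Lemma sw_form_ae (f1 f2 f3 g1 g2 g3 : V -> R) :
  measurable_fun setT f1 -> measurable_fun setT f2 -> measurable_fun setT f3 ->
  measurable_fun setT g1 -> measurable_fun setT g2 -> measurable_fun setT g3 ->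
  {ae mu, forall x, f1 x = g1 x} -> {ae mu, forall x, f2 x = g2 x} ->
  {ae mu, forall x, f3 x = g3 x} ->
  sw_form alpha lambda f1 f2 f3 = sw_form alpha lambda g1 g2 g3.
Proof.
move=> mf1 mf2 mf3 mg1 mg2 mg3 e1 e2 e3; rewrite /sw_form.
apply: ae_eq_integral => //.
- apply/measurable_EFinP; exact: (measurable_triform alpha lambda mf1 mf2 mf3).
- apply/measurable_EFinP; exact: (measurable_triform alpha lambda mg1 mg2 mg3).
have a1 := ae_prod_fst mu (ae_prod_fst mu e1 : {ae product_sf mu mu, forall w, _}).
have a2 := ae_prod_fst mu (ae_prod_snd mu e2 : {ae product_sf mu mu, forall w, _}).
have a3 := ae_prod_snd (product_sf mu mu) e3.
by apply: filterS3 a1 a2 a3 => w /= -> -> -> _.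
Qed.

(** The kernel is positive off a null set, so the form cannot vanish. *)
Lemma trilinear_neq0 (p : R) (f g h : V -> R) : (0 < n)%N -> 0 < p ->
  unit_function p f -> unit_function p g -> unit_function p h ->
  trilinear alpha lambda f g h <> 0%E.
Proof.
move=> n0 p0 uf ug uh T0.
have [mf f0 _] := uf; have [mg g0 _] := ug; have [mh h0 _] := uh.
have mt := measurable_triform alpha lambda mf mg mh.
have t0 x y z := triform_ge0 alpha lambda x y z f0 g0 h0.
have mi := measurable3_inner mt t0.
have i0 x y : (0 <= \int[mu]_z (triform f g h alpha lambda x y z)%:E)%E.
  by apply: integral_ge0 => z _; rewrite lee_fin.
have aex : {ae mu, forall x,
    (\int[mu]_y \int[mu]_z (triform f g h alpha lambda x y z)%:E = 0)%E}.
  apply: ae_eq0_of_integral T0.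
  - exact: (measurable_fun_fubini_tonelli_F (m2 := mu) (fun w : V * V =>
      \int[mu]_z (triform f g h alpha lambda w.1 w.2 z)%:E)%E mi (fun w => i0 w.1 w.2)).
  - by move=> x; apply: integral_ge0 => y _; exact: i0.
have [x [[ix xo] fx]] := unit_function_support p0 uf
  (ae_conj aex (ae_neq origin n0)).
have aey := ae_eq0_of_integral (measurableT_comp mi (measurable_pair1 x)) (i0 x) ix.
have [y [[iy [yo yx]] gy]] := unit_function_support p0 ug
  (ae_conj aey (ae_conj (ae_neq origin n0) (ae_neq x n0))).
have mz : measurable_fun setT (fun z => (triform f g h alpha lambda x y z)%:E).
  by apply/measurable_EFinP; apply: (measurable3_comp mt) => //; exact: measurable_cst.
have tz z : (0 <= (triform f g h alpha lambda x y z)%:E)%E by rewrite lee_fin.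
have aez := ae_conj (ae_eq0_of_integral mz tz iy) (ae_neq origin n0).
have [z [[[iz zo] [zx zy]] hz]] := unit_function_support p0 uh
  (ae_conj aez (ae_conj (ae_neq x n0) (ae_neq y n0))).
move: iz => [iz]; suff : 0 < triform f g h alpha lambda x y z by rewrite iz ltxx.
rewrite /triform sw_kernelE !sw_weightE.
have w0 u : u <> origin -> 0 < weight alpha u := @edist_gt0_origin R n alpha u.
have k0 (u v : V) : v <> u -> 0 < riesz lambda u v.
  by move=> vu; rewrite powR_gt0// edist_gt0//; exact/nesym.
exact: (mulr_gt0 (mulr_gt0 (mulr_gt0 (mulr_gt0 fx gy) hz)
  (mulr_gt0 (mulr_gt0 (w0 _ xo) (w0 _ yo)) (w0 _ zo)))
  (mulr_gt0 (mulr_gt0 (k0 _ _ yx) (k0 _ _ zx)) (k0 _ _ zy))).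
Qed.

End stein_weiss_form.

Theorem theorem1p3 (R : realType) (n : nat) (p alpha lambda : R)
  (n_ge1 : (1 <= n)%N)
  (p_gt1 : 1 < p)
  (alpha_ge0 : 0 <= alpha)
  (lambda_gt0 : 0 < lambda)
  (lambda_le : lambda <= n%:R / 2 - alpha)
  (scaling : 1 / p + (alpha + lambda) / n%:R = 1)
  (lambda_lt : lambda < n%:R)
  (alpha_lt : alpha < n%:R / (p / (p - 1)))
  (alpha_2lambda_gt : n%:R / (p / (p - 1)) < alpha + 2 * lambda)
  (lambda3_lt : 3 * lambda < 2 * n%:R)
  (p3 : 1 <= 3 / p)
  (p2 : 1 <= 2 / p)
  (f1 f2 f3 : Rn R n -> R)
  (f1_unit : Lp_unit p f1) (f2_unit : Lp_unit p f2) (f3_unit : Lp_unit p f3)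
  (f1_ge0 : {ae lebesgue_Rn R n, forall x, 0 <= f1 x})
  (f2_ge0 : {ae lebesgue_Rn R n, forall x, 0 <= f2 x})
  (f3_ge0 : {ae lebesgue_Rn R n, forall x, 0 <= f3 x})
  (extremal : sw_form alpha lambda f1 f2 f3
              = sw_best_constant n p alpha lambda) :
  let mu := lebesgue_Rn R n in
  let C := ((sw_best_constant n p alpha lambda)^-1)%E in
  let s := (p - 1)^-1 in
  let U1 := fun x => f1 x `^ (p - 1) in
  let U2 := fun x => f2 x `^ (p - 1) in
  let U3 := fun x => f3 x `^ (p - 1) in
  [/\ {ae mu, forall x, f1 x = f2 x /\ f2 x = f3 x},
      {ae mu, forall x, U1 x = U2 x /\ U2 x = U3 x} &
      {ae mu, forall x, (U1 x)%:E =
        C * (sw_weight alpha x)%:E *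
        \int[mu \x mu]_w
          (U1 w.1 `^ s * sw_weight alpha w.1
           * (U1 w.2 `^ s * sw_weight alpha w.2)
           * sw_kernel lambda x w.1 w.2)%:E}%E].
Proof.
move=> mu C s U1 U2 U3.
have p0 : 0 < p by exact: lt_trans p_gt1.
have [mf1 uF1] := Lp_unit_normr p_gt1 f1_unit.
have [mf2 uF2] := Lp_unit_normr p_gt1 f2_unit.
have [mf3 uF3] := Lp_unit_normr p_gt1 f3_unit.
have absE (f : Rn R n -> R) : {ae mu, forall x, 0 <= f x} -> {ae mu, forall x, f x = `|f x|}.
  by apply: filterS => x fx; rewrite ger0_norm.
pose F1 x := `|f1 x|; pose F2 x := `|f2 x|; pose F3 x := `|f3 x|.
have e1 : {ae mu, forall x, f1 x = F1 x} by exact: absE.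
have e2 : {ae mu, forall x, f2 x = F2 x} by exact: absE.
have e3 : {ae mu, forall x, f3 x = F3 x} by exact: absE.
rewrite -/F1 in uF1; rewrite -/F2 in uF2; rewrite -/F3 in uF3.
clearbody F1 F2 F3.
have [mF1 F10 _] := uF1; have [mF2 F20 _] := uF2; have [mF3 F30 _] := uF3.
have swT (f g h : Rn R n -> R) : unit_function p f -> unit_function p g -> unit_function p h ->
    sw_form alpha lambda f g h = trilinear alpha lambda f g h.
  by move=> [? ? _] [? ? _] [? ? _]; exact: sw_form_trilinear.
have bestE : sw_best_constant n p alpha lambda = trilinear alpha lambda F1 F2 F3.
  rewrite -extremal -(swT _ _ _ uF1 uF2 uF3).
  exact: sw_form_ae.
pose c := fine (trilinear alpha lambda F1 F2 F3).
have T0 : (0 <= trilinear alpha lambda F1 F2 F3)%E.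
  do 3![apply: integral_ge0 => ? _]; rewrite lee_fin.
  exact: (triform_ge0 alpha lambda _ _ _ F10 F20 F30).
have Tc : trilinear alpha lambda F1 F2 F3 = c%:E.
  rewrite /c fineK// ge0_fin_numE//.
  exact: (triform_finite n_ge1 p_gt1 p2 alpha_ge0 lambda_gt0 scaling uF1 uF2 uF3).
have c0 : 0 < c.
  rewrite lt_neqAle -lee_fin -Tc T0 andbT; apply/eqP => c0.
  by apply: (trilinear_neq0 n_ge1 p0 uF1 uF2 uF3 (alpha := alpha) (lambda := lambda));
    rewrite Tc -c0.
have maxC (f g h : Rn R n -> R) : unit_function p f -> unit_function p g -> unit_function p h ->
    (trilinear alpha lambda f g h <= c%:E)%E.
  move=> uf ug uh; rewrite -Tc -bestE -(swT _ _ _ uf ug uh).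
  apply: le_trans (lee_abs _) _; apply: ereal_sup_ubound.
  by exists f, g, h; split => //; exact: unit_function_Lp.
have E12 : {ae mu, forall x, F1 x = F2 x}.
  exact: (maximizer_eq12 n_ge1 p0 lambda_gt0 maxC uF1 uF2 uF3 Tc).
have E23 : {ae mu, forall x, F2 x = F3 x}.
  apply: (maximizer_eq12 n_ge1 p0 lambda_gt0 maxC uF2 uF3 uF1).
  rewrite -Tc -(trilinear_swap12 alpha lambda mF1 mF2 mF3 F10 F20 F30).
  exact: (trilinear_swap23 alpha lambda mF2 mF1 mF3 F20 F10 F30).
have f123 : {ae mu, forall x, f1 x = f2 x /\ f2 x = f3 x}.
  have e123 := ae_conj e1 (ae_conj e2 e3).
  apply: filterS3 e123 E12 E23 => x [h1 [h2 h3]] h12 h23.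
  by split; [rewrite h1 h12 -h2|rewrite h2 h23 -h3].
have F111 : trilinear alpha lambda F1 F1 F1 = c%:E.
  rewrite -Tc -(swT _ _ _ uF1 uF1 uF1) -(swT _ _ _ uF1 uF2 uF3).
  apply: sw_form_ae => //; first exact: filterE.
  by apply: filterS2 E12 E23 => x h12 h23; rewrite h12 h23.
have EL := euler_lagrange n_ge1 p_gt1 c0 uF1 (fun h uh => maxC _ _ _ uh uF1 uF1) F111.
split=> //.
  by apply: filterS f123 => x [h12 h23]; rewrite /U1 /U2 /U3 h12 h23.
have q0 : p - 1 != 0 by rewrite subr_eq0 gt_eqF.
have aeU : {ae mu, forall x, U1 x `^ s = F1 x}.
  by apply: filterS (e1) => y e1y; rewrite /U1 /s e1y -powRrM mulfV// powRr1.
apply: filterS2 e1 EL => x e1x; rewrite -e1x -/(U1 x) => ->.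
rewrite (potentialE alpha lambda uF1) /C bestE Tc inver gt_eqF//; congr (_ * _)%E.
have mU : measurable_fun setT (fun x => U1 x `^ s).
  by apply: measurable_powRl; exact: measurable_powRl.
have msrc (G : Rn R n -> R) : measurable_fun setT G ->
    measurable_fun setT (fun w : Rn R n * Rn R n =>
      (source alpha lambda G x w.1 w.2)%:E).
  move=> mG; apply/measurable_EFinP.
  by apply: (measurable3_comp (measurable_source alpha lambda mG));
    [exact: measurable_cst|exact: measurable_fst|exact: measurable_snd].
apply: ae_eq_integral; [exact: measurableT|exact: msrc mF1|exact: msrc mU|].
have a1 := ae_prod_fst mu aeU; have a2 := ae_prod_snd mu aeU.
by apply: filterS2 a1 a2 => w /= h1 h2 _; rewrite /source h1 h2.
Qed.
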